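(* Let $c$ be a positive integer and let $\mu$ be a $c$-core. For every $x\in[0,\infty)$, $$\sum_{\lambda\in\operatorname{Par}^c_{\mu}}q^{|\lambda|}t^{h_{x,c}^+(\lambda)}=q^{|\mu|}\prod_{i\geq 1}\frac{1}{(1-q^{ic})^{c-1}}\prod_{j\geq1}\frac{1}{1-q^{jc}t},$$ and for every $x\in(0,\infty]$, $$\sum_{\lambda\in\operatorname{Par}^c_{\mu}}q^{|\lambda|}t^{h_{x,c}^-(\lambda)}=q^{|\mu|}\prod_{i\geq 1}\frac{1}{(1-q^{ic})^{c-1}}\prod_{j\geq1}\frac{1}{1-q^{jc}t}.$$
   Context: A partition $\lambda=(\lambda_1\ge\lambda_2\ge\dots\ge\lambda_\ell>0)$ of $n=|\lambda|$ is drawn as a Young diagram with $\lambda_i$ unit boxes in row $i$ (rows stacked upward from the $x$-axis, left-justified at the $y$-axis). For a box $\square$, the arm $a(\square)$ is the number of boxes strictly to its right in its row, the leg $l(\square)$ is the number of boxes strictly above it in its column, and the hook length is $h(\square)=a(\square)+l(\square)+1$. A rimhook of length $c$ is a connected set of $c$ boxes of the diagram containing no $2\times2$ square whose removal leaves the diagram of a partition. A $c$-core is a partition with no rimhook of length $c$ (equivalently no box of hook length $c$); the $c$-core of $\lambda$ is the partition obtained by repeatedly removing rimhooks of length $c$ until none remain (it is well defined). $\operatorname{Par}^c_\mu$ denotes the set of all partitions (of all sizes, including the empty partition when relevant) with $c$-core $\mu$. For $x\in[0,\infty]$, $h^+_{x,c}(\lambda)$ is the number of boxes $\square$ of $\lambda$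 with $c\mid h(\square)$ and $\frac{a(\square)}{l(\square)+1}\le x<\frac{a(\square)+1}{l(\square)}$, and $h^-_{x,c}(\lambda)$ is the number of boxes with $c\mid h(\square)$ and $\frac{a(\square)}{l(\square)+1}< x\le\frac{a(\square)+1}{l(\square)}$; a fraction with denominator $0$ is interpreted as $+\infty$. *)

(* Defs.v *)
From Stdlib Require Import Relations.
From HB Require Import structures.
From mathcomp Require Import all_boot all_order all_algebra.
From mathcomp Require Import finmap boolp reals constructive_ereal.

Set Implicit Arguments.
Unset Strict Implicit.
Unset Printing Implicit Defensive.

Import Order.TTheory GRing.Theory Num.Theory.

Local Open Scope ring_scope.

(* A record rather than a bare function type, so that the ring structure below
   is the Cauchy product and not the pointwise one. *)
Record fps (R : Type) := FPS { fps_coef : nat -> R }.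

HB.instance Definition _ (R : Type) := gen_eqMixin (fps R).
HB.instance Definition _ (R : Type) := gen_choiceMixin (fps R).

Lemma fpsP (R : Type) (f g : fps R) :
  (forall n, fps_coef f n = fps_coef g n) -> f = g.
Proof. by case: f g => [f] [g] /= fg; congr FPS; apply/funext. Qed.

Section FpsRing.
Variable R : comNzRingType.
Implicit Types f g h : fps R.

Definition fps_C (a : R) : fps R := FPS (fun n => if n == 0%N then a else 0).
Definition fps_X : fps R := FPS (fun n => (n == 1%N)%:R).

Definition fps_zero : fps R := FPS (fun=> 0).
Definition fps_opp f := FPS (fun n => - fps_coef f n).
Definition fps_add f g := FPS (fun n => fps_coef f n + fps_coef g n).
Definition fps_mul f g :=
  FPS (fun n => \sum_(i < n.+1) fps_coef f i * fps_coef g (n - i)).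

Fact fps_addA : associative fps_add.
Proof. by move=> f g h; apply: fpsP => n /=; rewrite addrA. Qed.
Fact fps_addC : commutative fps_add.
Proof. by move=> f g; apply: fpsP => n /=; rewrite addrC. Qed.
Fact fps_add0 : left_id fps_zero fps_add.
Proof. by move=> f; apply: fpsP => n /=; rewrite add0r. Qed.
Fact fps_addN : left_inverse fps_zero fps_opp fps_add.
Proof. by move=> f; apply: fpsP => n /=; rewrite addNr. Qed.

HB.instance Definition _ :=
  GRing.isZmodule.Build (fps R) fps_addA fps_addC fps_add0 fps_addN.

Definition fps_trunc n f : {poly R} := \poly_(i < n.+1) fps_coef f i.

Lemma coef_fps_trunc n f m : (m <= n)%N -> (fps_trunc n f)`_m = fps_coef f m.
Proof. by move=> le_mn; rewrite coef_poly ltnS le_mn. Qed.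

Lemma coef_fps_mul_trunc n f g m : (m <= n)%N ->
  fps_coef (fps_mul f g) m = (fps_trunc n f * fps_trunc n g)`_m.
Proof.
move=> le_mn; rewrite coefM; apply: eq_bigr => i _.
rewrite !coef_fps_trunc //; first exact: leq_trans (leq_subr _ _) le_mn.
by apply: leq_trans le_mn; rewrite -ltnS.
Qed.

Fact fps_mulC : commutative fps_mul.
Proof.
by move=> f g; apply: fpsP => n; rewrite !(coef_fps_mul_trunc _ _ (leqnn n)) mulrC.
Qed.

Fact fps_mulA : associative fps_mul.
Proof.
move=> f g h; apply: fpsP => n.
rewrite !(coef_fps_mul_trunc _ _ (leqnn n)).
transitivity ((fps_trunc n f * (fps_trunc n g * fps_trunc n h))`_n).
  rewrite !coefM; apply: eq_bigr => i _; congr (_ * _).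
  by rewrite coef_fps_trunc ?leq_subr // -coef_fps_mul_trunc ?leq_subr.
rewrite mulrA !coefM; apply: eq_bigr => i _; congr (_ * _).
by rewrite -coef_fps_mul_trunc ?coef_fps_trunc // -ltnS.
Qed.

Fact fps_mul1 : left_id (fps_C 1) fps_mul.
Proof.
move=> f; apply: fpsP => n /=.
rewrite big_ord_recl /= mul1r subn0 big1 ?addr0 // => i _.
by rewrite mul0r.
Qed.

Fact fps_mulD : left_distributive fps_mul fps_add.
Proof.
move=> f g h; apply: fpsP => n /=.
by rewrite -big_split; apply: eq_bigr => i _; rewrite mulrDl.
Qed.

Fact fps_1neq0 : fps_C 1 != 0.
Proof.
by apply/eqP => /(congr1 (fun f => fps_coef f 0)) /= /eqP; rewrite oner_eq0.
Qed.

HB.instance Definition _ := GRing.Zmodule_isComNzRing.Build (fps R)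
  fps_mulA fps_mulC fps_mul1 fps_mulD fps_1neq0.

Lemma fps_coefD f g n : fps_coef (f + g) n = fps_coef f n + fps_coef g n.
Proof. by []. Qed.
Lemma fps_coefN f n : fps_coef (- f) n = - fps_coef f n.
Proof. by []. Qed.
Lemma fps_coef1 n : fps_coef (1 : fps R) n = (n == 0%N)%:R.
Proof. by case: n. Qed.
Lemma fps_coefM f g n :
  fps_coef (f * g) n = \sum_(i < n.+1) fps_coef f i * fps_coef g (n - i).
Proof. by []. Qed.
Lemma fps_coef_sum I (r : seq I) (P : pred I) (F : I -> fps R) n :
  fps_coef (\sum_(i <- r | P i) F i) n = \sum_(i <- r | P i) fps_coef (F i) n.
Proof. exact: (big_morph (fun f => fps_coef f n)). Qed.

(* Convergence is coefficientwise, each coefficient being eventually constant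
   (the product of the discrete topologies). *)

Definition fps_has_prod (F : nat -> fps R) (P : fps R) : Prop :=
  forall n, exists N, forall M, (N <= M)%N ->
    fps_coef (\prod_(1 <= i < M.+1) F i) n = fps_coef P n.

(* Unordered sum of the family [F] over the index set [D]: limit along the
   directed set of finite subsets of [D]. *)
Definition fps_has_sum (I : choiceType) (D : I -> Prop) (F : I -> fps R)
    (S : fps R) : Prop :=
  forall n, exists2 A : {fset I}, (forall i, i \in A -> D i) &
    forall B : {fset I}, (A `<=` B)%fset -> (forall i, i \in B -> D i) ->
      fps_coef (\sum_(i <- B) F i) n = fps_coef S n.

End FpsRing.

Arguments fps_X {R}.

Section FpsInverse.
Variable R : comUnitRingType.
Implicit Types f g : fps R.

Definition fps_unit : {pred fps R} := fun f => fps_coef f 0 \is a GRing.unit.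

(* With [u] the inverse of the constant coefficient [f_0], the series
   [g = 1 - u f] has no constant term and [1 / f = u * \sum_k g ^ k]; only the
   terms with [k <= n] contribute to the coefficient of degree [n]. *)
Definition fps_inv f : fps R :=
  if fps_coef f 0 \is a GRing.unit then
    let u := (fps_coef f 0)^-1 in
    FPS (fun n => u * fps_coef (\sum_(k < n.+1) (1 - fps_C u * f) ^+ k) n)
  else f.

Lemma fps_coef_exp_small f k n :
  fps_coef f 0 = 0 -> (n < k)%N -> fps_coef (f ^+ k) n = 0.
Proof.
move=> f0; elim: k n => [//|k IHk] n lt_nk.
rewrite exprS fps_coefM big1 // => -[[|i] /= lt_in] _.
  by rewrite f0 mul0r.
by rewrite IHk ?mulr0 //; move: lt_in lt_nk; rewrite !ltnS; case: n => // n *;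
  rewrite subSS; apply: leq_ltn_trans (leq_subr _ _) _.
Qed.

Lemma fps_coefCM a f n : fps_coef (fps_C a * f) n = a * fps_coef f n.
Proof.
rewrite fps_coefM big_ord_recl /= subn0 big1 ?addr0 // => i _.
by rewrite mul0r.
Qed.

Fact fps_mulV : {in fps_unit, left_inverse 1 fps_inv *%R}.
Proof.
move=> f; rewrite -topredE /= => uf; apply: fpsP => n.
have uf' : fps_coef f 0 \is a GRing.unit by [].
rewrite mulrC /fps_inv uf'.
set u := (fps_coef f 0)^-1; set g := 1 - fps_C u * f.
have g0 : fps_coef g 0 = 0.
  by rewrite fps_coefD fps_coefN fps_coefCM fps_coef1 mulVr ?subrr.
have -> : fps_coef (f * FPS (fun m => u * fps_coef (\sum_(k < m.+1) g ^+ k) m)) n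
    = fps_coef ((fps_C u * f) * \sum_(k < n.+1) g ^+ k) n.
  rewrite [LHS]fps_coefM [RHS]fps_coefM; apply: eq_bigr => i _.
  rewrite fps_coefCM [fps_coef (FPS _) _]/= mulrCA mulrA; congr (_ * _).
  rewrite !fps_coef_sum.
  have le_n : ((n - i).+1 <= n.+1)%N by rewrite ltnS leq_subr.
  rewrite -(big_mkord xpredT (fun k => fps_coef (g ^+ k) (n - i))).
  rewrite -[RHS](big_mkord xpredT (fun k => fps_coef (g ^+ k) (n - i))).
  rewrite [RHS](big_cat_nat _ le_n) //= [X in _ = _ + X]big_nat_cond.
  rewrite [X in _ = _ + X]big1 ?addr0 //.
  by move=> k; rewrite andbT => /andP[lt_k _]; apply: fps_coef_exp_small.
have -> : fps_C u * f = 1 - g by rewrite opprB addrC subrK.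
rewrite -opprB mulNr -subrX1 opprB fps_coefD fps_coefN.
by rewrite (fps_coef_exp_small g0) // subr0.
Qed.

Fact fps_unitP f g : g * f = 1 -> fps_unit f.
Proof.
move=> /(congr1 (fun h => fps_coef h 0)); rewrite fps_coefM big_ord1 /= => gf.
by apply/unitrPr; exists (fps_coef g 0); rewrite mulrC.
Qed.

Fact fps_inv_out : {in [predC fps_unit], fps_inv =1 id}.
Proof. by move=> f /negPf nuf; rewrite /fps_inv [X in if X then _ else _]nuf. Qed.

HB.instance Definition _ := GRing.ComNzRing_hasMulInverse.Build (fps R)
  fps_mulV fps_unitP fps_inv_out.

End FpsInverse.

(* Series in [q] with coefficients in [Z[t]]. *)
Definition q : fps {poly int} := fps_X.
Definition t : fps {poly int} := fps_C 'X.

Definition is_partition (s : seq nat) : bool :=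
  sorted geq s && (0%N \notin s).

Record intpart := Intpart { parts : seq nat; _ : is_partition parts }.

HB.instance Definition _ := [isSub for parts].
HB.instance Definition _ := [Choice of intpart by <:].

Definition psize (la : intpart) : nat := sumn (parts la).

(* The box [(i, j)] lies in row [i] and column [j], both counted from 0. *)
Definition box : Type := (nat * nat)%type.

Definition diagram (la : intpart) : {fset box} :=
  [fset b in [seq (i, j) | i <- iota 0 (size (parts la)),
                           j <- iota 0 (nth 0%N (parts la) i)]]%fset.

Lemma mem_diagram (la : intpart) (i j : nat) :
  ((i, j) \in diagram la) = (j < nth 0%N (parts la) i)%N.
Proof.
rewrite in_fset /=; apply/idP/idP => [/allpairsPdep[i' [j' [_]]]|lt_j].
  by rewrite mem_iota add0n => lt_j [-> ->].
apply/allpairsPdep; exists i, j; split => //; rewrite mem_iota ?add0n //=.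
by case: (ltnP i (size (parts la))) lt_j => // le_s; rewrite nth_default.
Qed.

Definition arm (la : intpart) (b : box) : nat :=
  #|` [fset b' in diagram la | (b'.1 == b.1) && (b.2 < b'.2)%N]%fset |.

Definition leg (la : intpart) (b : box) : nat :=
  #|` [fset b' in diagram la | (b'.2 == b.2) && (b.1 < b'.1)%N]%fset |.

Definition hook (la : intpart) (b : box) : nat := (arm la b + leg la b).+1.

Definition adjacent (b b' : box) : bool :=
  ((b.1 == b'.1) && ((b.2 == b'.2.+1) || (b'.2 == b.2.+1)))
  || ((b.2 == b'.2) && ((b.1 == b'.1.+1) || (b'.1 == b.1.+1))).

Definition connected_boxes (A : {fset box}) : Prop :=
  forall b b', b \in A -> b' \in A ->
    exists p : seq box, [/\ path adjacent b p, last b p = b' & all (mem A) p].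

Definition no_2x2 (A : {fset box}) : Prop :=
  forall i j, ~~ [&& (i, j) \in A, (i.+1, j) \in A,
                     (i, j.+1) \in A & (i.+1, j.+1) \in A].

Definition rimhook (c : nat) (la : intpart) (A : {fset box}) : Prop :=
  [/\ (A `<=` diagram la)%fset, #|` A| = c, connected_boxes A, no_2x2 A
    & exists nu : intpart, diagram nu = (diagram la `\` A)%fset].

Definition remove_rimhook (c : nat) (la nu : intpart) : Prop :=
  exists2 A, rimhook c la A & diagram nu = (diagram la `\` A)%fset.

Definition is_core (c : nat) (la : intpart) : Prop :=
  ~ exists A, rimhook c la A.

Definition has_core (c : nat) (la mu : intpart) : Prop :=
  clos_refl_trans intpart (remove_rimhook c) la mu /\ is_core c mu.

Definition Par (c : nat) (mu : intpart) : intpart -> Prop :=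
  fun la => has_core c la mu.

Section Statistics.
Variable R : realType.
Local Open Scope ereal_scope.

Definition efrac (m n : nat) : \bar R :=
  if n == 0%N then +oo else (m%:R / n%:R)%:E.

Definition hplus (x : \bar R) (c : nat) (la : intpart) : nat :=
  #|` [fset b in diagram la |
       [&& (c %| hook la b)%N,
           efrac (arm la b) (leg la b).+1 <= x
         & x < efrac (arm la b).+1 (leg la b)]]%fset |.

Definition hminus (x : \bar R) (c : nat) (la : intpart) : nat :=
  #|` [fset b in diagram la |
       [&& (c %| hook la b)%N,
           efrac (arm la b) (leg la b).+1 < x
         & x <= efrac (arm la b).+1 (leg la b)]]%fset |.

End Statistics.

(* Main.v *)
Require Import Defs.
From Stdlib Require Import Relations.
From HB Require Import structures.
From mathcomp Require Import all_boot all_order all_algebra.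
From mathcomp Require Import finmap boolp reals constructive_ereal.
From mathcomp Require Import zify ring.

(* The boundary of a partition is a word in horizontal and vertical steps, and
   a box is a horizontal step followed later by a vertical one. For x = r/s, map
   the lattice to a cylinder by (level s X - r Y, number of steps mod c). A
   box with c | h and a/(l+1) = x is then a pair of steps ending at the same
   vertex, one with c | h and (a+1)/l = x is a pair of steps starting at the same
   vertex, and the boxes common to h^+ and h^- are the pairs whose levels differ
   by less than r + s. Fix the multiset of edges of the walk on the cylinder. It
   determines the size, the core and, by a telescoping argument, the number of
   common boxes. The enumerators of Eulerian trails by inversions of departures
   and by inversions of arrivals are both explicit products times a determinant
   of Laplacian type; the two matrices are conjugate up to transposition, so the
   enumerators agree. Hence h^+_x and h^-_x are equidistributed at every rational
   x > 0 on partitions of given size and core, and moving x down through the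
   finitely many critical values reduces every case to h^+_0. There, removing c
   equal rows at a time splits off the factors 1 - q^(jc) t, and what remains is
   the case t = 1, which is counted on an abacus with c runners. *)

Set Implicit Arguments.
Unset Strict Implicit.
Unset Printing Implicit Defensive.

Import Order.TTheory GRing.Theory Num.Theory.
Local Open Scope ring_scope.

(** The trail formula is a weighted BEST theorem. Among the orders of E [true] and S [false]
    departures from a vertex, enumerated by inversions, those ending in [true] make up the fraction
    [E]/[E+S] of the t-binomial coefficient, and those ending in [false] the fraction t^E [S]/[E+S].
    The last departures from the vertices other than the endpoint form a tree directed to the
    endpoint, so these fractions act as edge weights of a Laplacian. Trees are never handled: the
    closed formula is checked against the first-step recursion, which forces open trails into the
    induction. Arrival inversions are departure inversions of the reversed walk. Reversal moves the
    power of t from one outgoing edge to the other, and a potential absorbs the change; it is well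
    defined because the backward rays leave the walk for good, levels being free to grow on a
    cylinder. Padding the diagram to a rectangle with sides proportional to r and s and divisible by
    c closes every boundary walk at its start, which reversal requires. Division is avoided
    throughout: factorials are moved to the other side and series are compared up to a degree. *)

(** * Words in two letters and their walks *)

Fixpoint words (k : nat) : seq (seq bool) :=
  if k is k'.+1 then
    [seq true :: w | w <- words k'] ++ [seq false :: w | w <- words k']
  else [:: [::]].

Lemma mem_words k w : (w \in words k) = (size w == k).
Proof.
elim: k w => [|k IHk] w /=; first by rewrite inE; case: w.
rewrite mem_cat; case: w => [|b w] /=.
  by apply/negP => /orP[] /mapP[].
rewrite eqSS -IHk; have inj (b' : bool) : injective (cons b') by move=> ? ? [].
have notin b1 b2 s : b1 != b2 -> (b1 :: w \in [seq b2 :: v | v <- s]) = false.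
  by move=> ne; apply/negP => /mapP[v _ [/eqP e _]]; rewrite e in ne.
by case: b; rewrite (mem_map (inj _)) notin ?orbF.
Qed.

Lemma words_uniq k : uniq (words k).
Proof.
elim: k => [//|k IHk] /=.
have inj (b' : bool) : injective (cons b') by move=> ? ? [].
rewrite cat_uniq !(map_inj_uniq (inj _)) IHk andbT /=.
by apply/hasPn => w /mapP[v _ ->]; apply/negP => /mapP[].
Qed.

Section Walk.
Variables (V : zmodType) (d : bool -> V).

Fixpoint edges (v : V) (w : seq bool) : seq (V * bool) :=
  if w is b :: w' then (v, b) :: edges (v + d b) w' else [::].

(* Inversions of the departures: pairs of a [true] step followed later by a
   [false] step from the same vertex. *)
Fixpoint dinv (v : V) (w : seq bool) : nat :=
  if w is b :: w' then
    (b * count_mem (v, false) (edges (v + d b) w') + dinv (v + d b) w')%N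
  else 0%N.

(* Inversions of the arrivals: pairs of a [true] step followed later by a
   [false] step ending at the same vertex. *)
Fixpoint ainv (v : V) (w : seq bool) : nat :=
  if w is b :: w' then
    (b * count_mem ((v + d true - d false)%R, false) (edges (v + d b)%R w')
     + ainv (v + d b)%R w')%N
  else 0%N.

Definition wend (v : V) (w : seq bool) : V := v + \sum_(b <- w) d b.

Lemma size_edges v w : size (edges v w) = size w.
Proof. by elim: w v => //= b w IHw v; rewrite IHw. Qed.

Lemma edges_rcons v w b :
  edges v (rcons w b) = rcons (edges v w) (wend v w, b).
Proof.
rewrite /wend; elim: w v => [|b' w IHw] v /=; first by rewrite big_nil addr0.
by rewrite IHw big_cons addrA.
Qed.

Lemma wend_cons v b w : wend v (b :: w) = wend (v + d b) w.
Proof. by rewrite /wend big_cons addrA. Qed.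

Lemma wend_rcons v b w : wend v (rcons w b) = wend v w + d b.
Proof. by rewrite /wend -cats1 big_cat big_seq1 addrA. Qed.

Lemma unzip2_edges v w : unzip2 (edges v w) = w.
Proof. by elim: w v => //= b w IHw v; rewrite IHw. Qed.

Lemma dinv_rcons v w b : dinv v (rcons w b) =
  (dinv v w + ~~ b * count_mem (wend v w, true) (edges v w))%N.
Proof.
elim: w v => [|b' w IHw] v /=; first by rewrite !muln0.
rewrite IHw edges_rcons -cats1 count_cat /= wend_cons addn0.
rewrite mulnDr -!addnA; congr (_ + _)%N; rewrite addnCA; congr (_ + _)%N.
rewrite mulnDr; congr (_ + _)%N.
rewrite !xpair_eqE eqb_id; clear IHw; case: b b' => [] [] //=;
  by rewrite ?andbF ?andbT ?mul0n ?mul1n //= eq_sym.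
Qed.

End Walk.

(** * Counting Eulerian trails by departure inversions *)

Definition tq : {poly int} := 'X.
Definition tint (k : nat) : {poly int} := \sum_(i < k) tq ^+ i.
Definition tfact (k : nat) : {poly int} := \prod_(i < k) tint i.+1.

Lemma tint0 : tint 0 = 0. Proof. exact: big_ord0. Qed.
Lemma tint1 : tint 1 = 1. Proof. exact: big_ord1. Qed.
Lemma tintS k : tint k.+1 = 1 + tq * tint k.
Proof.
rewrite /tint big_ord_recl expr0; congr (_ + _).
by rewrite big_distrr; apply: eq_bigr => i _; rewrite exprS.
Qed.
Lemma tintD a b : tint (a + b) = tint a + tq ^+ a * tint b.
Proof.
elim: a => [|a IHa]; first by rewrite tint0 add0r expr0 mul1r.
by rewrite addSn !tintS IHa exprS; ring.
Qed.
Lemma tfactS k : tfact k.+1 = tint k.+1 * tfact k.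
Proof. by rewrite /tfact big_ord_recr mulrC. Qed.
Lemma tint_neq0 k : tint k.+1 != 0.
Proof.
apply/eqP => /(congr1 (fun p : {poly int} => p.[0])).
by rewrite tintS /tq hornerD hornerM hornerX mul0r addr0 -polyC1 hornerC horner0.
Qed.
Lemma tfact_neq0 k : tfact k != 0.
Proof. by apply/prodf_neq0 => i _; apply: tint_neq0. Qed.

Section Trails.
Variables (V : finZmodType) (d : bool -> V) (rho : V).
Implicit Types (n : V * bool -> nat) (u v : V) (w : seq bool).

Definition trailsum (k : nat) n (v : V) : {poly int} :=
  \sum_(w <- words k | [forall e, count_mem e (edges d v w) == n e])
     tq ^+ dinv d v w.

Definition outdeg n u := (n (u, true) + n (u, false))%N.
Definition indeg n u := (n ((u - d true)%R, true) + n ((u - d false)%R, false))%N.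
(** Euler's condition for a trail from [v] to [rho]; in the induction the start moves and the end
    stays. *)
Definition balanced n v :=
  forall u, (outdeg n u + (u == rho) = indeg n u + (u == v))%N.
Definition deledge n e : V * bool -> nat := fun e' => (n e' - (e' == e))%N.

(** Each edge weight is proportional to the inversion enumerator of the departure orders at [u] that
    end in this edge; the two weights add up to [tint (outdeg n u)]. Unit rows and columns at [rho]
    produce the reduced determinant, and the unit rows at vertices without departures keep the
    unvisited part of [V] from annihilating it. *)
Definition lapl n (u w : V) : {poly int} :=
  if [|| u == rho, w == rho | outdeg n u == 0%N] then (u == w)%:R else
  tint (outdeg n u) * (u == w)%:R
  - tint (n (u, true)) * (u + d true == w)%:R
  - tq ^+ n (u, true) * tint (n (u, false)) * (u + d false == w)%:R.
(** A first [true] step is inverted with every one of the [n (v, false)] departures still to come, a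
    first [false] step with none. *)
Lemma trailsumS k n v : trailsum k.+1 n v =
  \sum_(b : bool | (0 < n (v, b))%N)
     tq ^+ (b * n (v, false)) * trailsum k (deledge n (v, b)) (v + d b).
Proof.
rewrite /trailsum /= big_cat !big_map /= big_mkcond [RHS]big_mkcond big_bool /=.
rewrite [X in _ + X]big_mkcond /=.
have step b w :
  [forall e, count_mem e (edges d v (b :: w)) == n e] =
  (0 < n (v, b))%N && [forall e, count_mem e (edges d (v + d b) w) == deledge n (v, b) e].
  apply/forallP/andP => [H|[lt0 /forallP H] e].
    have := H (v, b); rewrite /= eqxx => /eqP Hb; rewrite -Hb; split=> //.
    apply/forallP => e; rewrite /deledge -(eqP (H e)) /=.
    by rewrite [e == _]eq_sym addKn.
  move/eqP: (H e) => /= ->; rewrite /deledge [e == _]eq_sym.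
  by case: ((v, b) =P e) => [<-|_]; rewrite ?subn0 ?add0n // addnC subnK.
move: step => /= step; congr (_ + _).
- case: ifP => lt0; last first.
    by rewrite big1_seq // => w /andP[]; rewrite step lt0.
  rewrite mul1n big_distrr /= [RHS]big_mkcond [LHS]big_mkcond.
  apply: eq_bigr => w _; rewrite step lt0 /=.
  case: ifP => // /forallP H; rewrite mul1n exprD; congr (_ ^+ _ * _).
  by rewrite (eqP (H _)) /deledge xpair_eqE /= andbF subn0.
- case: ifP => lt0; last first.
    by rewrite big1_seq // => w /andP[]; rewrite step lt0.
  rewrite mul0n mul1r [RHS]big_mkcond [LHS]big_mkcond.
  by apply: eq_bigr => w _; rewrite step lt0 /= mul0n.
Qed.

End Trails.

Section VertexDeterminant.
Variables (V : finType) (A : idomainType).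
Implicit Types (L M : V -> V -> A) (u v w : V).

Definition vmx L : 'M[A]_#|V| := \matrix_(i, j) L (enum_val i) (enum_val j).
Definition vdet L := \det (vmx L).

Lemma vdet_linear L M1 M2 v a b :
  (forall w, L v w = a * M1 v w + b * M2 v w) ->
  (forall u w, u != v -> M1 u w = L u w) ->
  (forall u w, u != v -> M2 u w = L u w) ->
  vdet L = a * vdet M1 + b * vdet M2.
Proof.
move=> Lv L1 L2.
have other (i : 'I_#|V|.-1) : enum_val (lift (enum_rank v) i) != v.
  by rewrite -[v in _ != v]enum_rankK (inj_eq enum_val_inj) eq_sym neq_lift.
apply: (determinant_multilinear (i0 := enum_rank v)).
- by apply/rowP => j; rewrite !mxE enum_rankK Lv.
- by apply/matrixP => i j; rewrite !mxE L1.
- by apply/matrixP => i j; rewrite !mxE L2.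
Qed.

Lemma eq_vdet L M : (forall u w, L u w = M u w) -> vdet L = vdet M.
Proof. by move=> LM; congr (\det _); apply/matrixP => i j; rewrite !mxE. Qed.

(** Expansion along column [v] leaves one cofactor, and that cofactor does not see row [v]. *)
Lemma vdet_isolated_col L M v :
  L v v = M v v -> (forall u, u != v -> L u v = 0) ->
  (forall u w, u != v -> L u w = M u w) -> vdet L = vdet M.
Proof.
move=> Lvv L0 LM; rewrite /vdet !(expand_det_col _ (enum_rank v)).
apply: eq_bigr => i _; have [->|ne] := eqVneq i (enum_rank v).
  rewrite !mxE !enum_rankK Lvv; congr (_ * (_ * \det _)).
  apply/matrixP => i' j; rewrite !mxE LM //.
  by rewrite -[v in _ != v]enum_rankK (inj_eq enum_val_inj) eq_sym neq_lift.
have nev : enum_val i != v.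
  by apply: contraNneq ne => <-; rewrite enum_valK.
by rewrite !mxE enum_rankK -LM // L0 // !mul0r.
Qed.

Lemma vdet_kernel L (x : V -> A) v :
  x v != 0 -> (forall u, \sum_w L u w * x w = 0) -> vdet L = 0.
Proof.
move=> xv Lx; apply/eqP; rewrite /vdet -det_tr; apply/det0P.
exists (\row_j x (enum_val j)).
  by apply: contraNneq xv => /rowP/(_ (enum_rank v)); rewrite !mxE enum_rankK => ->.
apply/rowP => i; rewrite !mxE -[RHS](Lx (enum_val i)).
rewrite [RHS](reindex _ (onW_bij _ (@enum_val_bij V))) /=.
by apply: eq_bigr => j _; rewrite !mxE mulrC.
Qed.

(* The hypothesis makes [M] conjugate to the transpose of [L] by [diag_mx x]. *)
Lemma vdet_gauge L M (x : V -> A) :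
  (forall u, x u != 0) -> (forall u w, x u * M w u = x w * L u w) ->
  vdet M = vdet L.
Proof.
move=> x0 xLM; pose D := diag_mx (\row_j x (enum_val j) : 'rV_#|V|).
have D0 : \det D != 0.
  by rewrite det_diag; apply/prodf_neq0 => i _; rewrite mxE.
apply: (mulfI D0); rewrite /vdet -[\det (vmx M)]det_tr [RHS]mulrC -!det_mulmx.
congr (\det _); apply/matrixP => i j.
by rewrite mul_diag_mx mul_mx_diag !mxE xLM mulrC.
Qed.

End VertexDeterminant.

Section TrailFormula.
Variables (V : finZmodType) (d : bool -> V) (rho : V).
Implicit Types (n : V * bool -> nat) (u v : V) (e : V * bool).

Definition edge_fact n : {poly int} := \prod_e tfact (n e).
(** Away from [rho] the last departure belongs to the tree of last exits and the others are free; at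
    [rho], where the trail ends, all are free. *)
Definition vertex_fact n : {poly int} :=
  tfact (outdeg n rho) * \prod_(u | u != rho) tfact (outdeg n u).-1.

Lemma deledge_neq n e e' : e' != e -> deledge n e e' = n e'.
Proof. by rewrite /deledge => /negPf ->; rewrite subn0. Qed.

Lemma deledge_id n e : deledge n e e = (n e).-1.
Proof. by rewrite /deledge eqxx subn1. Qed.

Lemma edge_fact_del n e :
  tint (n e) * edge_fact (deledge n e) = (0 < n e)%:R * edge_fact n.
Proof.
rewrite /edge_fact (bigD1 e) //= [in RHS](bigD1 e) //= deledge_id.
case: (n e) => [|m] /=; first by rewrite tint0 !mul0r.
rewrite mul1r tfactS mulrA; congr (_ * _).
by apply: eq_bigr => e' ne; rewrite deledge_neq.
Qed.

Lemma sum_deledge n e k :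
  (0 < n e -> \sum_e' n e' = k.+1 -> \sum_e' deledge n e e' = k)%N.
Proof.
move=> n0; rewrite (bigD1 e) //= [in X in _ -> X](bigD1 e) //= deledge_id.
rewrite [in X in _ -> X](eq_bigr n); last by move=> e' ne; rewrite deledge_neq.
by case: (n e) n0 => // m _ [].
Qed.

(** Against [edge_fact], deleting an edge costs the t-integer of its multiplicity. This is zero for
    an absent edge, so both letters can be written without a case distinction. *)
Lemma trailsum_rec k n v :
  trailsum d k.+1 n v * edge_fact n =
  tq ^+ n (v, false) * tint (n (v, true)) *
     (trailsum d k (deledge n (v, true)) (v + d true)
        * edge_fact (deledge n (v, true))) +
  tint (n (v, false)) *
     (trailsum d k (deledge n (v, false)) (v + d false)
        * edge_fact (deledge n (v, false))).
Proof.
rewrite trailsumS big_mkcond big_bool /= mul1n mul0n expr0 mul1r.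
rewrite mulrDl; congr (_ + _).
  rewrite -!mulrA [tint _ * _]mulrCA edge_fact_del.
  by case: ltnP => _ /=; ring.
rewrite [RHS]mulrCA edge_fact_del.
by case: ltnP => _ /=; ring.
Qed.

Lemma outdeg_deledge n v b u : u != v ->
  outdeg (deledge n (v, b)) u = outdeg n u.
Proof.
by move=> ne; rewrite /outdeg !deledge_neq // xpair_eqE negb_and ne.
Qed.

Lemma outdeg_deledge_id n v b : (0 < n (v, b))%N ->
  outdeg (deledge n (v, b)) v = (outdeg n v).-1.
Proof.
rewrite /outdeg /deledge !xpair_eqE eqxx /=.
by case: b => /=; lia.
Qed.

Lemma balanced_deledge n v b : (0 < n (v, b))%N -> balanced d rho n v ->
  balanced d rho (deledge n (v, b)) (v + d b).
Proof.
move=> n0 bal u; move: (bal u).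
have indegE : indeg d (deledge n (v, b)) u = (indeg d n u - (u == v + d b)%R)%N.
  rewrite /indeg /deledge !xpair_eqE; case: b n0 => n0 /=.
    rewrite andbT andbF subn0 subr_eq; case: eqP => [->|_] /=; rewrite ?subn0 //.
    by rewrite addrK; lia.
  rewrite andbT andbF subn0 subr_eq; case: eqP => [->|_] /=; rewrite ?subn0 //.
  by rewrite addrK; lia.
have ind0 : u = v + d b -> (0 < indeg d n u)%N.
  by move=> ->; rewrite /indeg; case: b n0 {indegE} => n0; rewrite addrK addn_gt0 n0 ?orbT.
rewrite {}indegE; case: (eqVneq u v) => [e|ne].
  subst u; rewrite outdeg_deledge_id //.
  have : (0 < outdeg n v)%N.
    by rewrite /outdeg; case: b n0 {ind0} => n0; rewrite addn_gt0 n0 ?orbT.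
  by case: (_ =P v + d b) ind0 => [e /(_ e)|_ _] /=; lia.
rewrite outdeg_deledge //.
by case: (_ =P v + d b) ind0 => [e /(_ e)|_ _] /=; lia.
Qed.

Lemma lapl_deledge n v b u w : u != v ->
  lapl d rho (deledge n (v, b)) u w = lapl d rho n u w.
Proof.
move=> ne; rewrite /lapl outdeg_deledge // !deledge_neq //.
  by rewrite xpair_eqE negb_and ne.
by rewrite xpair_eqE negb_and ne.
Qed.

Lemma vertex_fact_root n b : (0 < n (rho, b))%N ->
  vertex_fact n = tint (outdeg n rho) * vertex_fact (deledge n (rho, b)).
Proof.
move=> n0; rewrite /vertex_fact mulrA outdeg_deledge_id //.
have : (0 < outdeg n rho)%N by rewrite /outdeg; case: b n0 => n0; rewrite addn_gt0 n0 ?orbT.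
case: outdeg => // m _ /=; rewrite tfactS; congr (_ * _).
by apply: eq_bigr => u ne; rewrite outdeg_deledge.
Qed.

Lemma vertex_fact_nonroot n v b : v != rho -> (0 < n (v, b))%N ->
  tint (outdeg n v).-1 * vertex_fact (deledge n (v, b)) =
  (1 < outdeg n v)%:R * vertex_fact n.
Proof.
move=> ne n0; rewrite /vertex_fact outdeg_deledge 1?eq_sym // !mulrA.
rewrite (bigD1 v) //= [in RHS](bigD1 v) //= outdeg_deledge_id //.
rewrite (eq_bigr (fun u => tfact (outdeg n u).-1)); last first.
  by move=> u /andP[_ neu]; rewrite outdeg_deledge.
case: (outdeg n v) => [|[|m]] /=; rewrite ?tint0 ?mul0r // mul1r tfactS.
by ring.
Qed.

Lemma indeg_head n u b : (0 < n (u, b))%N -> (0 < indeg d n (u + d b)%R)%N.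
Proof. by rewrite /indeg; case: b => n0; rewrite addrK addn_gt0 n0 ?orbT. Qed.

Lemma sum_delta (x : V -> {poly int}) u :
  \sum_w (u == w)%:R * x w = x u.
Proof.
rewrite (bigD1 u) //= eqxx mul1r big1 ?addr0 // => w.
by rewrite eq_sym => /negPf ->; rewrite mul0r.
Qed.

(** No edge meets [rho], so no trail from [rho] exists and the determinant has to vanish: the
    indicator of the vertices with departures lies in the kernel, since no row loses a term to the
    deleted root column. *)
Lemma vdet_lapl_unreached n : balanced d rho n rho -> outdeg n rho = 0%N ->
  (0 < \sum_e n e)%N -> vdet (lapl d rho n) = 0.
Proof.
move=> bal out0; rewrite lt0n sum_nat_eq0 negb_forall => /existsP[[v b] nv].
have outin u : outdeg n u = indeg d n u by move: (bal u); lia.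
pose x u : {poly int} := (0 < outdeg n u)%:R.
have xrho : x rho = 0 by rewrite /x out0.
have head u b' : tint (n (u, b')) * x (u + d b') = tint (n (u, b')).
  have [n0|] := ltnP 0 (n (u, b')); last first.
    by rewrite leqn0 => /eqP ->; rewrite tint0 mul0r.
  by rewrite /x outin indeg_head // mulr1.
apply: (@vdet_kernel _ _ _ x v).
  by rewrite /x /outdeg (_ : (0 < _)%N) ?oner_eq0 //; case: b nv => /=; lia.
move=> u; case: (eqVneq (outdeg n u) 0%N) => [u0|u0].
  under eq_bigr do rewrite /lapl u0 !orbT.
  by rewrite sum_delta /x u0.
have urho : u != rho by apply: contraNneq u0 => ->; apply/eqP.
under eq_bigr => w _.
  have -> : lapl d rho n u w * x w =
    tint (outdeg n u) * ((u == w)%:R * x w)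
    - tint (n (u, true)) * ((u + d true == w)%:R * x w)
    - tq ^+ n (u, true) * tint (n (u, false)) * ((u + d false == w)%:R * x w).
    rewrite /lapl (negPf urho) (negPf u0) orbF /=.
    by case: eqP => [->|_] /=; [rewrite xrho !mulr0 !subr0 | ring].
  over.
rewrite /= !sumrB -!big_distrr /= !sum_delta -mulrA !head.
rewrite {1}/x lt0n u0 mulr1 {1}/outdeg tintD; ring.
Qed.

(** This is the row version of the first-step recursion: row [v] is the only row that the deletion
    of an edge at [v] alters. *)
Lemma lapl_row_rec n v w (N := tint (outdeg n v).-1)
    (E := n (v, true)) (S := n (v, false)) :
  v != rho -> (1 < outdeg n v)%N ->
  N * lapl d rho n v w =
    tq ^+ S * tint E * lapl d rho (deledge n (v, true)) v w
    + tint S * lapl d rho (deledge n (v, false)) v w.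
Proof.
move=> vrho; rewrite {}/N.
have := @outdeg_deledge_id n v false; have := @outdeg_deledge_id n v true.
rewrite /lapl (negPf vrho) /= !deledge_id !(@deledge_neq _ (v, _) (v, _)); first last.
- by rewrite xpair_eqE andbF.
- by rewrite xpair_eqE andbF.
have [->|_] := eqVneq w rho; first by rewrite (negPf vrho) !mulr0 addr0.
rewrite -/E -/S; have -> : outdeg n v = (E + S)%N by [].
rewrite {}/E {}/S; case: (n (v, true)) (n (v, false)) => [|e] [|s] //= outt outf lt1; rewrite ?tint0 ?mul0r ?mulr0 ?add0r ?addr0.
- rewrite outf // ?add0n /=; case: s {outt outf} lt1 => // s _ /=.
  rewrite expr0; ring.
- rewrite outt // ?addn0 /=; case: e {outt outf} lt1 => // e _ /=.
  rewrite expr0; ring.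
rewrite outt // outf // addSn addnS /= -addSn {outt outf lt1}.
set N := tint (e.+1 + s).
(* The three identities compare the coefficients of the diagonal and of the two edges. Each splits
   one t-integer with the [false] part first, as [s+1] + t^(s+1) [e] or a shift of it. *)
have NX : N * tint (e.+2 + s) = tq ^+ s.+1 * tint e.+1 * N + tint s.+1 * N.
  by rewrite addSnnS addnC tintD; ring.
have NY : N * tint e.+1 = tq ^+ s.+1 * tint e.+1 * tint e + tint s.+1 * tint e.+1.
  by rewrite /N addSnnS addnC tintD; ring.
have NZ : N * tq ^+ e.+1 * tint s.+1 =
    tq ^+ s.+1 * tint e.+1 * tq ^+ e * tint s.+1
    + tint s.+1 * tq ^+ e.+1 * tint s.
  by rewrite /N addnC tintD !exprS; ring.
move: NX NY NZ; set X := tint (e.+2 + s); set Y := tint e.+1; set Z := tint s.+1.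
move=> NX NY NZ; set x := (v == w)%:R; set y := (_ == w)%:R; set z := (_ == w)%:R.
transitivity (N * X * x - N * Y * y - N * tq ^+ e.+1 * Z * z); first by ring.
by rewrite NX NY NZ; ring.
Qed.

Lemma combine_terms (N a x1 x2 P1 P2 P D1 D2 : {poly int}) :
  x1 * P1 * N = x1 * P -> x2 * P2 * N = x2 * P ->
  (a * (x1 * (P1 * D1)) + x2 * (P2 * D2)) * N = P * (a * x1 * D1 + x2 * D2).
Proof.
move=> e1 e2; transitivity (a * D1 * (x1 * P1 * N) + D2 * (x2 * P2 * N)).
  by ring.
by rewrite e1 e2; ring.
Qed.

(* Both sides satisfy the same recursion on the first step: deleting an edge that
   leaves [v] changes only the row [v] of the Laplacian, in which the
   determinant is linear. *)
Lemma trailsum_vdet k n v : (\sum_e n e = k)%N -> balanced d rho n v ->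
  trailsum d k n v * edge_fact n = vertex_fact n * vdet (lapl d rho n).
Proof.
elim: k n v => [|k IHk] n v sumn bal.
  have n0 e : n e = 0%N.
    by move/eqP: sumn; rewrite sum_nat_eq0 => /forallP/(_ e)/eqP.
  have out0 u : outdeg n u = 0%N by rewrite /outdeg !n0.
  have vrho : v = rho.
    have := bal v; rewrite /outdeg /indeg !n0 eqxx.
    by case: eqP.
  rewrite /trailsum /= big_cons big_nil addr0.
  rewrite (_ : [forall e, _]); last by apply/forallP => e; rewrite /= n0.
  rewrite /edge_fact big1 => [|e _]; last by rewrite n0 /tfact big_ord0.
  rewrite /vertex_fact big1 => [|u _]; last by rewrite out0 /tfact big_ord0.
  rewrite out0 /tfact big_ord0 !mulr1 /= mul1r.
  rewrite /vdet (_ : vmx _ = 1%:M) ?det1 //; apply/matrixP => i j; rewrite !mxE /lapl out0 eqxx !orbT.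
  by rewrite (inj_eq enum_val_inj).
have step b : tint (n (v, b)) *
    (trailsum d k (deledge n (v, b)) (v + d b) * edge_fact (deledge n (v, b))) =
    tint (n (v, b)) *
    (vertex_fact (deledge n (v, b)) * vdet (lapl d rho (deledge n (v, b)))).
  have [n0|] := ltnP 0 (n (v, b)); last first.
    by rewrite leqn0 => /eqP ->; rewrite tint0 !mul0r.
  by rewrite IHk ?sum_deledge //; [apply: sum_deledge | apply: balanced_deledge].
rewrite trailsum_rec -mulrA !step {step IHk}.
(* At the root the matrix does not see the deleted edge, its row there being a unit row; only the
   factorials change. *)
have [e|vrho] := eqVneq v rho.
  subst v; have same b : vdet (lapl d rho (deledge n (rho, b))) = vdet (lapl d rho n).
    apply: eq_vdet => u w; have [->|ne] := eqVneq u rho; last exact: lapl_deledge.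
    by rewrite /lapl eqxx.
  rewrite !same; have [out0|] := posnP (outdeg n rho).
    move: (out0) => /eqP; rewrite /outdeg addn_eq0 => /andP[/eqP -> /eqP ->].
    by rewrite vdet_lapl_unreached ?sumn // tint0; ring.
  move=> out0; have nz : tint (outdeg n rho) != 0.
    by case: outdeg out0 => // m _; apply: tint_neq0.
  have vf b : tint (n (rho, b)) * vertex_fact (deledge n (rho, b)) * tint (outdeg n rho)
      = tint (n (rho, b)) * vertex_fact n.
    have [n0|] := ltnP 0 (n (rho, b)).
      by rewrite (vertex_fact_root n0) mulrAC mulrA.
    by rewrite leqn0 => /eqP ->; rewrite tint0 !mul0r.
  apply: (mulIf nz); rewrite (combine_terms _ _ _ (vf true) (vf false)).
  by rewrite [outdeg n rho]addnC tintD; ring.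
have outv : outdeg n v = (indeg d n v).+1.
  by move: (bal v); rewrite eqxx (negPf vrho); lia.
(* A start without arrivals has exactly one departure, and the multiplier [tint (outdeg n v).-1]
   would be zero. Instead, column [v] is supported on the diagonal, so row [v] may be exchanged for
   the unit row left by the deletion. *)
case: (posnP (indeg d n v)) => [in0|in0].
  have [b nb nb'] : exists2 b, n (v, b) = 1%N & n (v, ~~ b) = 0%N.
    move: outv; rewrite in0 /outdeg.
    by case: (posnP (n (v, true))) => h e; [exists false | exists true]; rewrite /=; lia.
  have D : vdet (lapl d rho n) = vdet (lapl d rho (deledge n (v, b))).
    have in0b u b' : u + d b' = v -> n (u, b') = 0%N.
      move=> uv; apply/eqP; rewrite -leqn0 -in0 -uv /indeg.
      by case: b' {uv}; rewrite addrK ?leq_addr ?leq_addl.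
    have outv' : outdeg (deledge n (v, b)) v = 0%N.
      by rewrite outdeg_deledge_id ?nb // outv in0.
    have col u : u != v -> lapl d rho n u v = 0.
      move=> ne; rewrite /lapl (negPf vrho) (negPf ne) /= mulr0 sub0r.
      case: ifP => // _.
      have [/in0b ->|_] := eqVneq (u + d true) v;
      have [/in0b ->|_] := eqVneq (u + d false) v;
      by rewrite /= ?tint0 ?mulr0n ?mul0r ?mulr0 ?mul0r ?subr0 ?oppr0.
    apply: (vdet_isolated_col (v := v)) => //.
      rewrite /lapl outv' outv in0 (negPf vrho) eqxx /= tint1 mulr1.
      have [/in0b ->|_] := eqVneq (v + d true) v;
      have [/in0b ->|_] := eqVneq (v + d false) v;
      by rewrite /= ?tint0 ?mulr0n ?mul0r ?mulr0 ?mul0r ?subr0.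
    by move=> u w ne; rewrite lapl_deledge.
  have P : vertex_fact n = vertex_fact (deledge n (v, b)).
    rewrite /vertex_fact outdeg_deledge 1?eq_sym //; congr (_ * _).
    apply: eq_bigr => u _; have [->|ne] := eqVneq u v; last by rewrite outdeg_deledge.
    by rewrite outdeg_deledge_id ?nb // outv in0.
  rewrite P D; case: b nb nb' {D P} => /= -> ->; rewrite tint0 tint1 ?expr0; ring.
have lt1 : (1 < outdeg n v)%N by rewrite outv ltnS.
have nz : tint (outdeg n v).-1 != 0.
  by rewrite outv /=; case: indeg in0 => // m _; apply: tint_neq0.
have vf b : tint (n (v, b)) * vertex_fact (deledge n (v, b)) * tint (outdeg n v).-1
    = tint (n (v, b)) * vertex_fact n.
  have [n0|] := ltnP 0 (n (v, b)).
    by rewrite -mulrA [vertex_fact _ * _]mulrC vertex_fact_nonroot // lt1 mul1r.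
  by rewrite leqn0 => /eqP ->; rewrite tint0 !mul0r.
apply: (mulIf nz).
set D := vdet (lapl d rho n).
have DN : D * tint (outdeg n v).-1 =
    tq ^+ n (v, false) * tint (n (v, true)) * vdet (lapl d rho (deledge n (v, true)))
    + tint (n (v, false)) * vdet (lapl d rho (deledge n (v, false))).
  (* Row [v] is scaled before it is split, which stands in for a division by the t-integer. *)
  pose L u w := if u == v then tint (outdeg n v).-1 * lapl d rho n v w
                else lapl d rho n u w.
  have <- : vdet L = D * tint (outdeg n v).-1.
    rewrite (@vdet_linear _ _ _ (lapl d rho n) (lapl d rho n) v
      (tint (outdeg n v).-1) 0) ?mul0r ?addr0 1?mulrC // => [w|u w ne|u w ne].
    - by rewrite /L eqxx mul0r addr0.
    - by rewrite /L (negPf ne).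
    - by rewrite /L (negPf ne).
  apply: (vdet_linear (v := v)) => [w|u w ne|u w ne].
  - by rewrite /L eqxx lapl_row_rec.
  - by rewrite /L (negPf ne) lapl_deledge.
  - by rewrite /L (negPf ne) lapl_deledge.
by rewrite (combine_terms _ _ _ (vf true) (vf false)) -DN mulrA.
Qed.

End TrailFormula.

(** * Reversed walks: arrivals against departures *)

Section Reversal.
Variables (V : finZmodType) (d : bool -> V).
Implicit Types (n : V * bool -> nat) (u v : V) (e : V * bool) (w : seq bool).

Definition atrailsum (k : nat) n (v : V) : {poly int} :=
  \sum_(w <- words k | [forall e, count_mem e (edges d v w) == n e])
     tq ^+ ainv d v w.

(** Letters are negated on reversal so that a [true] before a [false] remains one; the reversed step
    labelled [b] thus undoes a step labelled [~~ b]. *)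
Definition rstep (b : bool) : V := - d (~~ b).
Definition rword w := rev (map negb w).
Definition redge e : V * bool := (e.1 + d e.2, ~~ e.2).
Definition rcount n : V * bool -> nat := fun e => n (e.1 - d (~~ e.2), ~~ e.2).

Lemma redgeK : cancel redge (fun e => (e.1 - d (~~ e.2), ~~ e.2)).
Proof. by case=> u b; rewrite /redge /= !negbK addrK. Qed.

Lemma redgeVK : cancel (fun e => (e.1 - d (~~ e.2), ~~ e.2)) redge.
Proof. by case=> u b; rewrite /redge /= !negbK subrK. Qed.

Lemma rwordK : involutive rword.
Proof. by move=> w; rewrite /rword map_rev revK mapK //; apply: negbK. Qed.

Lemma rword_cons b w : rword (b :: w) = rcons (rword w) (~~ b).
Proof. by rewrite /rword /= rev_cons. Qed.

Lemma wend_rword v w : wend rstep (wend d v w) (rword w) = v.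
Proof.
elim: w v => [|b w IHw] v; first by rewrite /wend !big_nil !addr0.
by rewrite rword_cons wend_rcons wend_cons IHw /rstep negbK addrK.
Qed.

Lemma edges_rword v w :
  edges rstep (wend d v w) (rword w) = rev (map redge (edges d v w)).
Proof.
elim: w v => //= b w IHw v.
by rewrite rword_cons edges_rcons wend_cons IHw wend_rword rev_cons.
Qed.

(** The reversed walk departs from the vertices at which the original one arrives. *)
Lemma dinv_rword v w : dinv rstep (wend d v w) (rword w) = ainv d v w.
Proof.
elim: w v => //= b w IHw v.
rewrite rword_cons dinv_rcons wend_cons IHw wend_rword addnC negbK.
case: b {IHw} => //=; congr (1 * _ + _)%N.
rewrite edges_rword count_rev count_map.
apply: eq_count => -[u b]; rewrite /redge /= !xpair_eqE.
by case: b; rewrite ?andbF ?andbT //= [RHS]eq_sym subr_eq eq_sym.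
Qed.

Lemma count_letter (d' : bool -> V) n b v w :
  [forall e, count_mem e (edges d' v w) == n e] ->
  count_mem b w = (\sum_u n (u, b))%N.
Proof.
move=> /forallP H; under eq_bigr do rewrite -(eqP (H _)).
elim: w v {H} => [|b' w IHw] v /=; first by rewrite big1.
rewrite big_split /= -IHw; congr (_ + _)%N.
rewrite (bigD1 v) //= xpair_eqE eqxx big1 ?addn0 // => u ne.
by rewrite xpair_eqE eq_sym (negPf ne).
Qed.

Lemma sum_edges n :
  (\sum_e n e = \sum_u n (u, true) + \sum_u n (u, false))%N.
Proof.
rewrite (eq_bigr (fun e => n (e.1, e.2))); last by case.
by rewrite -(pair_bigA _ (fun u b => n (u, b))) /= exchange_big big_bool.
Qed.

(** Reversal is a bijection of words, but it moves the start of the walk to its end. The closing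
    hypothesis is phrased by letter counts because these survive reversal. *)
Lemma atrailsum_rword k n v : (\sum_e n e = k)%N ->
  (forall w, size w = k -> count_mem true w = (\sum_u n (u, true))%N ->
     wend d v w = v) ->
  atrailsum k n v = trailsum rstep k (rcount n) v.
Proof.
move=> sumn walk_closed; rewrite /atrailsum /trailsum.
have perm_rw : perm_eq [seq rword w | w <- words k] (words k).
  apply: uniq_perm; rewrite ?(map_inj_uniq (inv_inj rwordK)) ?words_uniq // => w.
  by rewrite -{1}[w]rwordK (mem_map (inv_inj rwordK)) !mem_words size_rev size_map.
rewrite -[RHS](perm_big _ perm_rw) big_map /= big_seq_cond [RHS]big_seq_cond.
have counts w e u : count_mem e (edges rstep (wend d u w) (rword w)) =
    count_mem (e.1 - d (~~ e.2), ~~ e.2) (edges d u w).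
  rewrite edges_rword count_rev count_map; apply: eq_count => e'.
  by rewrite /= -{1}[e]redgeVK (inj_eq (can_inj redgeK)).
(* Only the edges of the reversed walk from [v] are known here. They still give the number of
   [false] letters, after a translation of the vertices, and hence the closing of [w]. *)
have wendE w : size w = k ->
    [forall e, count_mem e (edges rstep v (rword w)) == rcount n e] ->
    wend d v w = v.
  move=> sz /(count_letter true); rewrite /rword count_rev count_map => ct.
  have cf : count_mem false w = (\sum_u n (u, false))%N.
    rewrite [RHS](reindex_inj (addIr (- d false))) -ct.
    by apply: eq_count => b; rewrite /=; case: b.
  apply: walk_closed => //; apply: (@addIn (count_mem false w)); rewrite {2}cf.
  have -> : (count_mem true w + count_mem false w)%N = size w.
    rewrite -(count_predC (pred1 true)); congr (_ + _)%N.
    by apply: eq_count => b; rewrite /=; case: b.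
  by rewrite sz -sumn sum_edges.
apply: eq_big => [w|w /andP[]]; last first.
  rewrite mem_words => /eqP sz H; rewrite -{2}(walk_closed w sz (count_letter true H)).
  by rewrite dinv_rword.
rewrite mem_words; case: eqP => //= sz; apply/idP/idP => H.
  apply/forallP => e; rewrite -{1}(walk_closed w sz (count_letter true H)) counts.
  exact: (forallP H).
have wv := wendE w sz H; apply/forallP => e.
have E : ((redge e).1 - d (~~ (redge e).2), ~~ (redge e).2) = e := redgeK e.
move/forallP: H => /(_ (redge e)); rewrite /rcount E -{1}wv counts E.
by [].
Qed.

End Reversal.

Section ArrivalDeparture.
Variables (V : finZmodType) (d : bool -> V) (n : V * bool -> nat) (rho : V).
Hypothesis bal : balanced d rho n rho.
(** The two conditions below say that the backward [d true]-ray of an occupied vertex meets no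
    relevant edge at its far end; they remove the boundary terms of [gauge]. *)
Variable K : nat.
Hypothesis far_true : forall u, (0 < n (u, true))%N ->
  n (u - d true *+ K - d false, false) = 0%N.
Hypothesis far_false : forall u, (0 < n (u, false))%N ->
  n (u - d true *+ K.+1, true) = 0%N.
Implicit Types (u v w : V).

(* The potential with respect to which the two Laplacians are conjugate: it
   counts the [false] edges arriving on the backward [d true]-ray of [u]. *)
Definition gauge u := (\sum_(i < K.+1) n ((u - d true *+ i - d false)%R, false))%N.

Lemma outdeg_indeg u : outdeg n u = indeg d n u.
Proof. by move: (bal u); lia. Qed.

Lemma gauge_true u : (0 < n (u, true))%N ->
  gauge (u + d true)%R = (n ((u + d true - d false)%R, false) + gauge u)%N.
Proof.
move=> /far_true far; rewrite /gauge big_ord_recl mulr0n subr0 big_ord_recr /=.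
rewrite far addn0; congr (_ + _)%N; apply: eq_bigr => i _.
by rewrite /bump /= add1n mulrS opprD addrA addrK.
Qed.

(** Summing the balance of arrivals and departures along the ray telescopes in the [true] edges, and
    the term at the far end is zero. In [gauge_true] the ray merely gains a vertex in front and
    drops an empty one at the end. *)
Lemma gauge_false u : (0 < n (u, false))%N ->
  gauge u = (gauge (u + d false)%R + n (u, true))%N.
Proof.
move=> /far_false far; rewrite /gauge.
have -> : (\sum_(i < K.+1) n ((u + d false - d true *+ i - d false)%R, false) =
  \sum_(i < K.+1) n ((u - d true *+ i)%R, false))%N.
  by apply: eq_bigr => i _; rewrite [u + _ - _]addrAC addrK.
transitivity (\sum_(i < K.+1) n ((u - d true *+ i - d false)%R, false)
    + n ((u - d true *+ K.+1)%R, true))%N; first by rewrite far addn0.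
elim: K.+1 => [|m IHm].
  by rewrite !big_ord0 mulr0n subr0.
have := outdeg_indeg (u - d true *+ m); rewrite /outdeg /indeg.
have -> : u - d true *+ m - d true = u - d true *+ m.+1.
  by rewrite -addrA -opprD -mulrSr.
move=> E; rewrite !big_ord_recr /= [RHS]addnAC -IHm -!addnA E.
by congr (_ + _)%N; rewrite addnC.
Qed.

Lemma outdeg_rcount u : outdeg (rcount d n) u = outdeg n u.
Proof. by rewrite [RHS]outdeg_indeg /outdeg /indeg /rcount addnC. Qed.

Lemma indeg_rcount u : indeg (rstep d) (rcount d n) u = outdeg n u.
Proof. by rewrite /outdeg /indeg /rcount /rstep /= !opprK !addrK addnC. Qed.

Lemma indeg_pos u b : (0 < n (u, b))%N -> outdeg n (u + d b)%R != 0%N.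
Proof. by move/(indeg_head d); rewrite outdeg_indeg lt0n. Qed.

(** Originally the [false] edge out of [u] carries the power with exponent [n (u, true)]; after
    reversal the [true] edge into [w] carries the one with exponent [n (w - d false, false)]. These
    exponents are exactly the increments of [gauge] along the two edges. *)
Lemma vdet_lapl_rcount :
  vdet (lapl (rstep d) rho (rcount d n)) = vdet (lapl d rho n).
Proof.
apply: (vdet_gauge (x := fun u => tq ^+ gauge u)) => u.
  by rewrite expf_neq0 // polyX_eq0.
move=> w; rewrite /lapl !outdeg_rcount orbCA [w == u]eq_sym.
case: (eqVneq u rho) => [_|urho] /=.
  by case: eqP => [->//|_]; rewrite !mulr0.
case: (eqVneq w rho) => [_|wrho] /=.
  by case: eqP => [->//|_]; rewrite !mulr0.
rewrite /rcount /rstep /=.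
(* A vertex without departures has no arrivals either, so the unit rows placed there are compatible
   with transposition. *)
have [out0|out0] := eqVneq (outdeg n w) 0%N; have [out0'|out0'] := eqVneq (outdeg n u) 0%N.
- by case: eqP => [->//|_]; rewrite !mulr0.
- have -> : (u == w) = false.
    by apply/negbTE; apply: contraNneq out0' => ->; rewrite out0.
  have edge0 b : (u + d b == w) = true -> n (u, b) = 0%N.
    by move/eqP => e; apply/eqP; apply: contra_eqT out0; rewrite -lt0n -e => /indeg_pos.
  case et: (u + d true == w); case ef: (u + d false == w);
    by rewrite ?(edge0 _ et) ?(edge0 _ ef) ?tint0 !(mulr0, mul0r, subr0).
- move/eqP: out0'; rewrite addn_eq0 => /andP[/eqP ut /eqP uf].
  have ne : u == w = false.
    apply/negbTE; apply: contraNneq out0 => <-.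
    by rewrite /outdeg ut uf.
  rewrite ne; case: eqP => [e|_]; case: eqP => [e'|_];
    by rewrite ?e ?e' ?ut ?uf ?tint0 !(mulr0, mul0r, subr0).
have flip b : (w - d b == u) = (u + d b == w) by rewrite subr_eq eq_sym.
rewrite !flip !mulrBr addrAC; congr (_ - _ - _).
- by case: eqP => [->|_]; rewrite ?mulr0.
- case: eqP => [<-|_]; last by rewrite !mulr0.
  rewrite addrK !mulr1; have [uf|] := ltnP 0 (n (u, true)).
    by rewrite gauge_true // addnC exprD mulrA.
  by rewrite leqn0 => /eqP ->; rewrite tint0 !mulr0.
case: eqP => [<-|_]; last by rewrite !mulr0.
rewrite addrK !mulr1; have [uf|] := ltnP 0 (n (u, false)).
  by rewrite gauge_false // exprD mulrA.
by rewrite leqn0 => /eqP ->; rewrite tint0 !mulr0.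
Qed.

Lemma atrailsum_trailsum k : (\sum_e n e = k)%N ->
  (forall w : seq bool, size w = k ->
     count_mem true w = (\sum_u n (u, true))%N -> wend d rho w = rho) ->
  atrailsum d k n rho = trailsum d k n rho.
Proof.
move=> sumn walk_closed; rewrite (atrailsum_rword sumn walk_closed).
have bij_r : bijective (fun e : V * bool => (e.1 - d (~~ e.2), ~~ e.2)).
  by exists (redge d); [apply: redgeVK | apply: redgeK].
have nz : edge_fact n != 0 by apply/prodf_neq0 => e _; apply: tfact_neq0.
apply: (mulIf nz); rewrite (trailsum_vdet sumn bal).
have <- : edge_fact (rcount d n) = edge_fact n.
  by rewrite /edge_fact [RHS](reindex _ (onW_bij _ bij_r)).
rewrite (trailsum_vdet (rho := rho)); first last.
- by move=> u; rewrite outdeg_rcount indeg_rcount.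
- by rewrite -sumn [RHS](reindex _ (onW_bij _ bij_r)).
rewrite vdet_lapl_rcount; congr (_ * _); rewrite /vertex_fact outdeg_rcount.
by congr (_ * _); apply: eq_bigr => u _; rewrite outdeg_rcount.
Qed.

End ArrivalDeparture.

(** * Pair statistics that depend on the edges of a walk only *)

Section PairStatistic.
Variables (U : zmodType) (d : bool -> U).
Implicit Types (W H : U -> int) (u v : U) (w : seq bool).

Fixpoint pairsum W v w : int :=
  if w is b :: w' then
    (if b then \sum_(e <- edges d (v + d b) w' | ~~ e.2) W (e.1 - v) else 0)
    + pairsum W (v + d b) w'
  else 0.

Definition mixed_diff H u :=
  H u - H (u - d true) - H (u + d false) + H (u - d true + d false).

Lemma perm_edges_wend v w w' :
  perm_eq (edges d v w) (edges d v w') -> wend d v w = wend d v w'.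
Proof.
have sumE x : \sum_(b <- x) d b = \sum_(e <- edges d v x) d e.2.
  by rewrite -{1}(unzip2_edges d v x) big_map.
by move=> pe; rewrite /wend !sumE; congr (_ + _); apply: perm_big.
Qed.

(* Telescoping [H (_ - u) - H (_ - d true - u)] along the rest of the walk
   trades the [false] steps after a given [true] step for [true] steps, and
   evenness makes the resulting kernel blind to the order of the steps. *)
Lemma pairsum_mixed_diff H v w : (forall u, H (- u) = H u) ->
  let psi u := H u - H (u - d true) in
  let phi u := psi (u + d true) - psi u in
  pairsum (mixed_diff H) v w *+ 2 =
  \sum_(e <- edges d v w | e.2) \sum_(e' <- edges d v w | e'.2) phi (e'.1 - e.1)
  - \sum_(e <- edges d v w | e.2)
      (phi 0 + (psi (wend d v w - e.1) - psi (d true)) *+ 2).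
Proof.
move=> Heven psi phi.
have phiN u : phi (- u) = phi u.
  have e1 : - u + d true = - (u - d true) by rewrite opprB addrC.
  have e2 : - u - d true = - (u + d true) by rewrite opprD.
  by rewrite /phi /psi !addrK e1 e2 !Heven; ring.
(* Along a walk [psi] changes by [phi] at each [true] step and by minus the mixed difference at each
   [false] step. *)
have tele x u p : \sum_(e <- edges d u p | ~~ e.2) mixed_diff H (e.1 - x) =
    \sum_(e <- edges d u p | e.2) phi (e.1 - x) - (psi (wend d u p - x) - psi (u - x)).
  elim: p u => [|b p IHp] u /=.
    by rewrite !big_nil /wend big_nil addr0 subrr subr0.
  rewrite !big_cons wend_cons !IHp /=; case: b => /=.
    by rewrite /phi [u + _ - x]addrAC; ring.
  rewrite /mixed_diff /psi (addrAC u (d false)).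
  by rewrite (addrAC (u - x) (d false)); ring.
elim: w v => [|b w IHw] v /=; first by rewrite !big_nil subrr mul0rn.
rewrite mulrnDl IHw !big_cons wend_cons; case: b => /=; last first.
  rewrite mul0rn add0r; congr (_ - _); apply: eq_bigr => e _.
  by rewrite big_cons.
rewrite subrr tele [v + _ - v]addrAC subrr add0r.
set E := edges d _ w.
(* By [phiN] the new edge pairs with the later ones alike from either side, so the symmetric double
   sum counts each pair twice; hence the doubled statement. *)
have -> : \sum_(e <- E | e.2) \sum_(e' <- (v, true) :: E | e'.2) phi (e'.1 - e.1)
    = \sum_(e <- E | e.2) phi (e.1 - v)
      + \sum_(e <- E | e.2) \sum_(e' <- E | e'.2) phi (e'.1 - e.1).
  rewrite -big_split; apply: eq_bigr => e _.
  by rewrite big_cons /= -phiN opprB.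
by ring.
Qed.

Lemma eq_pairsum W W' v w :
  (forall e e', e \in edges d v w -> e' \in edges d v w ->
     W (e'.1 - e.1) = W' (e'.1 - e.1)) ->
  pairsum W v w = pairsum W' v w.
Proof.
elim: w v => //= b w IHw v WW; congr (_ + _); last first.
  by apply: IHw => e e' he he'; apply: WW; rewrite inE ?he ?he' orbT.
case: b {IHw} WW => // WW; rewrite big_seq_cond [RHS]big_seq_cond.
apply: eq_bigr => e /andP[he _].
by apply: (WW (v, true)); rewrite inE ?eqxx ?he ?orbT.
Qed.

(** The kernel is tested only on differences of vertices of the walk, which leaves room for a
    fundamental solution valid in a bounded range. The factor 2 comes from symmetrising [H] and
    cancels in the integers. *)
Lemma pairsum_perm W H v w w' : (forall u, H (- u) = H u) ->
  (forall e e', e \in edges d v w -> e' \in edges d v w ->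
     mixed_diff H (e'.1 - e.1) = W (e'.1 - e.1) *+ 2) ->
  perm_eq (edges d v w) (edges d v w') -> pairsum W v w = pairsum W v w'.
Proof.
move=> Heven HW pe.
have dbl x : (forall e e', e \in edges d v x -> e' \in edges d v x ->
     mixed_diff H (e'.1 - e.1) = W (e'.1 - e.1) *+ 2) ->
    pairsum W v x *+ 2 = pairsum (mixed_diff H) v x.
  move=> HWx; rewrite (@eq_pairsum (mixed_diff H) (fun u => W u *+ 2)) // {HWx}.
  clear HW pe; elim: x v => [|b x IHx] u /=; first by rewrite mul0rn.
  rewrite mulrnDl IHx; congr (_ + _); case: b => //.
  by rewrite -sumrMnl.
have HW' e e' : e \in edges d v w' -> e' \in edges d v w' ->
   mixed_diff H (e'.1 - e.1) = W (e'.1 - e.1) *+ 2.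
  by rewrite -!(perm_mem pe); apply: HW.
have pe2 : pairsum (mixed_diff H) v w *+ 2 = pairsum (mixed_diff H) v w' *+ 2.
  rewrite !(pairsum_mixed_diff _ _ Heven) (perm_edges_wend pe).
  rewrite (perm_big _ pe); congr (_ - _); last exact: perm_big.
  by apply: eq_bigr => e _; apply: perm_big.
by move: pe2; rewrite -!dbl //; lia.
Qed.

(* A fundamental solution of [mixed_diff]; its sum with its reflection is even,
   as [pairsum_perm] requires. *)
Definition quadrant_sum W (B : nat) u : int :=
  \sum_(i < B) \sum_(j < B) W (u - d true *+ i + d false *+ j).

(** The two directions telescope independently. For the kernel used later the three terms at
    distance [B] vanish once [B] is large. *)
Lemma mixed_diff_quadrant_sum W B u :
  mixed_diff (quadrant_sum W B) u =
  W u - W (u - d true *+ B) - W (u + d false *+ B)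
  + W (u - d true *+ B + d false *+ B).
Proof.
pose A x := \sum_(j < B) W (x + d false *+ j).
have teleA x : A x - A (x + d false) = W x - W (x + d false *+ B).
  rewrite -sumrB; elim: {A}B => [|m IHm]; first by rewrite big_ord0 mulr0n addr0 subrr.
  have -> : x + d false *+ m.+1 = x + d false + d false *+ m by rewrite mulrS addrA.
  by rewrite big_ord_recr /= IHm; ring.
have tele (f : U -> int) x : \sum_(i < B) f (x - d true *+ i)
    - \sum_(i < B) f (x - d true - d true *+ i) = f x - f (x - d true *+ B).
  rewrite -sumrB; elim: {A teleA}B => [|m IHm].
    by rewrite big_ord0 mulr0n subr0 subrr.
  have -> : x - d true *+ m.+1 = x - d true - d true *+ m.
    by rewrite mulrS opprD addrA.
  by rewrite big_ord_recr /= IHm; ring.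
have qE x : quadrant_sum W B x = \sum_(i < B) A (x - d true *+ i) by [].
have tele' x : quadrant_sum W B x =
    A x - A (x - d true *+ B) + quadrant_sum W B (x - d true).
  by rewrite -tele -!qE subrK.
rewrite /mixed_diff (tele' u) (tele' (u + d false)).
rewrite [u + d false - d true]addrAC [u + d false - d true *+ B]addrAC.
transitivity (A u - A (u + d false)
    - (A (u - d true *+ B) - A (u - d true *+ B + d false))); first by ring.
by rewrite !teleA; ring.
Qed.

End PairStatistic.

(** * Box statistics of words *)

(* A word is read as the boundary of a Young diagram, from the top of the
   vertical axis to the end of the horizontal one; [true] is a horizontal step
   and [false] a vertical one. A box is a pair of a [true] and a later [false],
   and its arm and leg are the numbers of [true] and [false] in between. *)
Fixpoint colsum (P : nat -> nat -> bool) (a l : nat) (w : seq bool) : nat :=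
  match w with
  | [::] => 0%N
  | true :: w' => colsum P a.+1 l w'
  | false :: w' => (P a l + colsum P a l.+1 w')%N
  end.

Fixpoint boxsum (P : nat -> nat -> bool) (w : seq bool) : nat :=
  match w with
  | [::] => 0%N
  | true :: w' => (colsum P 0 0 w' + boxsum P w')%N
  | false :: w' => boxsum P w'
  end.

Lemma eq_colsum P Q a l (w : seq bool) :
  (forall i j, (i <= a + count_mem true w)%N -> (j < l + count_mem false w)%N ->
     P i j = Q i j) ->
  colsum P a l w = colsum Q a l w.
Proof.
elim: w a l => [|[] w IHw] a l PQ //=.
  by apply: IHw => i j /= hi hj; apply: PQ => /=; lia.
rewrite PQ /=; [|lia..]; congr (_ + _)%N.
by apply: IHw => i j /= hi hj; apply: PQ => /=; lia.
Qed.

Lemma eq_boxsum P Q (w : seq bool) :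
  (forall i j, (i < count_mem true w)%N -> (j < count_mem false w)%N ->
     P i j = Q i j) ->
  boxsum P w = boxsum Q w.
Proof.
elim: w => [|[] w IHw] PQ //=; last first.
  by apply: IHw => i j /= hi hj; apply: PQ => /=; lia.
congr (_ + _)%N; first by apply: eq_colsum => i j /= hi hj; apply: PQ => /=; lia.
by apply: IHw => i j /= hi hj; apply: PQ => /=; lia.
Qed.

Lemma colsumD (P Q R : nat -> nat -> bool) a l w : (forall i j, (P i j : nat) = Q i j + R i j)%N ->
  colsum P a l w = (colsum Q a l w + colsum R a l w)%N.
Proof.
move=> PQR; elim: w a l => [|[] w IHw] a l //=.
by rewrite IHw PQR; lia.
Qed.

Lemma boxsumD (P Q R : nat -> nat -> bool) w : (forall i j, (P i j : nat) = Q i j + R i j)%N ->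
  boxsum P w = (boxsum Q w + boxsum R w)%N.
Proof.
move=> PQR; elim: w => [|[] w IHw] //=.
by rewrite IHw (colsumD _ _ _ PQR); lia.
Qed.

Lemma colsum_shift P a l w :
  colsum P a.+1 l w = colsum (fun i j => P i.+1 j) a l w.
Proof. by elim: w a l => [|[] w IHw] a l //=; rewrite IHw. Qed.

Section BoxWalk.
Variables (U : zmodType) (d : bool -> U).
Implicit Types (v : U) (w : seq bool).

Let at_ a l := d true *+ a + d false *+ l.

Lemma at_true v a l : v + at_ a l + d true = v + at_ a.+1 l.
Proof. by rewrite /at_ mulrSr -!addrA [d false *+ l + _]addrC. Qed.

Lemma at_false v a l : v + at_ a l + d false = v + at_ a l.+1.
Proof. by rewrite /at_ mulrSr -!addrA. Qed.

Lemma at_10 : at_ 1 0 = d true.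
Proof. by rewrite /at_ mulr1n mulr0n addr0. Qed.

(** From the start of the [true] step of a box to the start of its [false] step there are [a.+1]
    letters [true], the first one included, and [l] letters [false]. *)
Lemma pairsum_boxsum W (P : nat -> nat -> bool) v w :
  (forall a l, W (d true *+ a.+1 + d false *+ l) = (P a l)%:Z) ->
  pairsum d W v w = (boxsum P w)%:Z.
Proof.
move=> WP.
have colE a l p u : \sum_(e <- edges d (u + at_ a.+1 l) p | ~~ e.2)
    W (e.1 - u) = (colsum P a l p)%:Z.
  elim: p a l => [|[] p IHp] a l /=; first by rewrite big_nil.
    by rewrite big_cons /= at_true IHp.
  by rewrite big_cons /= at_false IHp [u + _]addrC addrK WP PoszD.
elim: w v => [|[] w IHw] v //=; last by rewrite add0r IHw.
by rewrite PoszD IHw; have := colE 0%N 0%N w v; rewrite at_10 => ->.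
Qed.

Lemma count_colsum v x a l w :
  count_mem (x, false) (edges d (v + at_ a l) w) =
  colsum (fun i j => v + at_ i j == x) a l w.
Proof.
elim: w a l => [|[] w IHw] a l //=.
  by rewrite xpair_eqE andbF add0n at_true IHw.
by rewrite xpair_eqE andbT at_false IHw.
Qed.

(** Departures of the two steps of a box differ by arm plus one and leg, arrivals by arm and leg
    plus one: these are the two fractions of the statistics. *)
Lemma dinv_boxsum v w :
  dinv d v w = boxsum (fun a l => d true *+ a.+1 + d false *+ l == 0) w.
Proof.
elim: w v => [|[] w IHw] v //=; rewrite IHw ?mul1n //; congr (_ + _)%N.
rewrite -[in edges _ _ _]at_10 count_colsum colsum_shift; apply: eq_colsum => i j _ _.
by rewrite -subr_eq0 [v + _]addrC addrK.
Qed.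

Lemma ainv_boxsum v w :
  ainv d v w = boxsum (fun a l => d true *+ a + d false *+ l.+1 == 0) w.
Proof.
elim: w v => [|[] w IHw] v //=; rewrite IHw ?mul1n //; congr (_ + _)%N.
rewrite -[in edges _ _ _]at_10 count_colsum colsum_shift; apply: eq_colsum => i j _ _.
rewrite -subr_eq0 /at_ -[v + d true - _]addrA opprD addrACA subrr add0r.
rewrite opprB mulrSr [_ + d true + _]addrAC [d false - _]addrC addrA addrK.
by rewrite mulrSr addrA.
Qed.

Lemma balanced_edges v w u :
  (count_mem (u, true) (edges d v w) + count_mem (u, false) (edges d v w)
    + (u == wend d v w) =
   count_mem ((u - d true)%R, true) (edges d v w)
    + count_mem ((u - d false)%R, false) (edges d v w) + (u == v))%N.
Proof.
elim: w v => [|b w IHw] v /=; first by rewrite /wend big_nil addr0.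
rewrite wend_cons; move: (IHw (v + d b)).
rewrite !xpair_eqE ![v == u - _]eq_sym !subr_eq [v == u]eq_sym.
case: b {IHw} => /=; rewrite ?andbT ?andbF;
case: (u == v); case: (u == v + _); rewrite /=; lia.
Qed.

End BoxWalk.

(** * The cylinder attached to a rational slope *)

HB.instance Definition _ (U V : finZmodType) := Finite.on (U * V)%type.

Lemma PoszMn (a b : nat) : a%:Z *+ b = (a * b)%:Z.
Proof. by rewrite -mulr_natr natz PoszM. Qed.

Lemma inZpD p a b : inZp a + inZp b = inZp (a + b) :> 'I_p.+1.
Proof. by apply: val_inj; rewrite /= modnDm. Qed.

Lemma inZpMn p a b : inZp a *+ b = inZp (a * b) :> 'I_p.+1.
Proof. by rewrite Zp_mulrn; apply: val_inj; rewrite /= modnMml. Qed.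

Lemma inZp_eq0 p a : (inZp a == 0 :> 'I_p.+1) = (p.+1 %| a)%N.
Proof. by rewrite -val_eqE. Qed.

Lemma inZp_inj p a b : (a <= p)%N -> (b <= p)%N ->
  (inZp a == inZp b :> 'I_p.+1) = (a == b).
Proof. by move=> ha hb; rewrite -val_eqE /= !modn_small. Qed.

(** The slope is [r / s] with denominators cleared; for positive [s], [l = 0] makes the last
    inequality true, in accordance with the convention on fractions with denominator 0. *)
Definition plus_box (c r s a l : nat) : bool :=
  [&& c %| (a + l).+1, s * a <= r * l.+1 & r * l < s * a.+1]%N.
Definition minus_box (c r s a l : nat) : bool :=
  [&& c %| (a + l).+1, s * a < r * l.+1 & r * l <= s * a.+1]%N.
Definition mid_box (c r s a l : nat) : bool :=
  [&& c %| (a + l).+1, s * a < r * l.+1 & r * l < s * a.+1]%N.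

(* Row lengths from top to bottom, hence increasing; empty rows are kept. *)
Fixpoint heights (x : nat) (w : seq bool) : seq nat :=
  match w with
  | [::] => [::]
  | true :: w' => heights x.+1 w'
  | false :: w' => x :: heights x w'
  end.

Fixpoint fpos (p : nat) (w : seq bool) : seq nat :=
  match w with
  | [::] => [::]
  | true :: w' => fpos p.+1 w'
  | false :: w' => p :: fpos p.+1 w'
  end.

(** For a fixed number of rows, empty ones included, the residues of the positions of the vertical
    steps determine the core; [f] prescribes them. *)
Definition core_word (c M n : nat) (f : nat -> nat) (w : seq bool) : bool :=
  [&& count_mem true w == M, sumn (heights 0 w) == n
    & [forall i : 'I_c, count (fun p => p %% c == i)%N (fpos 0 w) == f i]].

Section RationalSlope.
Variables (c' r s k : nat).
Hypotheses (r_gt0 : (0 < r)%N) (s_gt0 : (0 < s)%N).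
Let c := c'.+1.
(** Here [s * M = r * N] and [c] divides [M + N], so boundary walks close up, while [k] makes the
    rectangle as large as desired. Levels stay below [top]; a reflected difference of levels is at
    most [top + r + s], which is [K], and a shift by [K] steps then makes it nonpositive. *)
Let M := (c * k * r)%N.
Let N := (c * k * s)%N.
Let top := (r * N + s * M)%N.
Let K := (top + r + s)%N.
Let L := (top + s * K.+1)%N.

(* Vertices are pairs (level, number of steps mod c). Levels are taken modulo
   [L.+1] only to make [V] finite: [L] is so large that neither the walks nor the
   rays used for the gauge wrap around. *)
Let V : finZmodType := ('I_L.+1 * 'I_c'.+1)%type.
Let U : zmodType := (int * 'I_c'.+1)%type.
Let dV (b : bool) : V := if b then (inZp s, inZp 1) else (- inZp r, inZp 1).
Let dU (b : bool) : U := if b then (s%:Z, inZp 1) else (- r%:Z, inZp 1).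

(** The offset [r * N] makes the truncated subtraction exact for [y <= N]. *)
Let lev x y := (r * N + s * x - r * y)%N.
Let posV x y : V := (inZp (lev x y), inZp (x + y)).
Let posU x y : U := ((lev x y)%:Z, inZp (x + y)).
Let rho := posV 0 0.
Let lift (v : V) : U := ((v.1 : nat)%:Z, v.2).

Lemma lev_le x y : (x <= M)%N -> (y <= N)%N -> (lev x y <= top)%N.
Proof. by move=> hx hy; rewrite /lev /top; nia. Qed.

Lemma lift_pos x y : (x <= M)%N -> (y <= N)%N -> lift (posV x y) = posU x y.
Proof.
move=> hx hy; rewrite /lift /posU /= modn_small // ltnS.
by apply: leq_trans (lev_le hx hy) _; rewrite /L leq_addr.
Qed.

Lemma posV_true x y : (y <= N)%N -> posV x y + dV true = posV x.+1 y.
Proof.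
move=> hy; congr (_, _); rewrite /= inZpD; congr inZp; rewrite /lev; nia.
Qed.

Lemma posV_false x y : (y < N)%N -> posV x y + dV false = posV x y.+1.
Proof.
move=> hy; congr (_, _); rewrite /= ?inZpD; last by congr inZp; lia.
apply/eqP; rewrite subr_eq inZpD; apply/eqP; congr inZp; rewrite /lev; nia.
Qed.

Lemma posU_true x y : (y <= N)%N -> posU x y + dU true = posU x.+1 y.
Proof.
move=> hy; congr (_, _); rewrite /= ?inZpD; last by congr inZp; lia.
by rewrite /lev; nia.
Qed.

Lemma posU_false x y : (y < N)%N -> posU x y + dU false = posU x y.+1.
Proof.
move=> hy; congr (_, _); rewrite /= ?inZpD; last by congr inZp; lia.
by rewrite /lev; nia.
Qed.

Lemma edges_lift x y w : (x + count_mem true w <= M)%N ->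
  (y + count_mem false w <= N)%N ->
  edges dU (posU x y) w = [seq (lift e.1, e.2) | e <- edges dV (posV x y) w].
Proof.
elim: w x y => [|b w IHw] x y //= hx hy; rewrite lift_pos; [|lia..].
congr (_ :: _); case: b hx hy => /= hx hy.
  by rewrite posU_true ?posV_true; [apply: IHw => /= | |]; lia.
by rewrite posU_false ?posV_false; [apply: IHw => /= | |]; lia.
Qed.

Lemma mem_edges_pos x y w e : (x + count_mem true w <= M)%N ->
  (y + count_mem false w <= N)%N -> e \in edges dV (posV x y) w ->
  exists x' y', [/\ (x' <= M)%N, (y' <= N)%N & e.1 = posV x' y'].
Proof.
elim: w x y => [|b w IHw] x y //= hx hy; rewrite inE => /orP[/eqP ->|].
  by exists x, y; split=> //=; lia.
case: b hx hy => /= hx hy.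
  by rewrite posV_true; [apply: IHw => /= |]; lia.
by rewrite posV_false; [apply: IHw => /= |]; lia.
Qed.

Lemma atVE a l :
  dV true *+ a + dV false *+ l = (inZp (s * a) - inZp (r * l), inZp (a + l)).
Proof.
rewrite /dV !pairMnE /=. congr (_, _); rewrite ?mulNrn !inZpMn ?inZpD ?mul1n //.
Qed.

Lemma atUE a l :
  dU true *+ a + dU false *+ l = ((s * a)%:Z - (r * l)%:Z, inZp (a + l)).
Proof.
rewrite /dU !pairMnE /=; congr (_, _); rewrite ?inZpMn ?inZpD ?mul1n //.
by rewrite mulNrn !PoszMn.
Qed.

Lemma atV_eq0 a l : (s * a <= L)%N -> (r * l <= L)%N ->
  (dV true *+ a + dV false *+ l == 0) = (c %| a + l)%N && (s * a == r * l)%N.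
Proof.
move=> ha hl; rewrite atVE -pair_eqE /= andbC; congr (_ && _).
by rewrite subr_eq0 inZp_inj.
Qed.

Lemma pos_closed : posV M N = rho.
Proof.
rewrite /rho /posV /lev; congr (_, _); first by congr inZp; rewrite /M /N; nia.
apply/eqP; rewrite -val_eqE /= addn0 mod0n -/(dvdn _ _) /M /N -mulnDr.
by rewrite -/c -mulnA dvdn_mulr.
Qed.

Lemma wend_pos x y w : (y + count_mem false w <= N)%N ->
  wend dV (posV x y) w = posV (x + count_mem true w) (y + count_mem false w).
Proof.
elim: w x y => [|b w IHw] x y hy; first by rewrite /wend big_nil addr0 !addn0.
rewrite wend_cons; case: b hy => /= hy.
  by rewrite posV_true ?IHw /=; [congr posV; lia | lia..].
by rewrite posV_false ?IHw /=; [congr posV; lia | lia..].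
Qed.

Lemma boxsum_dinv w : count_mem true w = M -> count_mem false w = N ->
  dinv dV rho w =
  boxsum (fun a l => (c %| (a + l).+1) && (s * a.+1 == r * l))%N w.
Proof.
move=> wt wf; rewrite dinv_boxsum; apply: eq_boxsum => a l.
rewrite wt wf => ha hl; rewrite atV_eq0 ?addSn //; rewrite /L /top; nia.
Qed.

Lemma boxsum_ainv w : count_mem true w = M -> count_mem false w = N ->
  ainv dV rho w =
  boxsum (fun a l => (c %| (a + l).+1) && (s * a == r * l.+1))%N w.
Proof.
move=> wt wf; rewrite ainv_boxsum; apply: eq_boxsum => a l.
rewrite wt wf => ha hl; rewrite atV_eq0 ?addnS //; rewrite /L /top; nia.
Qed.

(** With the level [s * a.+1 - r * l] of a box, the two strict inequalities of [mid_box] read as the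
    window between 0 and [r + s]. *)
Let mid_ind (u : U) : int :=
  ((u.2 == 0) && (0 < u.1) && (u.1 < (r + s)%:Z))%R%:Z.

Lemma boxsum_mid (v : U) w : pairsum dU mid_ind v w = (boxsum (mid_box c r s) w)%:Z.
Proof.
apply: pairsum_boxsum => a l; rewrite atUE /mid_ind /mid_box /= inZp_eq0 addSn.
by rewrite -andbA; congr (Posz (nat_of_bool (_ && _))); apply/idP/idP; lia.
Qed.

Let H (u : U) : int := quadrant_sum dU mid_ind K u + quadrant_sum dU mid_ind K (- u).

Lemma mid_ind_mixed_diff (u : U) : (u.1 <= K%:Z) ->
  mixed_diff dU (quadrant_sum dU mid_ind K) u = mid_ind u.
Proof.
move=> hu; have mid0 (v : U) : (v.1 <= 0) -> mid_ind v = 0.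
  by move=> hv; rewrite /mid_ind [0 < _]ltNge hv andbF.
have sK : (K <= s * K)%N by rewrite leq_pmull.
have rK : (K <= r * K)%N by rewrite leq_pmull.
rewrite mixed_diff_quadrant_sum; case: u hu => x z /= hu.
by rewrite !(mid0 (_ + _)) ?subr0 ?addr0 // /= !pairMnE /= ?mulNrn ?PoszMn; lia.
Qed.

(** The window is symmetric about its centre, so the reflected half of [H] contributes the same
    kernel as the other half. *)
Lemma mid_ind_sym (u : U) : mid_ind (dU true - dU false - u) = mid_ind u.
Proof.
rewrite /mid_ind /= subrr sub0r oppr_eq0 -!andbA; congr (Posz (nat_of_bool (_ && _))).
by apply/idP/idP; lia.
Qed.

Lemma H_mixed_diff (u : U) : `|u.1| <= top%:Z -> mixed_diff dU H u = mid_ind u *+ 2.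
Proof.
move=> hu; transitivity (mixed_diff dU (quadrant_sum dU mid_ind K) u +
    mixed_diff dU (quadrant_sum dU mid_ind K) (dU true - dU false - u)).
  rewrite /mixed_diff /H.
  have -> : - (u - dU true) = dU true - u by rewrite opprB.
  have -> : - (u + dU false) = dU true - dU false - u - dU true.
    by rewrite opprD addrAC [dU true - _]addrC addrK addrC.
  have -> : - (u - dU true + dU false) = dU true - dU false - u.
    by rewrite opprD opprB addrAC.
  have -> : dU true - dU false - u + dU false = dU true - u.
    by rewrite addrAC subrK.
  have -> : dU true - dU false - u - dU true + dU false = - u.
    by rewrite addrAC [dU true - _ - _]addrAC subrK [dU true - u]addrC addrK.
  by ring.
rewrite !mid_ind_mixed_diff ?mid_ind_sym ?mulr2n //.
  by case: u hu => x z /= hu; rewrite /K; lia.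
by case: u hu => x z /= hu; rewrite /K; lia.
Qed.

(** Walks in the rectangle do not wrap, so their edges lift to integer levels, where the telescoping
    argument takes place. *)
Lemma mid_box_perm w w' :
  count_mem true w = M -> count_mem false w = N ->
  perm_eq (edges dV rho w) (edges dV rho w') ->
  boxsum (mid_box c r s) w = boxsum (mid_box c r s) w'.
Proof.
move=> wt wf pe.
have pw : perm_eq w w'.
  by rewrite -(unzip2_edges dV rho w) -(unzip2_edges dV rho w') perm_map.
have wt' : count_mem true w' = M by rewrite -wt; apply/esym/(permP pw).
have wf' : count_mem false w' = N by rewrite -wf; apply/esym/(permP pw).
have peU : perm_eq (edges dU (posU 0 0) w) (edges dU (posU 0 0) w').
  by rewrite !edges_lift ?add0n ?wt ?wf ?wt' ?wf' // perm_map.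
have [] : (boxsum (mid_box c r s) w)%:Z = (boxsum (mid_box c r s) w')%:Z; last by [].
rewrite -!(boxsum_mid (posU 0 0)); apply: (pairsum_perm (H := H)) peU => [u|e e'].
  by rewrite /H opprK addrC.
rewrite edges_lift ?add0n ?wt ?wf // => /mapP[f hf ->] /mapP[f' hf' ->] /=.
apply: H_mixed_diff.
have := mem_edges_pos _ _ hf; rewrite !add0n wt wf.
case=> // x [y [hx hy ->]].
have := mem_edges_pos _ _ hf'; rewrite !add0n wt wf.
case=> // x' [y' [hx' hy' ->]].
rewrite !lift_pos //=; have := lev_le hx hy; have := lev_le hx' hy'; lia.
Qed.

(** On a class of words with the same edges the common boxes give a constant power of t; the
    remaining boxes of [plus_box] are the arrival inversions and those of [minus_box] the departure
    inversions. *)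
Lemma class_sum w0 : size w0 = (N + M)%N -> count_mem true w0 = M ->
  \sum_(w <- words (N + M) | perm_eq (edges dV rho w) (edges dV rho w0))
     tq ^+ boxsum (plus_box c r s) w =
  \sum_(w <- words (N + M) | perm_eq (edges dV rho w) (edges dV rho w0))
     tq ^+ boxsum (minus_box c r s) w.
Proof.
move=> sz wt.
have falseE w : size w = (N + M)%N -> count_mem true w = M -> count_mem false w = N.
  move=> szw wtw; apply: (@addnI (count_mem true w)); rewrite [RHS]addnC {2}wtw -szw.
  rewrite -(count_predC (pred1 true)); congr (_ + _)%N.
  by apply: eq_count => b; case: b.
have wf := falseE _ sz wt.
pose n e := count_mem e (edges dV rho w0).
have classE w : perm_eq (edges dV rho w) (edges dV rho w0) =
    [forall e, count_mem e (edges dV rho w) == n e].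
  apply/idP/forallP => [/permP pe e|pe]; first by rewrite pe.
  by apply/allP => e _; apply: pe.
have size_class w : perm_eq (edges dV rho w) (edges dV rho w0) ->
    count_mem true w = M /\ count_mem false w = N.
  move=> pe; have pw : perm_eq w w0.
    by rewrite -(unzip2_edges dV rho w) -(unzip2_edges dV rho w0) perm_map.
  by rewrite !(permP pw).
pose m := boxsum (mid_box c r s) w0.
transitivity (tq ^+ m * atrailsum dV (N + M) n rho).
  rewrite /atrailsum big_distrr /=; apply: eq_big => [w|w pe]; first exact: classE.
  have [wtw wfw] := size_class w pe; rewrite -exprD boxsum_ainv //.
  rewrite /m -(mid_box_perm wtw wfw pe); congr (_ ^+ _); apply: boxsumD => a l.
  rewrite /plus_box /mid_box; case: (c %| _)%N => //=; lia.
transitivity (tq ^+ m * trailsum dV (N + M) n rho); last first.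
  rewrite /trailsum big_distrr /=; apply: eq_big => [w|w]; first by rewrite classE.
  rewrite -classE => pe; have [wtw wfw] := size_class w pe.
  rewrite -exprD boxsum_dinv // /m -(mid_box_perm wtw wfw pe).
  congr (_ ^+ _); apply/esym/boxsumD => a l.
  rewrite /minus_box /mid_box; case: (c %| _)%N => //=; lia.
suff -> : atrailsum dV (N + M) n rho = trailsum dV (N + M) n rho by [].
have sK : (K <= s * K)%N by rewrite leq_pmull.
have n_pos e : (0 < n e)%N -> exists x y, [/\ (x <= M)%N, (y <= N)%N & e.1 = posV x y].
  rewrite -has_count => /hasP[e' he' /eqP <-].
  by apply: mem_edges_pos he'; rewrite ?wt ?wf.
have levE x y : posV x y = (inZp (lev x y), inZp (x + y)) by [].
apply: (@atrailsum_trailsum _ _ _ _ _ K) => [u|u|u||w szw wtw].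
- have := balanced_edges dV rho w0 u.
  have -> : wend dV rho w0 = rho by rewrite wend_pos ?wt ?wf // !add0n pos_closed.
  by rewrite /outdeg /indeg.
(* Occupied vertices have level at most [top], and [K] steps [true] raise the level beyond [top + r]
   without reaching the modulus [L.+1]. The next condition is settled in the same way. *)
- move=> /n_pos[x [y [hx hy eu]]]; apply/eqP; rewrite -leqn0 leqNgt; apply/negP.
  move=> /n_pos[x' [y' [hx' hy' eu']]].
  have /(congr1 fst)/eqP : posV x y + - dV false = posV x' y' + dV true *+ K.
    by rewrite -[posV x' y']eu' -[posV x y]eu /= addrAC subrK.
  rewrite /= pairMnE /= opprK !inZpMn !inZpD.
  have l1 := lev_le hx hy; have l2 := lev_le hx' hy'.
  by rewrite inZp_inj; rewrite /L ?mulnS; move: sK; rewrite /K; lia.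
- move=> /n_pos[x [y [hx hy eu]]]; apply/eqP; rewrite -leqn0 leqNgt; apply/negP.
  move=> /n_pos[x' [y' [hx' hy' eu']]].
  have /(congr1 fst)/eqP : posV x y = posV x' y' + dV true *+ K.+1.
    by rewrite -[posV x' y']eu' -[posV x y]eu /= subrK.
  rewrite /= pairMnE /= !inZpMn !inZpD.
  have l1 := lev_le hx hy; have l2 := lev_le hx' hy'.
  by rewrite inZp_inj; rewrite /L ?mulnS; move: sK; rewrite /K; lia.
- rewrite -sz -(size_edges dV rho w0) /n; elim: (edges _ _ _) => [|e es IHes].
    by rewrite big1.
  rewrite /= big_split /= IHes (bigD1 e) //= eqxx big1 ?addn0 // => e' ne.
  by rewrite eq_sym (negPf ne).
have wtM : count_mem true w = M.
  rewrite wtw -wt; apply/esym/(@count_letter _ dV n true rho w0).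
  by rewrite -classE.
by rewrite wend_pos ?add0n ?wtM (falseE _ szw wtM) // pos_closed.
Qed.

Lemma boxsum_equidistributed (G : pred (seq bool)) :
  (forall w, size w = (N + M)%N -> G w -> count_mem true w = M) ->
  (forall w w', size w = (N + M)%N -> size w' = (N + M)%N ->
     perm_eq (edges dV rho w) (edges dV rho w') -> G w -> G w') ->
  \sum_(w <- words (N + M) | G w) tq ^+ boxsum (plus_box c r s) w =
  \sum_(w <- words (N + M) | G w) tq ^+ boxsum (minus_box c r s) w.
Proof.
move=> Gtrue Gclass.
(* Multiplicities are at most [N + M], so [inord] loses nothing and the classes are indexed by a
   finite type. *)
pose key w := [ffun e : V * bool => inord (count_mem e (edges dV rho w)) : 'I_(N + M).+1].
have keyE w w' : size w = (N + M)%N -> size w' = (N + M)%N ->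
    (key w == key w') = perm_eq (edges dV rho w) (edges dV rho w').
  move=> sz sz'; have le x e : size x = (N + M)%N -> (count_mem e (edges dV rho x) < (N + M).+1)%N.
    by move=> <-; rewrite ltnS -(size_edges dV rho x) count_size.
  apply/eqP/idP => [/ffunP kk|/permP pe]; last by apply/ffunP => e; rewrite !ffunE pe.
  apply/allP => e _; have := kk e; rewrite !ffunE => /(congr1 val).
  by rewrite /= !inordK ?le // => ->.
rewrite !(partition_big key xpredT) //=; apply: eq_bigr => kappa _.
have [/hasP[w0 w0k /andP[Gw0 /eqP kw0]]|none] :=
    boolP (has (fun w => G w && (key w == kappa)) (words (N + M))); last first.
  rewrite !big1_seq // => w /andP[gk wk];
  by case/hasP: none; exists w.
have sz0 : size w0 = (N + M)%N by apply/eqP; rewrite -mem_words.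
have cond w : w \in words (N + M) ->
    G w && (key w == kappa) = perm_eq (edges dV rho w) (edges dV rho w0).
  rewrite mem_words => /eqP sz; rewrite -kw0 keyE // andbC.
  by case: (boolP (perm_eq _ _)) => //= pe; apply: (Gclass w0); rewrite // perm_sym.
have red F : \sum_(w <- words (N + M) | G w && (key w == kappa)) F w =
    \sum_(w <- words (N + M) | perm_eq (edges dV rho w) (edges dV rho w0)) F w
    :> {poly int}.
  rewrite big_seq_cond [RHS]big_seq_cond; apply: eq_bigl => w.
  by apply: andb_id2l; apply: cond.
by rewrite !red; apply: class_sum => //; apply: Gtrue.
Qed.

(** A vertical step at height index [j] ending a row of length [h] has level
    [r * N + s * h - r * j], and [j] runs through a fixed interval; so the levels determine the
    size. *)
Lemma sum_levels x y w : (x + count_mem true w <= M)%N ->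
  (y + count_mem false w <= N)%N ->
  (\sum_(e <- edges dV (posV x y) w | ~~ e.2) (e.1.1 : nat)
     + r * \sum_(y <= j < y + count_mem false w) j =
   r * N * count_mem false w + s * sumn (heights x w))%N.
Proof.
elim: w x y => [|b w IHw] x y /= hx hy.
  by rewrite big_nil addn0 big_geq // !muln0.
rewrite big_cons; case: b hx hy => hx hy.
  by rewrite posV_true ?IHw //=; lia.
rewrite posV_false /=; [|lia].
rewrite add1n addnS big_ltn ?ltnS ?leq_addr // -addSn.
have := IHw x y.+1 hx; rewrite !addSn -addnS => /(_ hy) IH.
rewrite /= modn_small; last first.
  rewrite ltnS; apply: leq_trans (lev_le _ _) _; [lia|lia|].
  by rewrite /L leq_addr.
have E : (lev x y + r * y = r * N + s * x)%N.
  by rewrite /lev subnK // (leq_trans _ (leq_addr _ _)) // leq_mul2l; lia.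
by rewrite -{1}addnA mulnDr mulnS mulnDr [(_ + (r * y + _))%N]addnCA addnA E IH addnACA.
Qed.

Lemma count_residues x y w i : (x + count_mem true w <= M)%N ->
  (y + count_mem false w <= N)%N -> (i < c)%N ->
  count (fun p => p %% c == i)%N (fpos (x + y) w) =
  count (fun e : V * bool => ~~ e.2 && (e.1.2 == i :> nat)) (edges dV (posV x y) w).
Proof.
elim: w x y => [//|b w IHw] x y /= hx hy hi.
case: b hx hy => /= hx hy.
  rewrite posV_true; last by lia.
  by rewrite add0n -(IHw x.+1 y) ?addSn //=; lia.
rewrite posV_false; last by lia.
by rewrite -(IHw x y.+1) ?addnS //=; lia.
Qed.

Lemma perm_edges_heights w w' :
  count_mem true w = M -> count_mem false w = N ->
  perm_eq (edges dV rho w) (edges dV rho w') ->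
  [/\ count_mem true w' = M, sumn (heights 0 w') = sumn (heights 0 w) &
   forall i, (i < c)%N -> count (fun p => p %% c == i)%N (fpos 0 w') =
     count (fun p => p %% c == i)%N (fpos 0 w)].
Proof.
move=> wt wf pe.
have pw : perm_eq w w'.
  by rewrite -(unzip2_edges dV rho w) -(unzip2_edges dV rho w') perm_map.
have wt' : count_mem true w' = M by rewrite -wt; apply/esym/(permP pw).
have wf' : count_mem false w' = N by rewrite -wf; apply/esym/(permP pw).
split=> // [|i hi].
  have := @sum_levels 0 0 w; have := @sum_levels 0 0 w'.
  rewrite wt wf wt' wf' !add0n => /(_ (leqnn _) (leqnn _)) e' /(_ (leqnn _) (leqnn _)) e.
  move: e'; rewrite -(perm_big _ pe) /= e => /eqP.
  by rewrite eqn_add2l eqn_mul2l => /orP[/eqP h|/eqP //]; lia.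
have E x := @count_residues 0 0 x i.
by rewrite -[0%N]/(0 + 0)%N !E ?add0n ?wt ?wf ?wt' ?wf' //; apply/esym/(permP pe).
Qed.

Lemma boxsum_equidistributed_core n (f : nat -> nat) :
  \sum_(w <- words (N + M) | core_word c M n f w) tq ^+ boxsum (plus_box c r s) w =
  \sum_(w <- words (N + M) | core_word c M n f w) tq ^+ boxsum (minus_box c r s) w.
Proof.
apply: boxsum_equidistributed => [w _ /and3P[/eqP]|w w' sz sz' pe] //.
move=> /and3P[/eqP wt /eqP wn /forallP wf].
have wfalse : count_mem false w = N.
  apply: (@addnI (count_mem true w)); rewrite [RHS]addnC {2}wt -sz.
  rewrite -(count_predC (pred1 true)); congr (_ + _)%N.
  by apply: eq_count => b; case: b.
have [wt' hts res] := perm_edges_heights wt wfalse pe.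
rewrite /core_word wt' hts wn !eqxx /=; apply/forallP => i.
by rewrite res // -(eqP (wf i)).
Qed.

End RationalSlope.

(** * Diagrams and words *)

Lemma card_fset_diagram (la : intpart) (Q : pred box) :
  #|` [fset b in diagram la | Q b]%fset| =
  (\sum_(0 <= i < size (parts la)) \sum_(0 <= j < nth 0 (parts la) i) Q (i, j))%N.
Proof.
set s := parts la; set l := [seq (i, j) | i <- iota 0 (size s), j <- iota 0 (nth 0%N s i)].
have ul : uniq l.
  apply: allpairs_uniq_dep => [|i _|]; rewrite ?iota_uniq //.
  by move=> [i j] [i' j'] _ _ /= [-> ->].
have -> : [fset b in diagram la | Q b]%fset = [fset b in filter Q l]%fset.
  by apply/fsetP => b; rewrite !inE /= mem_filter andbC.
rewrite card_fseq undup_id ?filter_uniq // size_filter -sum1_count big_mkcond.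
rewrite big_allpairs_dep /index_iota subn0; apply: eq_bigr => i _.
by rewrite subn0; apply: eq_bigr => j _; case: (Q _).
Qed.

Lemma nth_sorted (s : seq nat) i j : sorted geq s -> (i <= j)%N ->
  (nth 0 s j <= nth 0 s i)%N.
Proof.
move=> ss ij; have [lt|] := ltnP j (size s); last by move=> h; rewrite nth_default.
have tr : transitive geq by move=> a b c h1 h2; exact: leq_trans h2 h1.
by have := sorted_leq_nth tr leqnn 0%N ss; apply=> //; rewrite inE ?(leq_ltn_trans ij lt).
Qed.

Lemma parts_sorted (la : intpart) : sorted geq (parts la).
Proof. by case: la => s /= /andP[]. Qed.

Lemma parts_gt0 (la : intpart) : 0%N \notin parts la.
Proof. by case: la => s /= /andP[]. Qed.

Lemma sum_nat_pred1 n i : (i < n)%N -> (\sum_(0 <= j < n) (j == i) = 1)%N.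
Proof.
by move=> lt; rewrite big_mkord (bigD1 (Ordinal lt)) //= eqxx big1 // => k; rewrite -val_eqE /= => /negPf ->.
Qed.

Lemma armE (la : intpart) i j : arm la (i, j) = (nth 0 (parts la) i - j.+1)%N.
Proof.
rewrite /arm card_fset_diagram /=; set s := parts la.
have [lt|le] := ltnP i (size s); last first.
  rewrite nth_default // sub0n big_nat_cond big1 // => i' /andP[/andP[_ lt] _].
  rewrite big1 // => j' _; case: eqP => //= e; move: lt; rewrite e ltnNge le //.
transitivity (\sum_(0 <= i' < size s) (i' == i) * (nth 0 s i - j.+1))%N.
  apply: eq_bigr => i' _; case: eqP => [->|_] /=; last by rewrite big1.
  rewrite mul1n; elim: (nth 0%N s i) => [|m IHm]; first by rewrite big_geq.
  by rewrite big_nat_recr //= IHm; case: ltnP; lia.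
by rewrite -big_distrl /= sum_nat_pred1 // mul1n.
Qed.

Lemma count_nth (P : pred nat) (s : seq nat) :
  count P s = (\sum_(0 <= i < size s) P (nth 0 s i))%N.
Proof.
by rewrite -sum1_count big_mkcond (big_nth 0%N); apply: eq_bigr => i _; case: (P _).
Qed.

Lemma legE (la : intpart) i j :
  leg la (i, j) = count (fun x => j < x)%N (drop i.+1 (parts la)).
Proof.
rewrite /leg card_fset_diagram /=; set s := parts la.
transitivity (\sum_(0 <= i' < size s) ((i < i') && (j < nth 0 s i')))%N.
  apply: eq_bigr => i' _; case: ltnP => /= [_|le]; last first.
    by rewrite big1 // => j' _; rewrite andbF.
  under eq_bigr do rewrite andbT.
  case: ltnP => [lt|le]; first exact: sum_nat_pred1.
  rewrite big_nat_cond big1 // => j' /andP[/andP[_ lt] _].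
  by case: eqP => // e; move: lt; rewrite e ltnNge le.
have [lt|le] := ltnP i (size s); last first.
  rewrite drop_oversize /= ?(leq_trans le) // big_nat_cond big1 //.
  move=> i' /andP[/andP[_ lt] _]; by rewrite ltnNge (leq_trans (ltnW lt) le).
rewrite (big_cat_nat _ (n := i.+1)) //= big_nat_cond big1 => [|i' /andP[/andP[_ h] _]].
  rewrite add0n count_nth size_drop -{1}[i.+1]add0n big_addn big_nat_cond [RHS]big_nat_cond.
  by apply: eq_bigr => k _; rewrite nth_drop addnC ltn_addr.
by rewrite ltnNge -ltnS h.
Qed.

Fixpoint boxstat (P : nat -> nat -> bool) (s : seq nat) : nat :=
  if s is x :: s' then
    (\sum_(0 <= j < x) P (x - j.+1) (count (fun y => j < y) s') + boxstat P s')%N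
  else 0%N.

Lemma card_boxstat (la : intpart) (P : nat -> nat -> bool) :
  #|` [fset b in diagram la | P (arm la b) (leg la b)]%fset| = boxstat P (parts la).
Proof.
rewrite card_fset_diagram.
under eq_bigr do under eq_bigr do rewrite armE legE.
elim: (parts la) => [|x s IHs] /=; first by rewrite big_geq.
by rewrite big_nat_recl //= drop0 IHs.
Qed.

Lemma boxstat_cat0 P s k : boxstat P (s ++ nseq k 0%N) = boxstat P s.
Proof.
elim: s => [|x s IHs] /=.
  by elim: k => //= k ->; rewrite big_geq.
rewrite IHs; congr (_ + _)%N; apply: eq_bigr => j _; congr (nat_of_bool (P _ _)).
by rewrite count_cat count_nseq mul0n addn0.
Qed.

Lemma heights_rcons x w b :
  heights x (rcons w b) =
  if b then heights x w else rcons (heights x w) (x + count_mem true w)%N.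
Proof.
elim: w x => [|b' w IHw] x /=; first by case: b; rewrite /= ?addn0.
by case: b'; rewrite IHw; clear IHw; case: b => //=; rewrite ?add0n ?add1n ?addSnnS.
Qed.

Lemma fpos_rcons p w b :
  fpos p (rcons w b) = if b then fpos p w else rcons (fpos p w) (p + size w)%N.
Proof.
elim: w p => [|b' w IHw] p /=; first by case: b; rewrite /= ?addn0.
by case: b'; rewrite IHw; clear IHw; case: b => //=; rewrite ?addSnnS.
Qed.

(** These are the boxes created by one more [false] appended to [w], that is, the boxes of a new
    longest row. *)
Fixpoint rowsum (P : nat -> nat -> bool) (w : seq bool) : nat :=
  if w is b :: w' then
    (b * P (count_mem true w') (count_mem false w') + rowsum P w')%N
  else 0%N.

Lemma colsum_rcons P a l w b : colsum P a l (rcons w b) =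
  (colsum P a l w + ~~ b * P (a + count_mem true w) (l + count_mem false w))%N.
Proof.
elim: w a l => [|b' w IHw] a l /=; first by case: b; rewrite /= ?addn0 ?mul1n.
by case: b'; rewrite IHw ?add0n ?add1n ?addSnnS ?addnA.
Qed.

Lemma boxsum_rcons P w b :
  boxsum P (rcons w b) = (boxsum P w + ~~ b * rowsum P w)%N.
Proof.
elim: w => [|b' w IHw] /=; first by case: b.
case: b'; rewrite IHw ?colsum_rcons ?mul0n ?add0n // mul1n mulnDr.
by rewrite !addnA; congr (_ + _)%N; rewrite -!addnA; congr (_ + _)%N; rewrite addnC.
Qed.

Lemma heightsS x w : heights x.+1 w = map S (heights x w).
Proof. by elim: w x => [|[] w IHw] x //=; rewrite IHw. Qed.

Lemma size_heights x w : size (heights x w) = count_mem false w.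
Proof. by elim: w x => [|[] w IHw] x //=; rewrite IHw. Qed.

Lemma rowsumE P w : rowsum P w =
  (\sum_(0 <= j < count_mem true w)
     P (count_mem true w - j.+1) (count (fun y => j < y) (heights 0 w)))%N.
Proof.
elim: w => [|b w IHw] /=; first by rewrite big_geq.
case: b => /=; last by rewrite IHw add0n.
rewrite add1n big_nat_recl // mul1n subSS subn0 IHw heightsS; congr (_ + _)%N.
  by congr (nat_of_bool (P _ _)); rewrite count_map -(size_heights 0) -count_predT.
by apply: eq_bigr => j _; rewrite subSS count_map.
Qed.

(** The induction is on the last letter: after [rev] the row of the last [false] is the head of the
    list, which [boxstat] peels off. *)
Lemma boxstat_heights P w : boxstat P (rev (heights 0 w)) = boxsum P w.
Proof.
elim/last_ind: w => [//|w b IHw]; rewrite heights_rcons boxsum_rcons.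
case: b => /=; first by rewrite addn0.
rewrite rev_rcons /= IHw add0n mul1n addnC rowsumE; congr (_ + _)%N.
by apply: eq_bigr => j _; rewrite count_rev.
Qed.

(** The beta-set of the row lengths, in strictly decreasing order when these are sorted. *)
Fixpoint beads (s : seq nat) : seq nat :=
  if s is x :: s' then (x + size s')%N :: beads s' else [::].

Definition pad (N : nat) (la : intpart) : seq nat :=
  parts la ++ nseq (N - size (parts la)) 0%N.

Definition residue_count (c N : nat) (la : intpart) (i : nat) : nat :=
  count (fun p => p %% c == i)%N (beads (pad N la)).

Lemma size_pad N la : (size (parts la) <= N)%N -> size (pad N la) = N.
Proof. by move=> le; rewrite size_cat size_nseq subnKC. Qed.

Lemma geq_trans : transitive geq.
Proof. by move=> a b d h1 h2; exact: leq_trans h2 h1. Qed.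

Lemma part_of_subproof (s : seq nat) :
  is_partition (sort geq (filter (fun x => 0 < x)%N s)).
Proof.
apply/andP; split; last by rewrite mem_sort mem_filter.
by apply: sort_sorted => a b; rewrite /geq leq_total.
Qed.

Definition part_of (s : seq nat) : intpart := Intpart (part_of_subproof s).
Definition wpart (w : seq bool) : intpart := part_of (rev (heights 0 w)).

Lemma part_ofE s : sorted geq s -> parts (part_of s) = filter (fun x => 0 < x)%N s.
Proof.
move=> ss; rewrite /= (sorted_sort geq_trans) //.
exact: (sorted_filter geq_trans).
Qed.

Lemma parts_inj : injective parts. Proof. exact: val_inj. Qed.

Lemma partsK la : part_of (parts la) = la.
Proof.
apply: parts_inj; rewrite part_ofE ?parts_sorted //; apply/all_filterP.
by apply/allP => x hx; rewrite lt0n; apply: contraNneq (parts_gt0 la) => <-.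
Qed.

Lemma filter_pos_pad s : sorted geq s ->
  filter (fun x => 0 < x)%N s
    ++ nseq (size s - size (filter (fun x => 0 < x)%N s)) 0%N = s.
Proof.
elim: s => [//|x s IHs] /= ss; have ss' := path_sorted ss.
case: ltnP => /= [_|]; first by rewrite subSS IHs.
rewrite leqn0 => /eqP x0; subst x.
have s0 : s = nseq (size s) 0%N.
  apply/all_pred1P/allP => y hy; move: (order_path_min geq_trans ss).
  by move/allP => /(_ y hy); rewrite /geq /= leqn0.
have -> : filter (fun x => 0 < x)%N s = [::].
  by rewrite s0; elim: (size s).
by rewrite /= {2}s0.
Qed.

Lemma heights_ge x w : all (leq x) (heights x w).
Proof.
elim: w x => [|[] w IHw] x //=; last by rewrite leqnn IHw.
by apply: sub_all (IHw x.+1) => y; exact: ltnW.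
Qed.

Lemma heights_sorted x w : sorted leq (heights x w).
Proof.
elim: w x => [|[] w IHw] x //=.
by rewrite path_sortedE ?heights_ge ?IHw //; exact: leq_trans.
Qed.

Lemma rev_heights_sorted w : sorted geq (rev (heights 0 w)).
Proof. by rewrite rev_sorted; exact: heights_sorted. Qed.

Lemma pad_wpart w : pad (count_mem false w) (wpart w) = rev (heights 0 w).
Proof.
rewrite /pad /wpart part_ofE ?rev_heights_sorted // -(size_heights 0) -size_rev.
by rewrite filter_pos_pad ?rev_heights_sorted.
Qed.

Lemma psize_wpart w : psize (wpart w) = sumn (heights 0 w).
Proof.
rewrite -sumn_rev -pad_wpart /pad sumn_cat sumn_nseq mul0n addn0 //.
Qed.

Lemma boxstat_wpart P w : boxstat P (parts (wpart w)) = boxsum P w.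
Proof. by rewrite -boxstat_heights -pad_wpart boxstat_cat0. Qed.

Lemma size_beads s : size (beads s) = size s.
Proof. by elim: s => //= x s ->. Qed.

Lemma beads_heights w : beads (rev (heights 0 w)) = rev (fpos 0 w).
Proof.
elim/last_ind: w => [//|w b IHw]; rewrite heights_rcons fpos_rcons.
case: b => //; rewrite !rev_rcons /= IHw size_rev size_heights !add0n.
congr (_ :: _); rewrite -(count_predC (pred1 true)); congr (_ + _)%N.
by apply: eq_count => -[].
Qed.

Lemma residue_count_wpart c w i :
  residue_count c (count_mem false w) (wpart w) i =
  count (fun p => p %% c == i)%N (fpos 0 w).
Proof. by rewrite /residue_count pad_wpart beads_heights count_rev. Qed.

Fixpoint word_of (x M : nat) (hs : seq nat) : seq bool :=
  if hs is h :: hs' then nseq (h - x) true ++ false :: word_of h M hs'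
  else nseq (M - x) true.

Lemma heights_nseq_cat x k w : heights x (nseq k true ++ w) = heights (x + k) w.
Proof. by elim: k x => [|k IHk] x; rewrite ?addn0 //= IHk addSnnS. Qed.

Lemma heights_word_of x M hs : path leq x hs -> heights x (word_of x M hs) = hs.
Proof.
elim: hs x => [|h hs IHhs] x /=.
  by rewrite -[nseq _ _]cats0 heights_nseq_cat.
by case/andP => xh ph; rewrite heights_nseq_cat subnKC //= IHhs.
Qed.

Lemma count_word_of x M hs : path leq x hs -> all (geq M) (x :: hs) ->
  count_mem true (word_of x M hs) = (M - x)%N.
Proof.
elim: hs x => [|h hs IHhs] x /=; first by rewrite count_nseq mul1n.
case/andP => xh ph /and3P[xM hM hsM].
rewrite count_cat count_nseq /= IHhs /= ?hM //; move: xM hM; rewrite /geq /=; lia.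
Qed.

Lemma size_word w : size w = (count_mem false w + count_mem true w)%N.
Proof.
rewrite -(count_predC (pred1 false)); congr (_ + _)%N.
by apply: eq_count => -[].
Qed.

Lemma heights_inj x w w' : size w = size w' -> heights x w = heights x w' -> w = w'.
Proof.
elim: w w' x => [|b w IHw] [|b' w'] x //= [sz].
have low v v' : heights x.+1 v = x :: v' -> False.
  by move=> e; have := heights_ge x.+1 v; rewrite e /= ltnn.
case: b b' => [] [] //.
- by move/(IHw _ _ sz) => ->.
- by move/low.
- by move/esym/low.
by case=> /(IHw _ _ sz) => ->.
Qed.

Lemma size_parts_le la : (size (parts la) <= psize la)%N.
Proof.
rewrite /psize; move: (parts_gt0 la); elim: (parts la) => //= x s IHs.
by rewrite inE negb_or eq_sym -lt0n => /andP[x0 /IHs]; lia.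
Qed.

Lemma parts_le la x : x \in parts la -> (x <= psize la)%N.
Proof.
rewrite /psize; elim: (parts la) => //= y s IHs; rewrite inE => /orP[/eqP ->|/IHs].
  exact: leq_addr.
by move/leq_trans; apply; exact: leq_addl.
Qed.

Lemma pad_sorted N la : sorted geq (pad N la).
Proof.
rewrite /pad; have ks x k : path geq x (nseq k 0%N) by elim: k x => //= k IHk x; rewrite IHk.
have := parts_sorted la; case: (parts la) => [|x s] /=.
  by move=> _; case: (N - _)%N => //= k; exact: ks.
by rewrite cat_path ks andbT.
Qed.

Lemma part_of_pad N la : part_of (pad N la) = la.
Proof.
rewrite -[RHS]partsK; apply: parts_inj; rewrite !part_ofE ?pad_sorted ?parts_sorted //.
by rewrite filter_cat filter_nseq ltnn cats0.
Qed.

Lemma wpart_surj la N M : (size (parts la) <= N)%N ->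
  (forall x, x \in parts la -> x <= M)%N ->
  exists2 w, w \in words (N + M) &
    [/\ count_mem true w = M, count_mem false w = N & wpart w = la].
Proof.
move=> leN leM; pose hs := rev (pad N la); pose w := word_of 0 M hs.
have hs_sorted : sorted leq hs.
  by rewrite /hs rev_sorted pad_sorted.
have hs_path : path leq 0 hs by rewrite path_sortedE ?hs_sorted ?andbT; [apply/allP | exact: leq_trans].
have wh : heights 0 w = hs by rewrite heights_word_of.
have wt : count_mem true w = M.
  rewrite count_word_of ?subn0 //=; apply/allP => x; rewrite mem_rev mem_cat.
  by case/orP => [/leM|/nseqP[-> //]].
have wf : count_mem false w = N by rewrite -(size_heights 0) wh size_rev size_pad.
have wla : wpart w = la.
  by rewrite /wpart wh revK part_of_pad.
by exists w => //; rewrite mem_words size_word wt wf.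
Qed.

(** A partition of [n] fits into the rectangle because [n <= N] and [n <= M], and it then has
    exactly one boundary word there. *)
Lemma perm_wpart (c n N M : nat) (f : nat -> nat) (A : {fset intpart}) :
  (n <= N)%N -> (n <= M)%N ->
  (forall la, la \in A <-> psize la = n /\
     forall i, (i < c)%N -> residue_count c N la i = f i) ->
  perm_eq [seq wpart w | w <- words (N + M) & core_word c M n f w] A.
Proof.
move=> nN nM HA.
have falseN w : w \in words (N + M) -> count_mem true w = M -> count_mem false w = N.
  by rewrite mem_words size_word => /eqP e wt; apply: (@addIn M); rewrite -{1}wt.
apply: uniq_perm => [||la].
- rewrite map_inj_in_uniq ?filter_uniq ?words_uniq // => w w'.
  rewrite !mem_filter => /andP[/and3P[/eqP wt _ _] hw] /andP[/and3P[/eqP wt' _ _] hw'] e.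
  apply: (@heights_inj 0); first by move: hw hw'; rewrite !mem_words => /eqP -> /eqP ->.
  by apply: (can_inj revK); rewrite -!pad_wpart (falseN w) // (falseN w') // e.
- exact: fset_uniq.
apply/mapP/idP => [[w]|].
  rewrite mem_filter => /andP[/and3P[/eqP wt /eqP wn /forallP wf] hw ->].
  apply/HA; split; first by rewrite psize_wpart.
  move=> i hi; rewrite -{1}(falseN w hw wt) residue_count_wpart.
  by apply/eqP; exact: (wf (Ordinal hi)).
move/HA => [szl resl]; have leN : (size (parts la) <= N)%N.
  by apply: leq_trans (size_parts_le la) _; rewrite szl.
have [w hw [wt wf wla]] : exists2 w, w \in words (N + M) &
    [/\ count_mem true w = M, count_mem false w = N & wpart w = la].
  by apply: wpart_surj => // x /parts_le; rewrite szl => h; exact: leq_trans nM.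
exists w => //; rewrite mem_filter hw andbT.
apply/and3P; split; first by rewrite wt.
  by rewrite -psize_wpart wla szl.
by apply/forallP => i; rewrite -residue_count_wpart wf wla resl.
Qed.

(** * Rimhooks and beads *)

Section Rimhooks.
Variable c : nat.

Definition row (la : intpart) (k : nat) : nat := nth 0%N (parts la) k.
Definition bead (N : nat) (la : intpart) (k : nat) : nat := (row la k + (N - k.+1))%N.

Lemma nth_beads s k : (k < size s)%N ->
  nth 0%N (beads s) k = (nth 0%N s k + (size s - k.+1))%N.
Proof.
elim: s k => //= x s IHs [|k] /=; first by rewrite subSS subn0.
by rewrite ltnS subSS => /IHs.
Qed.

Lemma nth_pad N la k : nth 0%N (pad N la) k = row la k.
Proof.
rewrite nth_cat nth_nseq /row; case: ltnP => // le.
by rewrite nth_default //; case: ifP.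
Qed.

Lemma sum_bead N la (f : nat -> nat) : (size (parts la) <= N)%N ->
  (\sum_(x <- beads (pad N la)) f x = \sum_(0 <= k < N) f (bead N la k))%N.
Proof.
move=> le; rewrite (big_nth 0%N) size_beads size_pad //.
rewrite big_nat_cond [RHS]big_nat_cond; apply: eq_bigr => k /andP[/andP[_ lt] _].
by rewrite nth_beads ?size_pad // nth_pad.
Qed.

Lemma residue_countE N la i : (size (parts la) <= N)%N ->
  residue_count c N la i = (\sum_(0 <= k < N) (bead N la k %% c == i))%N.
Proof.
move=> le; rewrite -(sum_bead (fun p => nat_of_bool (p %% c == i)%N)) //.
by rewrite /residue_count -sum1_count big_mkcond; apply: eq_bigr => x _; case: eqP.
Qed.

Lemma psizeE N la : (size (parts la) <= N)%N -> psize la = (\sum_(0 <= k < N) row la k)%N.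
Proof.
move=> le; transitivity (sumn (pad N la)).
  by rewrite /pad sumn_cat sumn_nseq mul0n addn0.
rewrite sumnE (big_nth 0%N) size_pad //.
by apply: eq_bigr => k _; rewrite nth_pad.
Qed.

(** Between [i0] and [i1] the values are shifted by one place, so as multisets the two families
    differ by one exchange, of [g i0] for [g' i1]. Applied to beads, this is a rimhook removal. *)
Lemma sum_shifted N i0 i1 (g g' f : nat -> nat) : (i0 <= i1 < N)%N ->
  (forall k, (k < i0) || (i1 < k) -> g' k = g k)%N ->
  (forall k, (i0 <= k < i1)%N -> g' k = g k.+1) ->
  (\sum_(0 <= k < N) f (g' k) + f (g i0) = \sum_(0 <= k < N) f (g k) + f (g' i1))%N.
Proof.
move=> /andP[le01 lt1N] gout gin.
have split3 (F : nat -> nat) : (\sum_(0 <= k < N) F k =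
    \sum_(0 <= k < i0) F k + \sum_(i0 <= k < i1.+1) F k + \sum_(i1.+1 <= k < N) F k)%N.
  rewrite -big_cat_nat //=; last exact: leqW.
  by rewrite -big_cat_nat.
rewrite !split3.
have -> : (\sum_(0 <= k < i0) f (g' k) = \sum_(0 <= k < i0) f (g k))%N.
  rewrite big_nat_cond [RHS]big_nat_cond; apply: eq_bigr => k /andP[/andP[_ lt] _].
  by rewrite gout ?lt.
have -> : (\sum_(i1.+1 <= k < N) f (g' k) = \sum_(i1.+1 <= k < N) f (g k))%N.
  rewrite big_nat_cond [RHS]big_nat_cond; apply: eq_bigr => k /andP[/andP[lt _] _].
  by rewrite gout ?lt ?orbT.
have -> : (\sum_(i0 <= k < i1.+1) f (g k) = f (g i0) + \sum_(i0 <= k < i1) f (g k.+1))%N.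
  by rewrite big_ltn ?ltnS // big_add1.
rewrite (big_nat_recr i1) //=.
have -> : (\sum_(i0 <= k < i1) f (g' k) = \sum_(i0 <= k < i1) f (g k.+1))%N.
  rewrite big_nat_cond [RHS]big_nat_cond; apply: eq_bigr => k /andP[h _].
  by rewrite gin.
lia.
Qed.

Lemma row_mono la i j : (i <= j)%N -> (row la j <= row la i)%N.
Proof. by apply: nth_sorted; exact: parts_sorted. Qed.

Lemma card_diagram la : #|` diagram la| = psize la.
Proof.
have -> : diagram la = [fset b in diagram la | true]%fset.
  by apply/fsetP => b; rewrite !inE /= andbT.
rewrite card_fset_diagram (@psizeE (size (parts la))) //.
by apply: eq_bigr => i _; rewrite sum_nat_const_nat subn0 muln1.
Qed.

Lemma row_le_size la k : (0 < row la k)%N -> (k < size (parts la))%N.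
Proof.
by have [//|h] := ltnP k (size (parts la)); rewrite /row nth_default.
Qed.

Lemma row_size_gt0 la k : (k < size (parts la))%N -> (0 < row la k)%N.
Proof.
move=> lt; rewrite lt0n; apply: contraNneq (parts_gt0 la) => <-.
exact: mem_nth.
Qed.

Lemma row_inj la nu : (forall k, row la k = row nu k) -> la = nu.
Proof.
move=> e; apply: parts_inj.
have sz : size (parts la) = size (parts nu).
  case: (ltngtP (size (parts la)) (size (parts nu))) => // /row_size_gt0.
    by rewrite -e /row nth_default.
  by rewrite e /row nth_default.
by apply: (eq_from_nth (x0 := 0%N)) => // k _; exact: e.
Qed.

(** A discrete intermediate value argument: the row index changes by at most one at a time, and the
    column is kept when it changes. *)
Lemma path_crosses_row (b : box) p j : path adjacent b p -> (b.1 <= j)%N ->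
  (j < (last b p).1)%N ->
  exists y, (j, y) \in b :: p /\ (j.+1, y) \in b :: p.
Proof.
elim: p b => [|b' p IHp] b /=; first by move=> _ h1 h2; move: h2; rewrite ltnNge h1.
case/andP=> adj pp hb hl; have [h|h] := leqP b'.1 j.
  have [y [y1 y2]] := IHp b' pp h hl.
  by exists y; rewrite inE y1 orbT inE y2 orbT.
case: b b' adj hb h {IHp pp hl} => [i y] [i' y'] /=; rewrite /adjacent /= => adj hb h.
have [-> -> ->] : [/\ y' = y, i = j & i' = j.+1].
  by case/orP: adj => /andP[/eqP]; [lia | move=> -> /orP[]/eqP; split=> //; lia].
by exists y; rewrite !inE !eqxx !orbT.
Qed.

Hypothesis c_gt0 : (0 < c)%N.

(** Connectedness makes consecutive rows of the rimhook share a column, and the absence of a 2 by 2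
    square makes this column unique. *)
Lemma remove_rimhook_rows la nu : remove_rimhook c la nu ->
  [/\ forall k, (row nu k <= row la k)%N, psize la = (psize nu + c)%N
    & exists i0 i1, [/\ (i0 <= i1 < size (parts la))%N,
        forall k, (k < i0) || (i1 < k) -> row nu k = row la k &
        forall k, (i0 <= k < i1)%N -> (row nu k).+1 = row la k.+1]%N].
Proof.
case=> A [subA cardA connA no22 _] dnu.
have inA i j : ((i, j) \in A) = (row nu i <= j < row la i)%N.
  have : ((i, j) \in diagram nu) = ((i, j) \in diagram la) && ((i, j) \notin A).
    by rewrite dnu in_fsetD andbC.
  rewrite !mem_diagram -/(row nu i) -/(row la i) (leqNgt (row nu i) j) => ->.
  have : (i, j) \in A -> (j < row la i)%N.
    by move/(fsubsetP subA); rewrite mem_diagram.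
  by case: ((i, j) \in A) => [->//|_]; rewrite /= andbT; case: (_ < _)%N.
have le k : (row nu k <= row la k)%N.
  have := mem_diagram nu k (row nu k).-1.
  rewrite -/(row nu k); case: (row nu k) => // m /=; rewrite ltnSn dnu in_fsetD.
  by case/andP => _; rewrite mem_diagram.
have sz : psize la = (psize nu + c)%N.
  rewrite -!card_diagram dnu -cardA cardfsD.
  have -> : (diagram la `&` A)%fset = A by apply/fsetIidPr.
  by rewrite subnK // fsubset_leq_card.
have touched k k' j : (row nu k < row la k)%N -> (row nu k' < row la k')%N ->
    (k <= j < k')%N -> (row nu j).+1 = row la j.+1.
  move=> hk hk' /andP[kj jk'].
  have kA : (k, row nu k) \in A by rewrite inA leqnn.
  have kA' : (k', row nu k') \in A by rewrite inA leqnn.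
  have [p [pp lp /allP pA]] := connA _ _ kA kA'.
  have [|y [y1 y2]] := path_crosses_row pp kj; first by rewrite lp.
  have inpA b : b \in (k, row nu k) :: p -> b \in A.
    by rewrite inE => /orP[/eqP ->|/pA].
  have := inpA _ y1; have := inpA _ y2; rewrite !inA => /andP[_ h1] /andP[h2 _].
  apply/eqP; rewrite eqn_leq (leq_ltn_trans h2 h1) leqNgt; apply/negP => h.
  have := no22 j (row nu j); rewrite !inA.
  have := row_mono la (leqnSn j); have := row_mono nu (leqnSn j); lia.
have [k0 hk0] : exists k, (row nu k < row la k)%N.
  apply/not_existsP => h; suff : psize la = psize nu by rewrite sz; lia.
  by congr psize; apply: row_inj => k; apply/eqP; rewrite eqn_leq le leqNgt (introN idP (h k)).
have ub k : (row nu k < row la k)%N -> (k <= size (parts la))%N.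
  by move=> h; apply/ltnW/row_le_size/(leq_ltn_trans _ h).
have ex : exists k, (row nu k < row la k)%N by exists k0.
case: (ex_minnP ex) => i0 h0 min0; case: (ex_maxnP ex ub) => i1 h1 max1.
split=> //; exists i0, i1; split=> [|k out|k hk].
- by rewrite min0 //=; apply/row_le_size/(leq_ltn_trans _ h1).
- apply/eqP; rewrite eqn_leq le leqNgt; apply/negP => h.
  by have := min0 _ h; have := max1 _ h; lia.
- exact: touched h0 h1 hk.
Qed.

(** One bead moves; comparing the sums of all beads shows that it moves by exactly [c]. *)
Lemma remove_rimhook_residue la nu N i : remove_rimhook c la nu ->
  (size (parts la) <= N)%N ->
  (size (parts nu) <= N)%N /\ residue_count c N nu i = residue_count c N la i.
Proof.
case/remove_rimhook_rows => le sz [i0 [i1 [/andP[le01 lt1] out inn]]] szN.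
have sznu : (size (parts nu) <= N)%N.
  apply: leq_trans szN; rewrite leqNgt; apply/negP => /row_size_gt0 h.
  by have := leq_trans h (le _); rewrite /row nth_default.
split=> //; rewrite !residue_countE //.
have i01 : (i0 <= i1 < N)%N by rewrite le01 (leq_trans lt1).
have gout k : (k < i0)%N || (i1 < k)%N -> bead N nu k = bead N la k.
  by move=> h; rewrite /bead out.
have gin k : (i0 <= k < i1)%N -> bead N nu k = bead N la k.+1.
  by move=> h; rewrite /bead -inn //; move: h i01; lia.
have sumE x : (size (parts x) <= N)%N -> (\sum_(0 <= k < N) bead N x k =
    psize x + \sum_(0 <= k < N) (N - k.+1))%N.
  by move=> hx; rewrite (psizeE hx) -big_split.
have b01 : (bead N la i0 = bead N nu i1 + c)%N.
  by have := sum_shifted id i01 gout gin; rewrite !sumE // sz; lia.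
have := sum_shifted (fun p => nat_of_bool (p %% c == i)%N) i01 gout gin.
by rewrite b01 modnDr => /addIn.
Qed.

End Rimhooks.

Section BeadMoves.
Variable c : nat.

Lemma nth_part_of s k : sorted geq s -> row (part_of s) k = nth 0%N s k.
Proof.
move=> ss; rewrite /row part_ofE // -[in RHS](filter_pos_pad ss) nth_cat nth_nseq.
by case: ltnP => // h; rewrite nth_default //; case: ifP.
Qed.

Lemma sorted_mkseq (m : nat -> nat) N : (forall k, (k.+1 < N)%N -> (m k.+1 <= m k)%N) ->
  sorted geq (mkseq m N).
Proof.
move=> hm; apply/(sortedP 0%N) => k; rewrite size_mkseq => h.
by rewrite !nth_mkseq ?(ltnW h) //; apply: hm.
Qed.

Definition box_connected (A : {fset box}) (b b' : box) :=
  exists p : seq box, [/\ path adjacent b p, last b p = b' & all (mem A) p].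

Lemma box_connected_trans A b1 b2 b3 :
  box_connected A b1 b2 -> box_connected A b2 b3 -> box_connected A b1 b3.
Proof.
move=> [p [p1 p2 p3]] [p' [p1' p2' p3']]; exists (p ++ p').
by rewrite cat_path last_cat all_cat p1 p2 p3.
Qed.

Lemma adjacent_sym : symmetric adjacent.
Proof.
move=> [i j] [i' j']; rewrite /adjacent /= [i' == i]eq_sym [j' == j]eq_sym.
by rewrite (orbC (j == _)) (orbC (i == i'.+1)).
Qed.

Lemma box_connected_sym A b b' : b \in A ->
  box_connected A b b' -> box_connected A b' b.
Proof.
move=> bA [p [p1 p2 p3]]; exists (rev (belast b p)); split.
- by rewrite -p2 rev_path; rewrite (eq_path (e' := adjacent)) // => x y; exact: adjacent_sym.
- by rewrite -p2; case: p {p1 p2 p3} => //= x p; rewrite rev_cons last_rcons.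
rewrite all_rev; apply/allP => x /mem_belast; rewrite inE => /orP[/eqP -> //|].
exact: (allP p3).
Qed.

Lemma box_connected1 (A : {fset box}) b b' : adjacent b b' -> b' \in A -> box_connected A b b'.
Proof. by move=> h hA; exists [:: b']; rewrite /= h hA. Qed.

(** The converse construction, from prescribed row lengths [m]. A box is joined to the leftmost box
    of row [i1] by running left in its row, stepping to the last box of the next row, and
    repeating. *)
Lemma remove_ribbon (la : intpart) N i0 i1 (m : nat -> nat) :
  (i0 <= i1 < N)%N -> (size (parts la) <= N)%N ->
  (forall k, (k < i0)%N || (i1 < k)%N -> m k = row la k) ->
  (forall k, (i0 <= k < i1)%N -> (m k).+1 = row la k.+1) ->
  (m i1 < row la i1)%N -> (row la i1.+1 <= m i1)%N ->
  (\sum_(0 <= k < N) row la k = \sum_(0 <= k < N) m k + c)%N ->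
  exists nu, remove_rimhook c la nu.
Proof.
move=> /andP[le01 lt1N] szN mout min mi1 mi1' msum.
have mlt k : (i0 <= k <= i1)%N -> (m k < row la k)%N.
  move=> /andP[h1]; rewrite leq_eqVlt => /orP[/eqP -> //|h2].
  by rewrite min ?h1 //; apply: row_mono.
have mle k : (m k <= row la k)%N.
  have [h|h] := boolP ((k < i0) || (i1 < k))%N; first by rewrite mout.
  by apply/ltnW/mlt; move: h; lia.
have mmono k : (m k.+1 <= m k)%N.
  have r := row_mono la (leqnSn k).
  have [h|h] := boolP ((k < i0) || (i1 < k))%N.
    by rewrite [m k]mout //; apply: leq_trans (mle _) r.
  have [->|ne] := eqVneq k i1; first by rewrite mout ?ltnSn ?orbT.
  have hk : (i0 <= k < i1)%N by move: h ne; lia.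
  by rewrite -ltnS (min k) //; apply: mlt; move: hk; lia.
have mN k : (N <= k)%N -> m k = 0%N.
  move=> h; rewrite mout; last by rewrite (leq_trans lt1N h) orbT.
  by rewrite /row nth_default // (leq_trans szN).
pose nu := part_of (mkseq m N).
have rnu k : row nu k = m k.
  rewrite nth_part_of; last by apply: sorted_mkseq.
  by have [h|h] := ltnP k N; [rewrite nth_mkseq | rewrite nth_default ?size_mkseq // mN].
have sznu : (size (parts nu) <= N)%N.
  by rewrite leqNgt; apply/negP => /row_size_gt0; rewrite rnu mN.
pose A := (diagram la `\` diagram nu)%fset.
have inA i j : ((i, j) \in A) = (m i <= j < row la i)%N.
  by rewrite in_fsetD !mem_diagram -/(row nu i) rnu -leqNgt.
have subnu : (diagram nu `<=` diagram la)%fset.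
  apply/fsubsetP => -[i j]; rewrite !mem_diagram -/(row nu i) rnu => h.
  exact: leq_trans h (mle i).
have dnu : diagram nu = (diagram la `\` A)%fset.
  apply/fsetP => b; rewrite !in_fsetD negb_and negbK.
  by case hb: (b \in diagram nu) => //=; [rewrite (fsubsetP subnu) | case: (_ \in _)].
exists nu, A => //; split.
- exact: fsubsetDl.
- rewrite cardfsD; have -> : (diagram la `&` diagram nu)%fset = diagram nu by apply/fsetIidPr.
  rewrite !card_diagram (psizeE szN) (psizeE sznu) msum.
  by under [X in (_ - X)%N]eq_bigr do rewrite rnu; rewrite addKn.
- have rowA i j : (i, j) \in A -> (i0 <= i <= i1)%N.
    rewrite inA => h; case: (boolP (i0 <= i <= i1)%N) => //.
    by rewrite negb_and -!ltnNge => /mout e; move: h; rewrite e; lia.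
  have left i j : (i, j) \in A -> box_connected A (i, j) (i, m i).
    elim: j => [|j IHj] hA; first by exists [::]; move: hA; rewrite inA; case: (m i).
    have [e|ne] := eqVneq (m i) j.+1; first by exists [::]; rewrite e.
    have jA : (i, j) \in A by move: hA ne; rewrite !inA; lia.
    apply: box_connected_trans (IHj jA).
    by apply: box_connected1 => //; rewrite /adjacent /= !eqxx ?orbT.
  have up i : (i0 <= i <= i1)%N -> box_connected A (i, m i) (i1, m i1).
    move=> /andP[h0 h1]; rewrite -(subKn h1); move: (leq_subr i i1).
    have : (i0 <= i1 - (i1 - i))%N by rewrite subKn.
    elim: (i1 - i)%N => [|k IHk] hk1 hk2; first by rewrite subn0; exists [::].
    set r := (i1 - k.+1)%N; have er : (r.+1 = i1 - k)%N by rewrite /r; lia.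
    have hr : (i0 <= r < i1)%N by move: hk1 hk2; rewrite /r; lia.
    have upA : (r.+1, m r) \in A by rewrite inA mmono -min ?leqnn.
    have := IHk _ _; rewrite -er => IH.
    apply: box_connected_trans (box_connected_trans (left _ _ upA) (IH _ _)).
    + by apply: box_connected1 => //; rewrite /adjacent /= !eqxx ?orbT.
    + by move: hr; lia.
    + by move: hk2; lia.
  move=> [i j] [i' j'] bA bA'.
  apply: (@box_connected_trans _ _ (i1, m i1)).
    exact: box_connected_trans (left _ _ bA) (up _ (rowA _ _ bA)).
  apply: box_connected_sym => //.
  exact: box_connected_trans (left _ _ bA') (up _ (rowA _ _ bA')).
- move=> i j; apply/negP => /and4P[]; rewrite !inA => h1 h2 h3 h4.
  have hi : (i0 <= i < i1)%N.
    case: (boolP (i0 <= i <= i1)%N) => [hi|].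
      have [ei|ne] := eqVneq i i1; last by move: hi ne; lia.
      by move: h4; rewrite mout ?ei ?ltnSn ?orbT //; lia.
    by rewrite negb_and -!ltnNge => /mout e; move: h1; rewrite e; lia.
  by have := min _ hi; move: h1 h4; lia.
by exists nu.
Qed.

End BeadMoves.

Section Cores.
Variable c : nat.
Hypothesis c_gt0 : (0 < c)%N.

Definition flush N la := forall k, (k < N)%N -> (c <= bead N la k)%N ->
  exists2 k', (k' < N)%N & bead N la k' = (bead N la k - c)%N.

(** A bead with a free place [c] below it could be slid there, and reordering the beads turns the
    slide into the removal of a rimhook. *)
Lemma core_flush la N : is_core c la -> (size (parts la) <= N)%N -> flush N la.
Proof.
move=> core szN i0 lt0 cle; apply: contrapT => nobead.
case: core; set v := (bead N la i0 - c)%N in nobead.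
have vne k : (k < N)%N -> bead N la k <> v by move=> h e; apply: nobead; exists k.
have ex : exists j, (j < N)%N && (v < bead N la j)%N.
  by exists i0; rewrite lt0 /v; lia.
have ub j : (j < N)%N && (v < bead N la j)%N -> (j <= N)%N by case/andP => /ltnW.
(* The slid bead lands in row [i1], the last row whose bead exceeds the free place; the rows in
   between move up by one. *)
case: (ex_maxnP ex ub) => i1 /andP[lt1 v1] max1.
have le01 : (i0 <= i1)%N by apply: max1; rewrite lt0 /v; lia.
have above : (i1.+1 < N)%N -> (bead N la i1.+1 < v)%N.
  move=> h; rewrite ltn_neqAle (introN eqP (vne _ h)) leqNgt; apply/negP => h'.
  by have := max1 i1.+1; rewrite h h' ltnn => /(_ isT).
(* The free place lies above all later beads, so the new row length [v + i1.+1 - N] is not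
   truncated. *)
have vN : (N - i1.+1 <= v)%N.
  have [h|h] := ltnP i1.+1 N; last by move: h; lia.
  by have := above h; rewrite /bead; lia.
have row1 : (0 < row la i1)%N by move: v1; rewrite /bead; lia.
pose m j := if (i0 <= j < i1)%N then (row la j.+1).-1
            else if j == i1 then (v + i1.+1 - N)%N else row la j.
have m1 : m i1 = (v + i1.+1 - N)%N by rewrite /m ltnn andbF eqxx.
have mout k : (k < i0)%N || (i1 < k)%N -> m k = row la k.
  move=> h; rewrite /m; case: ifP => [h'|_]; first by move: h h'; lia.
  by case: eqP => // e; move: h le01; rewrite e; lia.
have min k : (i0 <= k < i1)%N -> (m k).+1 = row la k.+1.
  move=> h; rewrite /m h prednK //; apply: leq_trans row1 _.
  by apply: row_mono; case/andP: h.
have [||||nu [A rim dnu]] := @remove_ribbon c la N i0 i1 m _ szN mout min.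
- by rewrite le01.
- by rewrite m1; move: v1; rewrite /bead; lia.
- rewrite m1; have [h|h] := ltnP i1.+1 N; first by have := above h; rewrite /bead; lia.
  by rewrite /row nth_default // (leq_trans szN).
- have := @sum_shifted N i0 i1 (bead N la) (fun k => m k + (N - k.+1))%N id.
  rewrite le01 lt1 => /(_ isT) H.
  have /H{H} H : forall k, (k < i0)%N || (i1 < k)%N -> (m k + (N - k.+1))%N = bead N la k.
    by move=> k h; rewrite mout.
  have /H{H} : forall k, (i0 <= k < i1)%N -> (m k + (N - k.+1))%N = bead N la k.+1.
    by move=> k h; rewrite /bead -min //; lia.
  rewrite /= !big_split /= m1.
  move: (\sum_(0 <= k < N) row la k)%N (\sum_(0 <= k < N) m k)%N
    (\sum_(0 <= k < N) (N - k.+1))%N => a b s.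
  by move: vN cle; rewrite /v; lia.
- by exists A; exact: rim.
Qed.

Lemma mem_beads N la x : (size (parts la) <= N)%N ->
  reflect (exists2 k, (k < N)%N & bead N la k = x) (x \in beads (pad N la)).
Proof.
move=> szN; have sz : size (beads (pad N la)) = N by rewrite size_beads size_pad.
have nthE k : (k < N)%N -> nth 0%N (beads (pad N la)) k = bead N la k.
  by move=> h; rewrite nth_beads ?size_pad // nth_pad.
apply: (iffP (nthP 0%N)); rewrite sz => -[k h e]; exists k => //.
  by rewrite -nthE.
by rewrite nthE.
Qed.

Lemma beads_sorted s : sorted geq s -> sorted gtn (beads s).
Proof.
elim: s => //= x s IHs ss; have := IHs (path_sorted ss).
case: s ss {IHs} => //= y s /andP[xy _] ->; rewrite andbT /gtn /=.
by move: xy; rewrite /geq /=; lia.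
Qed.

Lemma gtn_trans : transitive gtn.
Proof. by move=> a b d h1 h2; exact: ltn_trans h2 h1. Qed.

Lemma beads_uniq s : sorted geq s -> uniq (beads s).
Proof.
by move=> ss; apply: sorted_uniq gtn_trans _ _ (beads_sorted ss) => x; rewrite /gtn /= ltnn.
Qed.

(** On each runner the beads fill an initial segment, whose length is the residue count. *)
Lemma flush_mem N la x : (size (parts la) <= N)%N -> flush N la ->
  (x \in beads (pad N la)) = (x %/ c < residue_count c N la (x %% c))%N.
Proof.
move=> szN fl; set B := beads (pad N la); set i := (x %% c)%N; set Q := (x %/ c)%N.
have lti : (i < c)%N by rewrite ltn_mod.
have xE : x = (Q * c + i)%N by exact: divn_eq.
have down j k : ((j + k) * c + i)%N \in B -> (j * c + i)%N \in B.
  elim: k => [|k IHk]; first by rewrite addn0.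
  move=> /(mem_beads _ szN)[p ltp ep]; apply: IHk; apply/(mem_beads _ szN).
  have [|p' ltp' ep'] := fl p ltp; first by rewrite ep addnS mulSn; lia.
  by exists p'; rewrite // ep' ep addnS mulSn; lia.
have uB : uniq (filter (fun p => p %% c == i)%N B).
  by rewrite filter_uniq // beads_uniq // pad_sorted.
have uL q : uniq [seq (j * c + i)%N | j <- iota 0 q].
  rewrite map_inj_uniq ?iota_uniq // => j j' /addIn /eqP.
  by rewrite eqn_mul2r => /orP[/eqP e|/eqP //]; move: c_gt0; rewrite e.
rewrite /residue_count -/B -size_filter; apply/idP/idP => [xB|].
  have <- : size [seq (j * c + i)%N | j <- iota 0 Q.+1] = Q.+1 by rewrite size_map size_iota.
  apply: uniq_leq_size => // y /mapP[j]; rewrite mem_iota add0n ltnS => /= jQ ->.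
  rewrite mem_filter modnMDl modn_small // eqxx /=.
  by apply: (down j (Q - j)%N); rewrite subnKC // -xE.
apply: contraLR => xB; rewrite -leqNgt.
have <- : size [seq (j * c + i)%N | j <- iota 0 Q] = Q by rewrite size_map size_iota.
apply: uniq_leq_size => // y; rewrite mem_filter => /andP[/eqP yi yB].
have yE : y = (y %/ c * c + i)%N by rewrite {1}(divn_eq y c) yi.
apply/mapP; exists (y %/ c)%N; rewrite // mem_iota add0n /= ltnNge.
apply/negP => h; case/negP: xB; rewrite xE; apply: (down Q (y %/ c - Q)%N).
by rewrite subnKC // -yE.
Qed.

Lemma beads_inj s s' : beads s = beads s' -> s = s'.
Proof.
elim: s s' => [|x s IHs] [|y s'] //= [e /IHs ss]; subst s'.
by move/addIn: e => ->.
Qed.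

Lemma core_unique la mu N : is_core c la -> is_core c mu ->
  (size (parts la) <= N)%N -> (size (parts mu) <= N)%N ->
  (forall i, (i < c)%N -> residue_count c N la i = residue_count c N mu i) ->
  la = mu.
Proof.
move=> cla cmu szla szmu res; rewrite -(part_of_pad N la) -(part_of_pad N mu).
congr part_of; apply: beads_inj.
apply: (irr_sorted_eq gtn_trans); rewrite ?beads_sorted ?pad_sorted //.
  by move=> x; rewrite /gtn /= ltnn.
move=> x; rewrite !flush_mem //; try exact: core_flush.
by rewrite res // ltn_mod.
Qed.

(** Residue counts are invariant under removal, and they determine a core. For the converse,
    rimhooks are removed by induction on the size until a core with the counts of [mu] is left. *)
Theorem has_coreP la mu N : is_core c mu ->
  (size (parts la) <= N)%N -> (size (parts mu) <= N)%N ->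
  Par c mu la <->
  forall i, (i < c)%N -> residue_count c N la i = residue_count c N mu i.
Proof.
move=> cmu szla szmu; split=> [[rel _]|].
  have H : (size (parts la) <= N)%N -> (size (parts mu) <= N)%N /\
    forall i, residue_count c N la i = residue_count c N mu i.
    elim: rel {cmu szmu szla} => {la mu} [la nu rm sz|//|la nu mu _ IH1 _ IH2 sz].
      have res i := remove_rimhook_residue c_gt0 i rm sz.
      by split=> [|i]; [case: (res 0%N) | case: (res i)].
    have [sz' e1] := IH1 sz; have [sz'' e2] := IH2 sz'.
    by split=> // i; rewrite e1.
  by move=> i _; case: (H szla).
move: {2}(psize la).+1 (ltnSn (psize la)) => n; elim: n la szla => // n IHn la szla.
rewrite ltnS => szn res; have [cla|] := EM (is_core c la).
  by rewrite (core_unique cla cmu szla szmu res); split=> //; apply: rt_refl.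
move/contrapT => [A rim]; have [_ _ _ _ [nu dnu]] := rim.
have rm : remove_rimhook c la nu by exists A.
have [sznu _] := remove_rimhook_residue c_gt0 0 rm szla.
have [_ szE _] := remove_rimhook_rows c_gt0 rm.
have [||r _] := IHn nu sznu; first by move: szE szn c_gt0; lia.
  by move=> i hi; have [_ ->] := remove_rimhook_residue c_gt0 i rm szla; exact: res.
by split=> //; apply: rt_trans r; apply: rt_step.
Qed.

End Cores.

(** * Equidistribution at a rational slope *)

Definition core_set (c : nat) (mu : intpart) (n : nat) : {fset intpart} :=
  [fset la in [seq wpart w | w <- words (n + n)] |
     (psize la == n) && `[< Par c mu la >]]%fset.

Lemma mem_core_set c mu n la : reflect (psize la = n /\ Par c mu la) (la \in core_set c mu n).
Proof.
apply: (iffP idP); rewrite !inE /=.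
  by case/and3P => _ /eqP -> /asboolP.
case=> sz hp; rewrite sz eqxx (introT (asboolP _) hp) !andbT; apply/mapP.
have [||w hw [_ _ e]] := @wpart_surj la n n; first by rewrite -sz size_parts_le.
  by move=> x /parts_le; rewrite sz.
by exists w.
Qed.

Section Statistics.
Variables (c : nat) (mu : intpart).
Hypotheses (c_gt0 : (0 < c)%N) (mu_core : is_core c mu).

Definition core_stat (n : nat) (P : nat -> nat -> bool) : {poly int} :=
  \sum_(la <- core_set c mu n) tq ^+ boxstat P (parts la).

Lemma core_stat_words n N M P : (n <= N)%N -> (n <= M)%N -> (size (parts mu) <= N)%N ->
  core_stat n P =
  \sum_(w <- words (N + M) | core_word c M n (residue_count c N mu) w) tq ^+ boxsum P w.
Proof.
move=> nN nM muN; rewrite /core_stat.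
have perm := @perm_wpart c n N M (residue_count c N mu) (core_set c mu n) nN nM.
rewrite -(perm_big _ (perm _)) => [|la]; last first.
  split=> [/mem_core_set[sz hp]|[sz res]].
    split=> //; apply/(has_coreP c_gt0 mu_core _ muN) => //.
    by apply: leq_trans (size_parts_le la) _; rewrite sz.
  apply/mem_core_set; split=> //; apply/(has_coreP c_gt0 mu_core _ muN) => //.
  by apply: leq_trans (size_parts_le la) _; rewrite sz.
rewrite big_map big_filter; apply: eq_bigr => w _.
by rewrite boxstat_wpart.
Qed.

Lemma core_stat_plus_minus n r s : (0 < r)%N -> (0 < s)%N ->
  core_stat n (plus_box c r s) = core_stat n (minus_box c r s).
Proof.
move=> r0 s0; pose k := (n + size (parts mu))%N.
have le m x : (0 < m)%N -> (x <= k)%N -> (x <= c * k * m)%N.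
  move=> m0 xk; apply: leq_trans (leq_pmulr _ m0).
  by apply: leq_trans xk (leq_pmull _ c_gt0).
rewrite !(@core_stat_words n (c * k * s)%N (c * k * r)%N) ?le ?leq_addr ?leq_addl //.
move: le; rewrite -(prednK c_gt0) => _.
exact: boxsum_equidistributed_core.
Qed.

End Statistics.

(** * Slope zero *)

Lemma count_consecutive c a i : (i < c)%N ->
  (\sum_(0 <= j < c) ((a + j) %% c == i) = 1)%N.
Proof.
move=> hi; elim: a => [|a IHa].
  rewrite -[RHS](sum_nat_pred1 hi) big_nat_cond [RHS]big_nat_cond.
  by apply: eq_bigr => j /andP[/andP[_ lt] _]; rewrite add0n modn_small.
under eq_bigr do rewrite addSnnS.
have : (\sum_(0 <= j < c.+1) ((a + j) %% c == i) =
  \sum_(0 <= j < c) ((a + j) %% c == i) + ((a + c) %% c == i))%N by rewrite big_nat_recr.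
by rewrite big_nat_recl //= IHa addn0 modnDr [RHS]addnC => /addnI.
Qed.

Lemma count_beads_insert c k s1 s2 i : (i < c)%N ->
  count (fun p => p %% c == i)%N (beads (s1 ++ nseq c k ++ s2)) =
  (count (fun p => p %% c == i)%N (beads (s1 ++ s2))).+1.
Proof.
move=> hi; elim: s1 => [|x s1 IHs] /=.
  have -> m : count (fun p => p %% c == i)%N (beads (nseq m k ++ s2)) =
    (\sum_(0 <= j < m) (((k + size s2) + j) %% c == i) +
     count (fun p => p %% c == i)%N (beads s2))%N.
    elim: m => [|m IHm]; first by rewrite big_geq.
    rewrite big_nat_recr //= IHm size_cat size_nseq [(m + _)%N]addnC !addnA.
    by congr (_ + _)%N; apply: addnC.
  by rewrite count_consecutive.
rewrite IHs !size_cat size_nseq addnS; congr (nat_of_bool (_ == _) + _).+1.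
by rewrite (addnCA (size s1)) (addnCA x) modnDl.
Qed.

Definition insert_copies (c k : nat) (s : seq nat) : seq nat :=
  filter (leq k) s ++ nseq c k ++ filter (gtn k) s.

Lemma sorted_filter_split k s : sorted geq s ->
  filter (leq k) s ++ filter (gtn k) s = s.
Proof.
elim: s => //= x s IHs ss; rewrite /gtn /= ltnNge; case: leqP => /= h.
  by rewrite IHs // (path_sorted ss).
have lt : all (gtn k) s.
  apply/allP => y ys; apply: leq_ltn_trans h.
  by have /allP/(_ y ys) := order_path_min geq_trans ss.
have -> : filter (leq k) s = [::].
  by rewrite -(filter_pred0 s); apply: eq_in_filter => y /(allP lt); rewrite /gtn /= ltnNge => /negPf.
by rewrite (all_filterP lt).
Qed.

Lemma insert_copies_sorted c k s : sorted geq s -> sorted geq (insert_copies c k s).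
Proof.
move=> ss; rewrite (sorted_pairwise geq_trans).
have pf p : pairwise geq (filter p s).
  by rewrite -(sorted_pairwise geq_trans) (sorted_filter geq_trans).
have pn : pairwise geq (nseq c k).
  by elim: c => //= m ->; rewrite andbT all_nseq /geq /= leqnn orbT.
rewrite /insert_copies !pairwise_cat !pf pn !andbT /= allrel_catr.
rewrite -andbA; apply/and3P; split; apply/allrelP => x y.
- by rewrite mem_filter => /andP[h _] /nseqP[->].
- rewrite !mem_filter => /andP[h _] /andP[h' _]; exact: ltnW (leq_trans h' h).
- by move=> /nseqP[-> _]; rewrite mem_filter => /andP[h _]; exact: ltnW.
Qed.

Lemma count_insert_pred (p : pred nat) c k s :
  count p (insert_copies c k s) = (count p s + p k * c)%N.
Proof.
rewrite /insert_copies !count_cat count_nseq addnCA addnC; congr (_ + _)%N.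
rewrite -count_cat; apply/permP.
rewrite (eq_filter (a1 := gtn k) (a2 := predC (leq k))); last by move=> x; rewrite /= /gtn /= ltnNge.
by rewrite perm_filterC.
Qed.

Lemma count_insert_copies c k s x :
  count_mem x (insert_copies c k s) = (count_mem x s + c * (x == k))%N.
Proof.
by rewrite count_insert_pred /= [k == x]eq_sym mulnC.
Qed.

Lemma size_insert_copies c k s : size (insert_copies c k s) = (size s + c)%N.
Proof. by rewrite -!count_predT count_insert_pred mul1n. Qed.

Lemma sorted_geq_eq s s' : sorted geq s -> sorted geq s' ->
  (forall x, count_mem x s = count_mem x s') -> s = s'.
Proof.
move=> ss ss' e; apply: (sorted_eq geq_trans) ss ss' _.
  by move=> x y; rewrite /geq /= => /andP[h1 h2]; apply/eqP; rewrite eqn_leq h1 h2.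
by apply/allP => x _; rewrite /= e.
Qed.

Definition add_copies (c k : nat) (la : intpart) : intpart :=
  part_of (insert_copies c k (parts la)).

Lemma parts_add_copies c k la : (0 < k)%N ->
  parts (add_copies c k la) = insert_copies c k (parts la).
Proof.
move=> k0; rewrite part_ofE ?insert_copies_sorted ?parts_sorted //.
apply/all_filterP/allP => x; rewrite -has_pred1 has_count count_insert_copies lt0n.
have := parts_gt0 la; rewrite -has_pred1 has_count -leqNgt leqn0 => /eqP h0.
by case: x => //; rewrite h0; case: k k0 => // k _; rewrite muln0.
Qed.

Lemma psize_add_copies c k la : (0 < k)%N ->
  psize (add_copies c k la) = (psize la + c * k)%N.
Proof.
move=> k0; rewrite /psize parts_add_copies // /insert_copies !sumn_cat sumn_nseq.
rewrite -[in RHS](sorted_filter_split k (parts_sorted la)) sumn_cat mulnC; lia.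
Qed.

Lemma residue_count_add_copies c k la N i : (0 < k)%N -> (i < c)%N ->
  (size (parts la) <= N)%N ->
  residue_count c (N + c) (add_copies c k la) i = (residue_count c N la i).+1.
Proof.
move=> k0 hi szN; rewrite /residue_count /pad parts_add_copies //.
have szE : size (insert_copies c k (parts la)) = (size (parts la) + c)%N.
  exact: size_insert_copies.
rewrite szE subnDr /insert_copies -!catA count_beads_insert // catA.
by rewrite sorted_filter_split ?parts_sorted.
Qed.

Lemma residue_count_addn c la N i : (i < c)%N -> (size (parts la) <= N)%N ->
  residue_count c (N + c) la i = (residue_count c N la i).+1.
Proof.
move=> hi szN; rewrite /residue_count /pad -addnBAC // addnC nseqD.
by rewrite count_beads_insert.
Qed.

Lemma Par_add_copies c k mu la : (0 < c)%N -> (0 < k)%N -> is_core c mu ->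
  Par c mu (add_copies c k la) <-> Par c mu la.
Proof.
move=> c0 k0 core; pose N := (size (parts la) + size (parts mu))%N.
have sz1 : (size (parts la) <= N)%N by rewrite leq_addr.
have sz2 : (size (parts mu) <= N)%N by rewrite leq_addl.
rewrite (has_coreP c0 core sz1 sz2).
rewrite (@has_coreP c c0 _ mu (N + c)) //; first last.
- by rewrite (leq_trans sz2) ?leq_addr.
- by rewrite parts_add_copies // size_insert_copies leq_add2r.
split=> H i hi.
  by have := H i hi; rewrite residue_count_add_copies // residue_count_addn // => -[].
by rewrite residue_count_add_copies // residue_count_addn // H.
Qed.

Section SlopeZero.
Variables (c : nat) (mu : intpart).
Hypotheses (c_gt0 : (0 < c)%N) (mu_core : is_core c mu).

Let P0 := plus_box c 0 1.

Lemma boxstat0_cons x s :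
  boxstat P0 (x :: s) = ((0 < x) && (c %| (count (leq x) s).+1) + boxstat P0 s)%N.
Proof.
rewrite /=; congr (_ + _)%N; case: x => [|x]; first by rewrite big_geq.
rewrite big_nat_recr //= subSS subnn big_nat_cond big1 ?add0n.
  by rewrite /P0 /plus_box mul1n mul0n add0n !andbT.
move=> j /andP[/andP[_ lt] _]; rewrite /P0 /plus_box mul0n mul1n leqn0 subn_eq0.
by rewrite leqNgt ltnS lt andbF.
Qed.

Lemma boxstat0_insert k s : (0 < k)%N -> sorted geq s ->
  boxstat P0 (insert_copies c k s) = (boxstat P0 s).+1.
Proof.
move=> k0 ss; rewrite -[in RHS](sorted_filter_split k ss) /insert_copies.
have : all (leq k) (filter (leq k) s) by apply: filter_all.
have : all (gtn k) (filter (gtn k) s) by apply: filter_all.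
move: (filter (gtn k) s) (filter (leq k) s) => s2 s1 lt2.
elim: s1 => [_|x s1 IHs /andP[kx /IHs e]].
  have run m : (m <= c)%N -> boxstat P0 (nseq m k ++ s2) = ((m == c) + boxstat P0 s2)%N.
    elim: m => [|m IHm] hm; first by rewrite eq_sym (gtn_eqF c_gt0).
    rewrite [nseq _ _ ++ _]/= boxstat0_cons (IHm (ltnW hm)) (ltn_eqF hm) add0n k0 /=.
    congr (nat_of_bool _ + _)%N.
    rewrite count_cat count_nseq leqnn mul1n (_ : count _ s2 = 0%N) ?addn0; last first.
      by apply/eqP; rewrite -leqn0 leqNgt -has_count; apply/hasPn => y /(allP lt2) /=; rewrite -ltnNge.
    apply/idP/eqP => [d|<-]; last exact: dvdnn.
    by apply/eqP; rewrite eqn_leq hm dvdn_leq.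
  by rewrite run // eqxx.
rewrite !cat_cons !boxstat0_cons e addnS; congr (nat_of_bool (_ && _) + _).+1.
by rewrite !count_cat count_nseq addnCA -addnS dvdn_addr ?dvdn_mull.
Qed.

Lemma boxstat0_regular s : sorted geq s ->
  (forall x, (0 < x)%N -> (count_mem x s < c)%N) -> boxstat P0 s = 0%N.
Proof.
elim: s => [//|x s IHs] ss reg; rewrite boxstat0_cons IHs ?(path_sorted ss) //; last first.
  by move=> y y0; apply: leq_ltn_trans (reg y y0); rewrite /= leq_addl.
case: x ss reg => // x ss reg; rewrite addn0 /=.
have -> : count (leq x.+1) s = count_mem x.+1 s.
  apply: eq_in_count => y ys; have /allP/(_ y ys) := order_path_min geq_trans ss.
  by rewrite /geq /= eqn_leq => ->.
case: (boolP (_ %| _)%N) => // /dvdn_leq -/(_ isT).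
by have := reg x.+1 isT; rewrite /= eqxx add1n ltnNge => /negPf ->.
Qed.

Lemma add_copies_surj k la : (0 < k)%N -> (c <= count_mem k (parts la))%N ->
  exists la', la = add_copies c k la'.
Proof.
move=> k0 ck; set s := parts la.
pose s' := filter (predC1 k) s ++ nseq (count_mem k s - c) k.
exists (part_of s'); apply: parts_inj; rewrite parts_add_copies //.
apply: sorted_geq_eq; rewrite ?insert_copies_sorted ?parts_sorted // => x.
rewrite count_insert_copies /= (permP (permEl (perm_sort _ _))) count_filter.
case: x => [|x].
  rewrite [in RHS](eq_count (a2 := pred0)); last by move=> [|y].
  rewrite count_pred0 eq_sym (gtn_eqF k0) muln0; apply/count_memPn.
  exact: parts_gt0.
rewrite [in RHS](eq_count (a2 := pred1 x.+1)); last by move=> [|y] //=; rewrite andbT.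
rewrite count_cat count_nseq count_filter; have [e|ne] := eqVneq x.+1 k.
  subst k; rewrite [in RHS](eq_count (a2 := pred0)) => [|y /=]; last by case: eqP.
  by rewrite count_pred0 /= eqxx muln1 mul1n add0n subnK.
rewrite muln0 addn0 /= [k == _]eq_sym (negPf ne) addn0; apply: eq_count => y /=.
by case: eqP => // ->; rewrite ne.
Qed.

Lemma add_copies_inj k : (0 < k)%N -> injective (add_copies c k).
Proof.
move=> k0 la la' /(congr1 parts); rewrite !parts_add_copies // => e.
apply: parts_inj; apply: sorted_geq_eq; rewrite ?parts_sorted // => x.
by have := congr1 (count_mem x) e; rewrite !count_insert_copies => /addIn.
Qed.

Definition regular_upto (j : nat) (la : intpart) : bool :=
  all (fun i => count_mem i.+1 (parts la) < c)%N (iota 0 j).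

Lemma regular_uptoS j la :
  regular_upto j.+1 la = regular_upto j la && (count_mem j.+1 (parts la) < c)%N.
Proof.
rewrite /regular_upto (_ : iota 0 j.+1 = iota 0 j ++ [:: j]); last by rewrite -addn1 iotaD.
by rewrite all_cat /= andbT.
Qed.

Definition wsum (z : {poly int}) (j n : nat) : {poly int} :=
  \sum_(la <- core_set c mu n | regular_upto j la) z ^+ boxstat P0 (parts la).

Lemma wsumS z j n : wsum z j.+1 n =
  wsum z j n - (if (c * j.+1 <= n)%N then z * wsum z j (n - c * j.+1) else 0).
Proof.
apply/eqP; rewrite eq_sym subr_eq; apply/eqP.
rewrite /wsum (bigID (fun la => count_mem j.+1 (parts la) < c)%N) /=; congr (_ + _).
  by apply: eq_bigl => la; rewrite regular_uptoS.
case: ifP => [le|/negbT gt]; last first.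
  rewrite big1_seq // => la /andP[/andP[_]]; rewrite -leqNgt => ck /mem_core_set[sz _].
  have [//|la' e] := add_copies_surj _ ck.
  by move: gt; rewrite -sz e psize_add_copies // leq_addl.
have perm : perm_eq [seq la <- core_set c mu n | regular_upto j la & ~~ (count_mem j.+1 (parts la) < c)%N]
    [seq add_copies c j.+1 la | la <- core_set c mu (n - c * j.+1) & regular_upto j la].
  have regE la : regular_upto j (add_copies c j.+1 la) = regular_upto j la.
    apply: eq_in_all => i; rewrite mem_iota add0n => /andP[_ lt].
    by rewrite parts_add_copies // count_insert_copies eqSS (ltn_eqF lt) muln0 addn0.
  apply: uniq_perm; rewrite ?filter_uniq ?(map_inj_uniq (add_copies_inj _)) ?filter_uniq ?fset_uniq //.
  move=> la; rewrite mem_filter; apply/andP/mapP.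
    case=> /andP[rg]; rewrite -leqNgt => ck /mem_core_set[sz hp].
    have [//|la' e] := add_copies_surj _ ck; exists la' => //.
    rewrite mem_filter -regE -e rg; apply/mem_core_set.
    by rewrite -sz e psize_add_copies // addnK; split=> //; apply/(@Par_add_copies c j.+1); rewrite -?e.
  move=> [la' ]; rewrite mem_filter => /andP[rg /mem_core_set[sz hp]] ->; split.
    by rewrite regE rg -leqNgt parts_add_copies // count_insert_copies eqxx muln1 leq_addl.
  apply/mem_core_set; rewrite psize_add_copies // sz subnK //; split=> //.
  by apply/Par_add_copies.
rewrite -big_filter (perm_big _ perm) big_map big_filter mulr_sumr.
by apply: eq_bigr => la _; rewrite parts_add_copies // boxstat0_insert ?parts_sorted // exprS.
Qed.

Lemma coef_qXnM (R : comNzRingType) m (f : fps R) n :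
  fps_coef (fps_X ^+ m * f) n = if (m <= n)%N then fps_coef f (n - m) else 0.
Proof.
elim: m f n => [|m IHm] f n; first by rewrite expr0 mul1r subn0.
rewrite exprSr -mulrA IHm; case: ltnP => [lt|le].
  rewrite (ltnW lt) fps_coefM; have -> : (n - m)%N = (n - m.+1).+1 by rewrite subnSK.
  rewrite !big_ord_recl /= mul0r add0r mul1r big1 ?addr0 ?subSS ?subn0 // => i _.
  by rewrite mul0r.
case: leqP => // le'; have -> : n = m by apply/eqP; rewrite eqn_leq le.
by rewrite subnn fps_coefM big_ord1 /= mul0r.
Qed.

Lemma wsum_fps z M :
  FPS (wsum z 0) * \prod_(1 <= j < M.+1) (1 - q ^+ (j * c) * fps_C z) = FPS (wsum z M).
Proof.
elim: M => [|M IHM]; first by rewrite big_geq // mulr1.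
rewrite big_nat_recr //= mulrA IHM mulrBr mulr1; apply: fpsP => n.
rewrite fps_coefD fps_coefN [_ * (_ * _)]mulrC -mulrA coef_qXnM fps_coefCM /= wsumS mulnC.
by case: ifP.
Qed.

Lemma wsum_regular z n M : (n <= M)%N -> wsum z M n = wsum 1 M n.
Proof.
move=> nM; rewrite /wsum big_seq_cond [RHS]big_seq_cond; apply: eq_bigr => la.
case/andP => /mem_core_set[sz _] /allP reg.
rewrite boxstat0_regular ?parts_sorted // => -[|x] // _.
have [lt|le] := ltnP x M; first by apply: reg; rewrite mem_iota.
rewrite (_ : count_mem _ _ = 0%N) //; apply/count_memPn; apply/negP => /parts_le.
by rewrite sz leqNgt ltnS (leq_trans nM).
Qed.

End SlopeZero.

(** * Counting partitions with a given core *)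

Section Truncation.
Variable R : comNzRingType.
Implicit Types (f g : fps R) (n : nat).

Definition eq_upto n f g := forall m, (m <= n)%N -> fps_coef f m = fps_coef g m.

Lemma eq_upto_refl n f : eq_upto n f f. Proof. by []. Qed.
Lemma eq_upto_sym n f g : eq_upto n f g -> eq_upto n g f.
Proof. by move=> e m h; rewrite e. Qed.
Lemma eq_upto_trans n f g h : eq_upto n f g -> eq_upto n g h -> eq_upto n f h.
Proof. by move=> e e' m hm; rewrite e ?e'. Qed.

Lemma eq_uptoM n f f' g g' : eq_upto n f f' -> eq_upto n g g' ->
  eq_upto n (f * g) (f' * g').
Proof.
move=> ef eg m hm; rewrite !fps_coefM; apply: eq_bigr => i _.
by rewrite ef ?eg // (leq_trans _ hm) // ?leq_subr // -ltnS.
Qed.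

Lemma eq_upto_prod n (I : Type) (r : seq I) (P : pred I) (F G : I -> fps R) :
  (forall i, P i -> eq_upto n (F i) (G i)) ->
  eq_upto n (\prod_(i <- r | P i) F i) (\prod_(i <- r | P i) G i).
Proof.
move=> FG; apply: (big_ind2 (eq_upto n)) => // f f' g g'; exact: eq_uptoM.
Qed.

Lemma eq_upto_prod1 n (I : Type) (r : seq I) (P : pred I) (F : I -> fps R) :
  (forall i, P i -> eq_upto n (F i) 1) -> eq_upto n (\prod_(i <- r | P i) F i) 1.
Proof.
move=> F1; apply: (big_ind (fun f => eq_upto n f 1)) => // f g ef eg.
by rewrite -[1 in X in eq_upto _ _ X]mulr1; apply: eq_uptoM.
Qed.

Lemma eq_upto_one_sub n k f : (n < k)%N -> eq_upto n (1 - fps_X ^+ k * f) 1.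
Proof.
move=> nk m hm; rewrite fps_coefD fps_coefN coef_qXnM.
by rewrite leqNgt (leq_ltn_trans hm nk) subr0.
Qed.

Lemma eq_upto_one_subX n k : (n < k)%N -> eq_upto n (1 - fps_X ^+ k) 1.
Proof. by rewrite -[fps_X ^+ k]mulr1; apply: eq_upto_one_sub. Qed.

Lemma eq_upto_exp n k f g : eq_upto n f g -> eq_upto n (f ^+ k) (g ^+ k).
Proof. by move=> e; elim: k => // k IHk; rewrite !exprS; apply: eq_uptoM. Qed.

Lemma eq_upto_mulXn n k f g :
  eq_upto n f g <-> eq_upto (k + n) (fps_X ^+ k * f) (fps_X ^+ k * g).
Proof.
split=> e m hm; last first.
  by have := e (k + m)%N; rewrite !coef_qXnM leq_addr addKn leq_add2l => /(_ hm).
by rewrite !coef_qXnM; case: leqP => // h; apply: e; rewrite leq_subLR.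
Qed.

End Truncation.

Section Abacus.
Variables (R : comNzRingType) (x : R) (c : nat).
Hypothesis c_gt0 : (0 < c)%N.

(* [runner i p k m] enumerates the sets of [m] beads on the positions in
   [p, p + k) congruent to [i], each weighted by the sum of its positions. *)
Fixpoint runner (i p k m : nat) : R :=
  if k is k'.+1 then
    if (p %% c == i)%N then
      runner i p.+1 k' m + (if m is m'.+1 then x ^+ p * runner i p.+1 k' m' else 0)
    else runner i p.+1 k' m
  else (m == 0%N)%:R.

Definition residues_are (f : nat -> nat) (s : seq nat) : bool :=
  [forall i : 'I_c, count (fun p => p %% c == i)%N s == f i].

Lemma abacus_sum p k (f : nat -> nat) :
  \sum_(w <- words k | residues_are f (fpos p w)) x ^+ sumn (fpos p w) =
  \prod_(i < c) runner i p k (f i).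
Proof.
elim: k p f => [|k IHk] p f /=.
  rewrite big_cons big_nil /residues_are /= addr0.
  case: ifP => [/forallP H|/negbT].
    by rewrite big1 // => i _; rewrite -(eqP (H i)).
  rewrite negb_forall => /existsP[i]; rewrite eq_sym => /negPf ne.
  by rewrite (bigD1 i) //= ne mul0r.
pose i0 := Ordinal (ltn_pmod p c_gt0).
rewrite big_cat !big_map /= IHk.
rewrite [RHS](bigD1 i0) //= eqxx mulrDl [X in X + _ = _](bigD1 i0) //=.
have other g : \prod_(i < c | i != i0) (if (p %% c == i)%N then
      runner i p.+1 k (f i) + g i else runner i p.+1 k (f i)) =
    \prod_(i < c | i != i0) runner i p.+1 k (f i).
  by apply: eq_bigr => i; rewrite -val_eqE eq_sym /= => /negPf ->.
rewrite other; congr (_ + _).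
pose f' i := (f i - (i == p %% c)%N)%N.
have split w : residues_are f (p :: fpos p.+1 w) =
    (0 < f (p %% c)%N)%N && residues_are f' (fpos p.+1 w).
  apply/forallP/andP => [H|[f0 /forallP H] i].
    have := H i0; rewrite /= eqxx => /eqP e; split; first by rewrite -e.
    apply/forallP => i; rewrite /f' -(eqP (H i)) /= [i == _ :> nat]eq_sym.
    by rewrite addKn.
  rewrite /= (eqP (H i)) /f'; case: (eqVneq (i : nat) (p %% c)%N) => [e|ne] /=.
    by rewrite e add1n subn1 prednK.
  by rewrite add0n subn0.
rewrite (eq_bigl _ _ split).
case f0 : (f (p %% c)%N) => [|m] /=; first by rewrite big_pred0 ?mul0r // => w.
rewrite (eq_bigr (fun w => x ^+ p * x ^+ sumn (fpos p.+1 w))); last by move=> w _; rewrite exprD.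
rewrite -mulr_sumr IHk (bigD1 i0) //= mulrA {1}/f' eqxx f0 subn1 /=; congr (_ * _).
by apply: eq_bigr => i; rewrite -val_eqE /f' /= => /negPf ->; rewrite subn0.
Qed.

Lemma runner_skip i p k m j : (forall l, (l < j)%N -> (p + l) %% c != i)%N ->
  runner i p (j + k) m = runner i (p + j) k m.
Proof.
elim: j p => [|j IHj] p H; first by rewrite addn0.
rewrite addSn /= -[p in X in if X then _ else _]addn0 (negPf (H 0%N _)) // IHj ?addSnnS //.
by move=> l lt; rewrite addSnnS; apply: H.
Qed.

Lemma runner_block i b k m : (i < c)%N ->
  runner i (c * b) (c + k) m = runner i (c * b.+1) k m +
    (if m is m'.+1 then x ^+ (c * b + i) * runner i (c * b.+1) k m' else 0).
Proof.
move=> hi; have -> : (c + k = i + (c - i.+1 + k).+1)%N by lia.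
have modE l : (l < c)%N -> ((c * b + l) %% c = l)%N by move=> h; rewrite mulnC modnMDl modn_small.
rewrite runner_skip => [|l lt]; last by rewrite modE ?(ltn_trans lt hi) // ltn_eqF.
rewrite /= modE // eqxx.
have skip m' : runner i (c * b + i).+1 (c - i.+1 + k) m' = runner i (c * b.+1) k m'.
  rewrite runner_skip => [|l lt]; first by congr (runner _ _ _ _); rewrite mulnS; lia.
  by rewrite addSnnS -addnA modE; [rewrite gtn_eqF|]; lia.
by case: m => [|m]; rewrite !skip.
Qed.

Lemma runner_product i b Q m : (i < c)%N ->
  runner i (c * b) (c * Q) m * \prod_(j < m) (1 - x ^+ (c * j.+1)) =
  x ^+ ((c * b + i) * m + c * 'C(m, 2)) * \prod_(j < m) (1 - x ^+ (c * (Q - j))).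
Proof.
move=> hi; elim: Q b m => [|Q IHQ] b m.
  rewrite muln0 /=; case: m => [|m]; first by rewrite !big_ord0 !muln0 expr0 !mulr1.
  by rewrite mul0r [in RHS]big_ord_recl /= expr0 subrr mul0r mulr0.
rewrite mulnS runner_block //; case: m => [|m].
  by rewrite addr0 IHQ !big_ord0 !muln0.
rewrite mulrDl IHQ; set P := x ^+ (c * b + i) * runner i (c * b.+1) (c * Q) m.
have -> : P * \prod_(j < m.+1) (1 - x ^+ (c * j.+1)) = x ^+ (c * b + i) *
    (x ^+ ((c * b.+1 + i) * m + c * 'C(m, 2)) * \prod_(j < m) (1 - x ^+ (c * (Q - j))))
    * (1 - x ^+ (c * m.+1)).
  by rewrite -IHQ big_ord_recr /= !mulrA.
rewrite big_ord_recr /= [in RHS]big_ord_recl /= subn0.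
under [X in _ = _ * (_ * X)]eq_bigr do rewrite /bump /= add1n subSS.
set Pi := \prod_(j < m) _.
have [mQ|Qm] := leqP m Q; last first.
  have -> : Pi = 0 by rewrite /Pi (bigD1 (Ordinal Qm)) //= subnn muln0 expr0 subrr mul0r.
  by rewrite !(mul0r, mulr0) addr0.
rewrite binS bin1; set B := 'C(m, 2).
have -> : ((c * b.+1 + i) * m.+1 + c * (B + m) =
  ((c * b + i) * m.+1 + c * (B + m)) + c * m.+1)%N by rewrite mulnS; lia.
have -> : ((c * b + i) * m.+1 + c * (B + m) =
  (c * b + i) + ((c * b.+1 + i) * m + c * B))%N by rewrite mulnS; lia.
have -> : (c * Q.+1 = c * m.+1 + c * (Q - m))%N by rewrite -mulnDr; congr muln; lia.
rewrite !exprD; ring.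
Qed.

End Abacus.

Section CoreCount.
Variables (c : nat) (mu : intpart).
Hypotheses (c_gt0 : (0 < c)%N) (mu_core : is_core c mu).

Lemma Par_psize la : Par c mu la -> la = mu \/ (psize mu < psize la)%N.
Proof.
case=> rel _; elim: rel => {la} [la nu rm|la|la nu ka _ IH1 _ IH2].
- by right; have [_ -> _] := remove_rimhook_rows c_gt0 rm; rewrite -[X in (X < _)%N]addn0 ltn_add2l.
- by left.
- case: IH1 => [->//|h]; case: IH2 => [<-|h']; right=> //; exact: ltn_trans h' h.
Qed.

Lemma Par_core : Par c mu mu. Proof. by split; [apply: rt_refl|]. Qed.

Definition core_gf : fps {poly int} := FPS (fun n => (#|` core_set c mu n|)%:R).

Lemma core_gf_small n : (n < psize mu)%N -> fps_coef core_gf n = 0.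
Proof.
move=> lt; rewrite /= (_ : core_set c mu n = fset0) ?cardfs0 //.
apply/fsetP => la; rewrite in_fset0; apply/negP => /mem_core_set[sz /Par_psize[e|]].
  by move: lt; rewrite -sz e ltnn.
by rewrite sz ltnNge (ltnW lt).
Qed.

Lemma core_gf_psize : fps_coef core_gf (psize mu) = 1.
Proof.
rewrite /= (_ : core_set c mu _ = [fset mu]%fset) ?cardfs1 //.
apply/fsetP => la; rewrite in_fset1; apply/idP/eqP => [/mem_core_set[sz /Par_psize[//|]]|->].
  by rewrite sz ltnn.
by apply/mem_core_set; split=> //; exact: Par_core.
Qed.

Lemma sumn_beads s : sumn (beads s) = (sumn s + 'C(size s, 2))%N.
Proof. by elim: s => //= x s ->; rewrite binS bin1; lia. Qed.

Lemma sumn_fpos w : sumn (fpos 0 w) = (sumn (heights 0 w) + 'C(count_mem false w, 2))%N.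
Proof.
by rewrite -sumn_rev -beads_heights sumn_beads sumn_rev size_rev size_heights.
Qed.

Lemma sum_residues (s : seq nat) :
  (\sum_(i < c) count (fun p => p %% c == i)%N s = size s)%N.
Proof.
elim: s => [|x s IHs] /=; first by rewrite big1.
rewrite big_split /= IHs (bigD1 (Ordinal (ltn_pmod x c_gt0))) //= eqxx big1 // => i.
by rewrite -val_eqE eq_sym /= => /negPf ->.
Qed.

Lemma size_fpos p w : size (fpos p w) = count_mem false w.
Proof. by elim: w p => [|[] w IHw] p //=; rewrite IHw. Qed.

Lemma residue_count_ge n0 i : (i < c)%N ->
  (n0 <= residue_count c (size (parts mu) + n0 * c) mu i)%N.
Proof.
move=> hi; elim: n0 => // n IHn.
by rewrite mulSn [(c + _)%N]addnC addnA residue_count_addn // leq_addr.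
Qed.

Lemma coef_qX (R : comNzRingType) k n : fps_coef (fps_X ^+ k : fps R) n = (n == k)%:R.
Proof.
rewrite -[fps_X ^+ k]mulr1 coef_qXnM fps_coef1 subn_eq0.
by case: (ltngtP k n) => // h; rewrite ?leqNgt ?h // h leqnn.
Qed.

Section Bound.
Variable n0 : nat.
Hypothesis mu_n0 : (psize mu <= n0)%N.
Let N := (size (parts mu) + n0 * c)%N.
Let T := 'C(N, 2).
Let Q := (N + n0 + T).+1.
Let M := (c * Q - N)%N.
Let f := residue_count c N mu.

Let NM : (N + M = c * Q)%N.
Proof. by rewrite /M subnKC // (leq_trans _ (leq_pmull _ c_gt0)) // /Q; lia. Qed.

Let n0N : (n0 <= N)%N.
Proof. by rewrite /N (leq_trans (leq_pmulr n0 c_gt0)) ?leq_addl. Qed.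

Let n0M : (n0 <= M)%N.
Proof. by have := leq_pmull Q c_gt0; rewrite /M /Q; lia. Qed.

Let muN : (size (parts mu) <= N)%N. Proof. exact: leq_addr. Qed.

Lemma residues_are_core_word n w : size w = (N + M)%N ->
  residues_are c f (fpos 0 w) && (sumn (heights 0 w) == n) = core_word c M n f w.
Proof.
move=> sz; rewrite /core_word -/(residues_are c f (fpos 0 w)).
case: (boolP (residues_are _ _ _)) => [/forallP H|_]; last by rewrite !andbF.
rewrite andbT /=; suff -> : count_mem true w = M by rewrite eqxx.
apply: (@addnI (count_mem false w)); rewrite -size_word sz; congr (_ + _)%N.
rewrite -(size_fpos 0) -sum_residues; under eq_bigr do rewrite (eqP (H _)).
by rewrite sum_residues size_beads size_pad.
Qed.

Let G : fps {poly int} :=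
  \sum_(w <- words (N + M) | residues_are c f (fpos 0 w)) q ^+ sumn (fpos 0 w).

Lemma abacus_core_gf : eq_upto (T + n0) G (q ^+ T * core_gf).
Proof.
move=> m hm; rewrite coef_qXnM fps_coef_sum.
have sumE w : w \in words (N + M) -> residues_are c f (fpos 0 w) ->
    sumn (fpos 0 w) = (T + sumn (heights 0 w))%N.
  rewrite mem_words => /eqP sz res; rewrite sumn_fpos addnC; congr (binomial _ 2 + _)%N.
  have := residues_are_core_word (sumn (heights 0 w)) sz; rewrite res eqxx /=.
  move=> /esym/and3P[/eqP wt _ _]; apply: (@addIn (count_mem true w)).
  by rewrite -size_word sz wt.
case: leqP => [le|gt]; last first.
  rewrite big1_seq // => w /andP[res hw]; rewrite coef_qX sumE // (ltn_eqF (leq_trans gt _)) //.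
  exact: leq_addr.
have perm := @perm_wpart c (m - T) N M f (core_set c mu (m - T)).
rewrite /= -(perm_size (perm _ _ _)); first last.
- move=> la; split=> [/mem_core_set[sz hp]|[sz res]].
    split=> //; apply/(has_coreP c_gt0 mu_core _ muN) => //.
    by apply: leq_trans (size_parts_le la) _; rewrite sz; move: hm n0N; lia.
  apply/mem_core_set; split=> //; apply/(has_coreP c_gt0 mu_core _ muN) => //.
  by apply: leq_trans (size_parts_le la) _; rewrite sz; move: hm n0N; lia.
- by move: hm n0M; lia.
- by move: hm n0N; lia.
rewrite size_map size_filter -sum1_count natr_sum big_seq_cond [RHS]big_seq_cond.
rewrite big_mkcond [RHS]big_mkcond; apply: eq_bigr => w _.
case: (boolP (w \in _)) => //= hw; have := hw; rewrite mem_words => /eqP sz.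
rewrite -residues_are_core_word //; case: (boolP (residues_are _ _ _)) => //= res.
rewrite coef_qX sumE // -{1}(subnKC le) eqn_add2l eq_sym.
by case: eqP.
Qed.

Let Y : fps {poly int} := \prod_(1 <= j < n0.+1) (1 - q ^+ (j * c)) ^+ c.

Lemma runner_denominator :
  eq_upto n0 (\prod_(i < c) \prod_(j < f i) (1 - q ^+ (c * j.+1))) Y.
Proof.
have -> : Y = \prod_(i < c) \prod_(0 <= j < n0) (1 - q ^+ (c * j.+1)).
  rewrite prodr_const card_ord -prodrXl /Y big_add1 /=.
  by apply: eq_bigr => j _; rewrite mulnC.
apply: eq_upto_prod => i _; rewrite -(big_mkord xpredT (fun j => 1 - q ^+ (c * j.+1))).
rewrite (big_cat_nat _ (n := n0)) //=; last exact: residue_count_ge.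
rewrite -[X in eq_upto _ _ X]mulr1; apply: eq_uptoM => //.
rewrite big_nat_cond; apply: eq_upto_prod1 => j /andP[/andP[le _] _].
apply: eq_upto_one_subX; apply: leq_ltn_trans le _.
exact: leq_pmull.
Qed.

Lemma core_count_bound : eq_upto n0 (core_gf * Y) (q ^+ psize mu).
Proof.
have fN i : (f i <= N)%N by rewrite -(size_pad muN) -size_beads count_size.
pose e := (\sum_(i < c) (i * f i + c * 'C(f i, 2)))%N.
have GE : G * \prod_(i < c) \prod_(j < f i) (1 - q ^+ (c * j.+1)) =
    q ^+ e * \prod_(i < c) \prod_(j < f i) (1 - q ^+ (c * (Q - j))).
  rewrite /G NM (abacus_sum _ c_gt0) -big_split /= /e -prodrXr -big_split /=.
  by apply: eq_bigr => i _; have := @runner_product _ q c c_gt0 i 0 Q (f i) (ltn_ord i); rewrite !muln0 !add0n.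
have RE : eq_upto (T + n0) (\prod_(i < c) \prod_(j < f i) (1 - q ^+ (c * (Q - j)))) 1.
  apply: eq_upto_prod1 => i _; apply: eq_upto_prod1 => j _; apply: eq_upto_one_subX.
  apply: leq_trans (leq_pmull _ c_gt0); have := ltn_ord j; have := fN i; rewrite /Q; lia.
have E : eq_upto (T + n0) (q ^+ T * (core_gf * Y)) (q ^+ e).
  apply: (@eq_upto_trans _ _ _ (q ^+ T * (core_gf * \prod_(i < c) \prod_(j < f i) (1 - q ^+ (c * j.+1))))).
    apply/(eq_upto_mulXn n0 T)/eq_uptoM => //; exact/eq_upto_sym/runner_denominator.
  rewrite mulrA; apply: (@eq_upto_trans _ _ _ (G * \prod_(i < c) \prod_(j < f i) (1 - q ^+ (c * j.+1)))).
    by apply: eq_uptoM => //; apply/eq_upto_sym/abacus_core_gf.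
  by rewrite GE -[X in eq_upto _ _ X]mulr1; apply: eq_uptoM.
have Y0 : fps_coef Y 0 = 1.
  have : eq_upto 0 Y 1.
    rewrite /Y big_nat_cond; apply: eq_upto_prod1 => j /andP[/andP[j0 _] _].
    rewrite -[X in eq_upto _ _ X](expr1n _ c); apply: eq_upto_exp.
    by apply: eq_upto_one_subX; rewrite muln_gt0 j0.
  by move=> /(_ 0%N isT) ->; rewrite fps_coef1.
have lead : fps_coef (core_gf * Y) (psize mu) = 1.
  rewrite fps_coefM big_ord_recr /= subnn Y0 mulr1 big1 => [|i _].
    by rewrite add0r; exact: core_gf_psize.
  by have := core_gf_small (ltn_ord i) => /= ->; rewrite mul0r.
(* [mu] is the only smallest partition with core [mu], so the lowest coefficient
   identifies the exponent. *)
have eE : e = (T + psize mu)%N.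
  have := E (T + psize mu)%N; rewrite leq_add2l mu_n0 coef_qXnM leq_addr addKn lead coef_qX.
  by move=> /(_ isT); case: (_ =P e) => [<- //|_] /eqP; rewrite oner_eq0.
apply/(eq_upto_mulXn n0 T); rewrite -exprD -eE; exact: E.
Qed.

End Bound.
End CoreCount.

(** * Independence of the slope *)

Section Slopes.
Variables (R : realType) (c : nat) (mu : intpart).
Hypotheses (c_gt0 : (0 < c)%N) (mu_core : is_core c mu).
Implicit Types (x y z : \bar R) (n : nat).

Definition plus_pred x (a l : nat) : bool :=
  [&& (c %| (a + l).+1)%N, (efrac R a l.+1 <= x)%E & (x < efrac R a.+1 l)%E].
Definition minus_pred x (a l : nat) : bool :=
  [&& (c %| (a + l).+1)%N, (efrac R a l.+1 < x)%E & (x <= efrac R a.+1 l)%E].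

Lemma hplusE x la : hplus x c la = boxstat (plus_pred x) (parts la).
Proof. exact: card_boxstat. Qed.

Lemma hminusE x la : hminus x c la = boxstat (minus_pred x) (parts la).
Proof. exact: card_boxstat. Qed.

Definition slope (p : nat * nat) : \bar R := (p.1%:R / p.2.+1%:R)%:E.

Lemma efracS a l : efrac R a l.+1 = slope (a, l). Proof. by []. Qed.

Lemma slope_le a b a' b' : (slope (a, b) <= slope (a', b'))%E = (a * b'.+1 <= a' * b.+1)%N.
Proof.
rewrite /slope lee_fin /= ler_pdivrMr ?ltr0Sn // mulrAC ler_pdivlMr ?ltr0Sn //.
by rewrite -!natrM ler_nat.
Qed.

Lemma slope_lt a b a' b' : (slope (a, b) < slope (a', b'))%E = (a * b'.+1 < a' * b.+1)%N.
Proof. by rewrite ltNge slope_le -ltnNge. Qed.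

Lemma lt_efrac a b a' l : (slope (a, b) < efrac R a'.+1 l)%E = (a * l < a'.+1 * b.+1)%N.
Proof. by case: l => [|l]; rewrite ?muln0 ?ltry // efracS slope_lt. Qed.

Lemma le_efrac a b a' l : (slope (a, b) <= efrac R a'.+1 l)%E = (a * l <= a'.+1 * b.+1)%N.
Proof. by case: l => [|l]; rewrite ?muln0 ?leey // efracS slope_le. Qed.

Lemma plus_pred_slope r s a l : plus_pred (slope (r, s)) a l = plus_box c r s.+1 a l.
Proof. by rewrite /plus_pred efracS slope_le lt_efrac /plus_box mulnC ![(_ * s.+1)%N]mulnC. Qed.

Lemma minus_pred_slope r s a l : minus_pred (slope (r, s)) a l = minus_box c r s.+1 a l.
Proof. by rewrite /minus_pred efracS slope_lt le_efrac /minus_box ![(_ * s.+1)%N]mulnC. Qed.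

Lemma eq_boxstat (P Q : nat -> nat -> bool) s n : sorted geq s -> (sumn s <= n)%N ->
  (forall a l, (a < n)%N -> (l < n)%N -> P a l = Q a l) -> boxstat P s = boxstat Q s.
Proof.
elim: s n => [//|x s IHs] n ss hn PQ /=; congr (_ + _)%N; last first.
  by apply: (IHs n); rewrite ?(path_sorted ss) //; apply: leq_trans hn; rewrite /= leq_addl.
rewrite big_nat_cond [RHS]big_nat_cond; apply: eq_bigr => j /andP[/andP[_ jx] _].
rewrite PQ //; first by move: hn jx; rewrite /=; lia.
have : (count (fun k : nat => j < k)%N s <= sumn s)%N.
  by elim: (s) => //= y s' IHs'; case: ltnP; lia.
by move: hn jx; rewrite /=; lia.
Qed.

Definition critical n : seq (\bar R) :=
  [seq slope (i, j) | i <- iota 0 n.+1, j <- iota 0 n.+1].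

Lemma mem_critical n i j : (i <= n)%N -> (j <= n)%N -> slope (i, j) \in critical n.
Proof. by move=> hi hj; apply/allpairsP; exists (i, j); rewrite !mem_iota. Qed.

Definition plus_sum x n : {poly int} := core_stat c mu n (plus_pred x).
Definition minus_sum x n : {poly int} := core_stat c mu n (minus_pred x).

Lemma eq_core_stat n P Q : (forall a l, (a < n)%N -> (l < n)%N -> P a l = Q a l) ->
  core_stat c mu n P = core_stat c mu n Q.
Proof.
move=> PQ; rewrite /core_stat big_seq_cond [RHS]big_seq_cond; apply: eq_bigr => la.
rewrite andbT => /mem_core_set[sz _].
by rewrite (eq_boxstat (parts_sorted la) _ PQ) // -sz.
Qed.

Lemma plus_sum_step x y n : (y <= x)%E ->
  (forall z, z \in critical n -> (z <= x)%E -> (z <= y)%E) -> (x < +oo)%E ->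
  plus_sum x n = plus_sum y n.
Proof.
move=> yx noz xoo; apply: eq_core_stat => a l ha hl; rewrite /plus_pred; congr (_ && (_ && _)).
  apply/idP/idP => [h|h]; last exact: le_trans h yx.
  by apply: noz h; rewrite efracS mem_critical // ltnW.
case: l hl => [|l] hl; first by rewrite xoo (le_lt_trans yx xoo).
apply/idP/idP => [h|h]; first exact: le_lt_trans yx h.
rewrite ltNge; apply/negP => h'; move: h; rewrite ltNge noz //.
by rewrite efracS mem_critical // ltnW // ltnW.
Qed.

Lemma minus_sum_step x y n : (y < x)%E ->
  (forall z, z \in critical n -> (z < x)%E -> (z <= y)%E) ->
  minus_sum x n = plus_sum y n.
Proof.
move=> yx noz; apply: eq_core_stat => a l ha hl.
rewrite /plus_pred /minus_pred; congr (_ && (_ && _)).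
  apply/idP/idP => [h|h]; last exact: le_lt_trans h yx.
  by apply: noz h; rewrite efracS mem_critical // ltnW.
case: l hl => [|l] hl; first by rewrite leey (lt_le_trans yx (leey _)).
apply/idP/idP => [h|h]; first exact: lt_le_trans yx h.
rewrite leNgt; apply/negP => h'; move: h; rewrite ltNge noz //.
by rewrite efracS mem_critical // ltnW // ltnW.
Qed.

Lemma exists_max (s : seq (\bar R)) (P : pred (\bar R)) x0 : x0 \in s -> P x0 ->
  exists y, [/\ y \in s, P y & forall z, z \in s -> P z -> (z <= y)%E].
Proof.
elim: s x0 => [//|x s IHs] x0; rewrite inE.
have [/hasP[x1 x1s Px1] _ _|/hasPn none] := boolP (has P s).
  have [y [ys Py ymax]] := IHs x1 x1s Px1.
  have [Px|nPx] := boolP (P x); last first.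
    exists y; rewrite inE ys orbT; split=> // z; rewrite inE => /orP[/eqP ->|]; last exact: ymax.
    by move=> Px; rewrite Px in nPx.
  have [xy|yx] := leP x y.
    by exists y; rewrite inE ys orbT; split=> // z; rewrite inE => /orP[/eqP ->|/ymax].
  exists x; rewrite inE eqxx; split=> // z; rewrite inE => /orP[/eqP ->//|zs Pz].
  exact: le_trans (ymax _ zs Pz) (ltW yx).
move=> /orP[/eqP ->|x0s] Px; last by move: (none _ x0s); rewrite Px.
exists x; rewrite inE eqxx; split=> // z; rewrite inE => /orP[/eqP ->//|/none nPz Pz].
by rewrite Pz in nPz.
Qed.

Lemma count_ltn (T : eqType) (s : seq T) (a1 a2 : pred T) (e : T) : subpred a1 a2 ->
  e \in s -> a2 e -> ~~ a1 e -> (count a1 s < count a2 s)%N.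
Proof.
move=> sub; elim: s => //= k s IHs; rewrite inE => /orP[/eqP <-|es] h2 h1.
  by rewrite h2 (negPf h1) add0n add1n ltnS sub_count.
by have := IHs es h2 h1; have := sub k; case: (a1 k) => [/(_ isT) ->|_]; case: (a2 k); lia.
Qed.

Lemma slope0 : slope (0%N, 0%N) = 0%E. Proof. by rewrite /slope /= mul0r. Qed.

Lemma plus_sum_const x n : (0 <= x)%E -> (x < +oo)%E -> plus_sum x n = plus_sum 0%E n.
Proof.
have [m] : exists m, (count (fun z => z <= x)%E (critical n) <= m)%N.
  by exists (count (fun z => z <= x)%E (critical n)).
have c0 : (0%E : \bar R) \in critical n by rewrite -slope0 mem_critical.
elim: m x => [|m IHm] x hm x0 xoo.
  by move: hm; rewrite leqNgt -has_count; case/hasP; exists 0%E.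
have [y [yc yx ymax]] := @exists_max (critical n) (fun z => (z <= x)%E) _ c0 x0.
rewrite (@plus_sum_step x y n) //.
have y0 : (0 <= y)%E by apply: ymax.
have [->//|yn0] := eqVneq y 0%E.
have y_gt0 : (0 < y)%E by rewrite lt_neqAle eq_sym yn0.
have -> : plus_sum y n = minus_sum y n.
  move: yc y_gt0 => /allpairsP[[r s] [_ _ ->]] /=; rewrite -slope0 slope_lt mul0n muln1 => r0.
  transitivity (core_stat c mu n (plus_box c r s.+1)).
    by apply: eq_core_stat => a l _ _; rewrite plus_pred_slope.
  rewrite core_stat_plus_minus //.
  by apply: eq_core_stat => a l _ _; rewrite minus_pred_slope.
have [y' [yc' yy' ymax']] := @exists_max (critical n) (fun z => (z < y)%E) _ c0 y_gt0.
rewrite (@minus_sum_step y y') //; apply: IHm.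
- rewrite -ltnS; apply: leq_trans hm; apply: (count_ltn _ yc) => //=.
    by move=> z /= h; apply: le_trans h (le_trans (ltW yy') yx).
  by rewrite -ltNge.
- by apply: ymax'.
- exact: lt_trans yy' (le_lt_trans yx xoo).
Qed.

Lemma minus_sum_const x n : (0 < x)%E -> minus_sum x n = plus_sum 0%E n.
Proof.
move=> x0; have c0 : (0%E : \bar R) \in critical n by rewrite -slope0 mem_critical.
have [y [yc yx ymax]] := @exists_max (critical n) (fun z => (z < x)%E) _ c0 x0.
rewrite (@minus_sum_step x y) // plus_sum_const //; first exact: ymax.
exact: lt_le_trans yx (leey _).
Qed.

Lemma plus_sum0 n : plus_sum 0%E n = wsum c mu tq 0 n.
Proof.
rewrite /plus_sum /core_stat /wsum; apply: eq_bigr => la _; congr (_ ^+ _).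
apply: (eq_boxstat (parts_sorted la) (leqnn _)) => a l _ _.
by rewrite -slope0 plus_pred_slope.
Qed.

End Slopes.

(** * The generating function *)

Section InfiniteProduct.
Variable R : comUnitRingType.
Implicit Types (f g : fps R) (F : nat -> fps R).

Definition fps_prod F : fps R :=
  FPS (fun n => fps_coef (\prod_(1 <= i < n.+1) F i) n).

Lemma eq_upto_fps_prod F n M : (forall i, eq_upto i (F i.+1) 1) -> (n <= M)%N ->
  eq_upto n (fps_prod F) (\prod_(1 <= i < M.+1) F i).
Proof.
move=> F1 nM m mn /=; have mM := leq_trans mn nM.
rewrite (big_cat_nat (n := m.+1) (p := M.+1)) //=.
have tail : eq_upto m (\prod_(m.+1 <= i < M.+1) F i) 1.
  rewrite big_nat_cond; apply: eq_upto_prod1 => -[|i] // /andP[/andP[mi _] _] l lm.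
  by apply: F1; apply: leq_trans lm mi.
have := eq_uptoM (@eq_upto_refl _ m (\prod_(1 <= i < m.+1) F i)) tail.
by rewrite mulr1 => /(_ m (leqnn m)).
Qed.

Lemma fps_has_prodP F : (forall i, eq_upto i (F i.+1) 1) -> fps_has_prod F (fps_prod F).
Proof. by move=> F1 n; exists n => M nM; rewrite (eq_upto_fps_prod F1 nM). Qed.

Lemma fps_unit_coef0 f : fps_coef f 0 = 1 -> f \is a GRing.unit.
Proof.
move=> f0; change (is_true (fps_coef f 0 \is a GRing.unit)).
by rewrite f0 unitr1.
Qed.

Lemma eq_upto_inv1 n f : eq_upto n f 1 -> eq_upto n f^-1 1.
Proof.
move=> f1; have uf : f \is a GRing.unit by rewrite fps_unit_coef0 // f1.
have := eq_uptoM (@eq_upto_refl _ n f^-1) f1.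
by rewrite mulr1 mulVr // => /eq_upto_sym.
Qed.

End InfiniteProduct.

Lemma coef_qt k (a : {poly int}) h n :
  fps_coef (q ^+ k * fps_C a ^+ h) n = if n == k then a ^+ h else 0.
Proof.
have -> : fps_C a ^+ h = fps_C (a ^+ h).
  elim: h => [|h IHh]; first by [].
  by rewrite exprS IHh; apply: fpsP => m; rewrite fps_coefCM /= exprS; case: ifP; rewrite ?mulr0.
rewrite coef_qXnM /= subn_eq0; by case: (ltngtP k n).
Qed.

Lemma fps_has_sum_core c mu (h : intpart -> nat) (S : fps {poly int}) :
  (forall n, fps_coef S n = \sum_(la <- core_set c mu n) tq ^+ h la) ->
  fps_has_sum (Par c mu) (fun la => q ^+ psize la * t ^+ h la) S.
Proof.
move=> Scoef n; exists (core_set c mu n) => [la /mem_core_set[]//|B sub BPar].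
rewrite fps_coef_sum Scoef; under eq_bigr do rewrite coef_qt.
rewrite -big_mkcond -big_filter; apply: perm_big; apply: uniq_perm.
- by rewrite filter_uniq ?fset_uniq.
- exact: fset_uniq.
move=> la; rewrite mem_filter; apply/andP/idP => [[/eqP e laB]|laA].
  by apply/mem_core_set; split; [|apply: BPar].
by have /mem_core_set[-> _] := laA; rewrite eqxx; split=> //; apply: (fsubsetP sub).
Qed.

Theorem theorem3p2 (R : realType) (c : nat) (mu : intpart)
    (c_gt0 : (0 < c)%N) (mu_core : is_core c mu) :
  exists P1 P2 : fps {poly int},
    [/\ fps_has_prod (fun i => ((1 - q ^+ (i * c)) ^+ (c - 1))^-1) P1,
        fps_has_prod (fun j => (1 - q ^+ (j * c) * t)^-1) P2,
        forall x : \bar R, (0 <= x)%E -> (x < +oo)%E ->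
          fps_has_sum (Par c mu)
            (fun la => q ^+ psize la * t ^+ hplus x c la)
            (q ^+ psize mu * P1 * P2)
      & forall x : \bar R, (0 < x)%E ->
          fps_has_sum (Par c mu)
            (fun la => q ^+ psize la * t ^+ hminus x c la)
            (q ^+ psize mu * P1 * P2)].
Proof.
pose u1 i : fps {poly int} := (1 - q ^+ (i * c)) ^+ (c - 1).
pose u2 j : fps {poly int} := 1 - q ^+ (j * c) * t.
have lt_mul i : (i < i.+1 * c)%N by apply: leq_pmulr.
have u1_1 i : eq_upto i (u1 i.+1) 1.
  by rewrite -(expr1n _ (c - 1)); apply/eq_upto_exp/eq_upto_one_subX.
have u2_1 i : eq_upto i (u2 i.+1) 1 by apply: eq_upto_one_sub.
have unit_of (u : nat -> fps {poly int}) i : (forall i, eq_upto i (u i.+1) 1) ->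
    (0 < i)%N -> u i \is a GRing.unit.
  by case: i => // i u_1 _; rewrite fps_unit_coef0 // u_1.
pose P1 := fps_prod (fun i => (u1 i)^-1); pose P2 := fps_prod (fun i => (u2 i)^-1).
have inv_1 u i : (forall i, eq_upto i (u i.+1) 1) -> eq_upto i (u i.+1 : fps {poly int})^-1 1.
  by move=> u_1; apply: eq_upto_inv1.
have prodV (u : nat -> fps {poly int}) M : (forall i, eq_upto i (u i.+1) 1) ->
    eq_upto M (fps_prod (fun i => (u i)^-1) * \prod_(1 <= i < M.+1) u i) 1.
  move=> u_1; apply: (@eq_upto_trans _ _ _
    (\prod_(1 <= i < M.+1) (u i)^-1 * \prod_(1 <= i < M.+1) u i)).
    apply: eq_uptoM => //; apply: eq_upto_fps_prod => // i; exact: inv_1.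
  rewrite -big_split /= big_nat_cond big1 // => i /andP[/andP[i0 _] _].
  by rewrite mulVr // unit_of.
have main n : fps_coef (q ^+ psize mu * P1 * P2) n = wsum c mu tq 0 n.
  pose n0 := (n + psize mu)%N.
  pose D1 := \prod_(1 <= i < n0.+1) u1 i; pose D2 := \prod_(1 <= i < n0.+1) u2 i.
  pose D := \prod_(1 <= j < n0.+1) (1 - q ^+ (j * c) : fps {poly int}).
  have tD : eq_upto n0 (FPS (wsum c mu tq 0) * D2) (core_gf c mu * D).
    have -> : core_gf c mu * D = FPS (wsum c mu 1 n0).
      rewrite -wsum_fps //; congr (_ * _).
        apply: fpsP => m; rewrite /= /wsum /regular_upto /=.
        by under eq_bigr do rewrite expr1n; rewrite big_const_seq count_predT iter_addr_0.
      by apply: eq_bigr => j _; rewrite mulr1.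
    by rewrite wsum_fps // => m hm /=; apply: wsum_regular.
  have cD : eq_upto n0 (core_gf c mu * (D * D1)) (q ^+ psize mu).
    have -> : D * D1 = \prod_(1 <= j < n0.+1) (1 - q ^+ (j * c)) ^+ c.
      rewrite -big_split /=; apply: eq_bigr => j _; rewrite /u1 -exprS.
      by rewrite subn1 prednK.
    by apply: core_count_bound => //; apply: leq_addl.
  have E : eq_upto n0 (q ^+ psize mu * P1 * P2) (FPS (wsum c mu tq 0)).
    apply: (@eq_upto_trans _ _ _ (core_gf c mu * (D * D1) * P1 * P2)).
      by apply: eq_uptoM => //; apply: eq_uptoM => //; apply: eq_upto_sym.
    apply: (@eq_upto_trans _ _ _ (core_gf c mu * D * (P1 * D1) * P2)).
      by rewrite !mulrA (mulrAC _ P1 D1).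
    apply: (@eq_upto_trans _ _ _ (FPS (wsum c mu tq 0) * D2 * 1 * P2)).
      apply: eq_uptoM => //; apply: eq_uptoM; [exact: eq_upto_sym tD | exact: prodV].
    apply: (@eq_upto_trans _ _ _ (FPS (wsum c mu tq 0) * (P2 * D2))).
      by rewrite mulr1 mulrAC mulrA.
    by rewrite -[X in eq_upto _ _ X]mulr1; apply: eq_uptoM => //; apply: prodV.
  by rewrite E // leq_addr.
exists P1, P2; split.
- by apply: fps_has_prodP => i; apply: (inv_1 u1).
- by apply: fps_has_prodP => i; apply: (inv_1 u2).
- move=> x x0 xoo; apply: fps_has_sum_core => n; rewrite main -(plus_sum0 R) //.
  rewrite -(plus_sum_const c_gt0 mu_core n x0 xoo).
  by apply: eq_bigr => la _; rewrite hplusE.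
move=> x x0; apply: fps_has_sum_core => n; rewrite main -(plus_sum0 R) //.
rewrite -(minus_sum_const c_gt0 mu_core n x0).
by apply: eq_bigr => la _; rewrite hminusE.
Qed.
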